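(* Let $\mathcal{A},\mathcal{B}$ be C*-algebras, let $X$ be an $\mathcal{A}$-correspondence and $Y$ a $\mathcal{B}$-correspondence, and let $m\ge1$. Suppose that there are C*-algebras $\mathcal{C}_0=\mathcal{A},\mathcal{C}_1,\dots,\mathcal{C}_{m-1},\mathcal{C}_m=\mathcal{B}$, $\mathcal{C}_{i-1}$-$\mathcal{C}_i$-correspondences $R_i$ and $\mathcal{C}_i$-$\mathcal{C}_{i-1}$-correspondences $S_i$ ($i=1,\dots,m$) such that $$X\cong R_1\otimes S_1,\qquad S_m\otimes R_m\cong Y,\qquad S_i\otimes R_i\cong R_{i+1}\otimes S_{i+1}\ \text{ for } i=1,\dots,m-1. \quad( * )$$ (a) If $X$ and $Y$ are regular, then the C*-algebras $\mathcal{C}_1,\dots,\mathcal{C}_{m-1}$ and the correspondences $R_1,\dots,R_m,S_1,\dots,S_m$ satisfying $( * )$ (with $\mathcal{C}_0=\mathcal{A}$, $\mathcal{C}_m=\mathcal{B}$, and the same $m$) can be chosen so that $S_i\otimes R_i$ (and therefore $R_{i+1}\otimes S_{i+1}$) is regular for every $i=1,\dots,m-1$. (b) If $X$ and $Y$ are both regular and full, then they can be chosen so that $S_i\otimes R_i$ (and therefore $R_{i+1}\otimes S_{i+1}$) is both regular and full for every $i=1,\dots,m-1$.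
   Context: An $\mathcal{A}$-$\mathcal{B}$-correspondence is a right Hilbert $\mathcal{B}$-module $X$ with a $*$-homomorphism $\phi_X:\mathcal{A}\to\mathcal{L}(X)$ (adjointable operators); all correspondences are assumed non-degenerate, i.e. the closed linear span of $\phi_X(\mathcal{A})X$ is $X$. An $\mathcal{A}$-correspondence is an $\mathcal{A}$-$\mathcal{A}$-correspondence. $X$ is full if the closed linear span of $\{\langle\xi,\eta\rangle:\xi,\eta\in X\}$ is $\mathcal{B}$; injective if $\phi_X$ is injective; proper if $\phi_X(\mathcal{A})\subseteq\mathcal{K}(X)$ (the generalized compact operators); regular if injective and proper. $\otimes$ denotes the interior tensor product over the common coefficient C*-algebra. $\cong$ denotes unitary isomorphism: a surjective bimodule map preserving the algebra-valued inner products. *)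

(* Defs.v *)
From HB Require Import structures.
From mathcomp Require Import all_boot all_order all_algebra.
From mathcomp Require Import complex.
From mathcomp Require Import all_classical all_reals all_analysis.

Set Implicit Arguments.
Unset Strict Implicit.
Unset Printing Implicit Defensive.

Import Order.TTheory GRing.Theory Num.Theory.
Import numFieldNormedType.Exports.

Local Open Scope classical_set_scope.
Local Open Scope complex_scope.
Local Open Scope ring_scope.

(* C*-algebras are not assumed to be unital (and may be zero), so the ring
   structures of MathComp, which all have a unit, are not used for the
   product.  Norms of complex normed modules take their values in R[i]. *)
HB.mixin Record isCStarAlgebra (R : realType) A
    of CompleteNormedModule R[i] A := {
  cmul : A -> A -> A;
  star : A -> A;
  cmulA : associative cmul;
  cmulDl : left_distributive cmul +%R;
  cmulDr : right_distributive cmul +%R;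
  cmulZl : forall (c : R[i]) (a b : A), cmul (c *: a) b = c *: cmul a b;
  cmulZr : forall (c : R[i]) (a b : A), cmul a (c *: b) = c *: cmul a b;
  starK : involutive star;
  starD : {morph star : a b / a + b};
  starZ : forall (c : R[i]) (a : A), star (c *: a) = Num.conj c *: star a;
  starM : forall a b : A, star (cmul a b) = cmul (star b) (star a);
  normr_cmul : forall a b : A, `|cmul a b| <= `|a| * `|b|;
  cstar_identity : forall a : A, `|cmul (star a) a| = `|a| ^+ 2
}.

#[short(type="cstarAlgType")]
HB.structure Definition CStarAlgebra (R : realType) :=
  {A of isCStarAlgebra R A & CompleteNormedModule R[i] A}.

Definition cpositive (R : realType) (A : cstarAlgType R) (a : A) : Prop :=
  exists b : A, a = cmul (star b) b.

(* Right Hilbert modules, with inner product conjugate linear in the first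
   argument; the norm and its completeness are those of the underlying complex
   Banach space, and [normr_inner] says that it is the norm of the inner
   product (in particular [inner] is definite). *)
HB.mixin Record isHilbertModule (R : realType) (B : cstarAlgType R) X
    of CompleteNormedModule R[i] X := {
  ract : X -> B -> X;
  inner : X -> X -> B;
  ractDl : forall (x y : X) (b : B), ract (x + y) b = ract x b + ract y b;
  ractDr : forall (x : X) (b c : B), ract x (b + c) = ract x b + ract x c;
  ractZl : forall (k : R[i]) (x : X) (b : B), ract (k *: x) b = k *: ract x b;
  ractZr : forall (k : R[i]) (x : X) (b : B), ract x (k *: b) = k *: ract x b;
  ractM : forall (x : X) (b c : B), ract x (cmul b c) = ract (ract x b) c;
  innerDr : forall x y z : X, inner x (y + z) = inner x y + inner x z;
  innerZr : forall (k : R[i]) (x y : X), inner x (k *: y) = k *: inner x y;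
  inner_ract : forall (x y : X) (b : B), inner x (ract y b) = cmul (inner x y) b;
  inner_star : forall x y : X, star (inner x y) = inner y x;
  inner_ge0 : forall x : X, cpositive (inner x x);
  normr_inner : forall x : X, `|x| ^+ 2 = `|inner x x|
}.

#[short(type="hilbertModType")]
HB.structure Definition HilbertModule (R : realType) (B : cstarAlgType R) :=
  {X of isHilbertModule R B X & CompleteNormedModule R[i] X}.

Definition lin_span (R : realType) (V : lmodType R[i]) (S : set V) : set V :=
  [set v | exists (n : nat) (c : 'I_n -> R[i]) (s : 'I_n -> V),
     (forall i, S (s i)) /\ v = \sum_(i < n) c i *: s i].

Definition closed_span (R : realType) (V : normedModType R[i]) (S : set V) :
  set V := closure (lin_span S).

Section Operators.
Variables (R : realType) (B : cstarAlgType R) (X : hilbertModType B).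

Definition adjoint_pair (T T' : X -> X) : Prop :=
  forall x y : X, inner (T x) y = inner x (T' y).

Definition adjointable (T : X -> X) : Prop := exists T', adjoint_pair T T'.

Definition rank1 (xi eta : X) : X -> X := fun z => ract xi (inner eta z).

(* The finite rank operators, a subspace of the pointwise module X -> X. *)
Definition finite_rank : set (X -> X) :=
  lin_span [set T : X -> X | exists xi eta : X, T = rank1 xi eta].

(* The closure of the finite rank operators for the operator norm of L(X);
   the inequality for all z says that the operator norm of T - F is at most
   e. *)
Definition gen_compact (T : X -> X) : Prop :=
  adjointable T /\
  forall e : R[i], 0 < e ->
    exists2 F : X -> X, finite_rank F & forall z : X, `|T z - F z| <= e * `|z|.

End Operators.

(* The left action [lact] is the *-homomorphism phi : A -> L(X), written
   phi(a)x = lact a x; [lact_star] says both that phi(a) is adjointable and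
   that phi preserves the involution.  Adjointability makes each phi(a)
   linear, bounded and B-linear. *)
HB.mixin Record isCorrespondence (R : realType) (A B : cstarAlgType R) X
    of HilbertModule R B X := {
  lact : A -> X -> X;
  lactD : forall (a b : A) (x : X), lact (a + b) x = lact a x + lact b x;
  lactZ : forall (k : R[i]) (a : A) (x : X), lact (k *: a) x = k *: lact a x;
  lactM : forall (a b : A) (x : X), lact (cmul a b) x = lact a (lact b x);
  lact_star : forall a : A, adjoint_pair (lact a) (lact (star a));
  lact_nondegenerate :
    closed_span [set z : X | exists (a : A) (x : X), z = lact a x] = setT
}.

#[short(type="corrType")]
HB.structure Definition Correspondence (R : realType) (A B : cstarAlgType R) :=
  {X of isCorrespondence R A B X & HilbertModule R B X}.

Section Correspondences.
Variables (R : realType) (A B : cstarAlgType R).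
Implicit Types X Y : corrType A B.

Definition full X : Prop :=
  closed_span [set b : B | exists x y : X, b = inner x y] = setT.

Definition corr_injective X : Prop :=
  injective (fun (a : A) (x : X) => lact a x).

Definition corr_proper X : Prop :=
  forall a : A, gen_compact (fun x : X => lact a x).

Definition regular X : Prop := corr_injective X /\ corr_proper X.

Definition unitarily_isomorphic X Y : Prop :=
  exists U : {linear X -> Y},
    [/\ forall y : Y, exists x : X, U x = y,
        forall (a : A) (x : X), U (lact a x) = lact a (U x),
        forall (x : X) (b : B), U (ract x b) = ract (U x) b &
        forall x y : X, inner (U x) (U y) = inner x y].

End Correspondences.

(* [interior_tensor X Y T]: the correspondence T is the interior tensor product
   of X and Y over B, with elementary tensors t x y.  The last two clauses say
   that T is the Hausdorff completion of the algebraic balanced tensor product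
   for the semi-inner product
     <x (x) y, x' (x) y'> = <y, <x, x'> y'>,
   which determines T up to a unique unitary isomorphism compatible with the
   elementary tensors. *)
Definition interior_tensor (R : realType) (A B C : cstarAlgType R)
    (X : corrType A B) (Y : corrType B C) (T : corrType A C) : Prop :=
  exists t : X -> Y -> T,
    (forall (k : R[i]) x x' y, t (k *: x + x') y = k *: t x y + t x' y) /\
    (forall (k : R[i]) x y y', t x (k *: y + y') = k *: t x y + t x y') /\
    (forall x (b : B) y, t (ract x b) y = t x (lact b y)) /\
    (forall (a : A) x y, lact a (t x y) = t (lact a x) y) /\
    (forall x y (c : C), ract (t x y) c = t x (ract y c)) /\
    (forall x x' y y', inner (t x y) (t x' y') = inner y (lact (inner x x') y')) /\
    closed_span [set z : T | exists x y, z = t x y] = setT.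

(* Z ~= X (x) Y *)
Definition iso_tensor (R : realType) (A B C : cstarAlgType R)
    (Z : corrType A C) (X : corrType A B) (Y : corrType B C) : Prop :=
  exists2 T : corrType A C, interior_tensor X Y T & unitarily_isomorphic Z T.

(* X (x) Y ~= X' (x) Y' *)
Definition tensor_iso_tensor (R : realType) (A B B' C : cstarAlgType R)
    (X : corrType A B) (Y : corrType B C)
    (X' : corrType A B') (Y' : corrType B' C) : Prop :=
  exists2 T : corrType A C, interior_tensor X Y T & iso_tensor T X' Y'.

(* Every interior tensor product of X and Y has the property P; since the
   interior tensor product is unique up to unitary isomorphism, this is the
   property P of X (x) Y for isomorphism invariant P such as being regular or
   full. *)
Definition tensor_has (R : realType) (A B C : cstarAlgType R)
    (X : corrType A B) (Y : corrType B C) (P : corrType A C -> Prop) : Prop :=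
  forall T : corrType A C, interior_tensor X Y T -> P T.

(* The algebras C_0 = A, ..., C_m = B are [alg 0], ..., [alg m]; the
   correspondences R_i and S_i, for i = 1, ..., m, are [corR i.-1] and
   [corS i.-1].  The values at larger indices play no role. *)
Record chain (R : realType) (A B : cstarAlgType R) (m : nat) := Chain {
  alg : nat -> cstarAlgType R;
  alg_first : A = alg 0%N;
  alg_last : B = alg m;
  corR : forall i : nat, corrType (alg i) (alg i.+1);
  corS : forall i : nat, corrType (alg i.+1) (alg i)
}.

Definition transport_corr (R : realType) (A B : cstarAlgType R) (e : A = B)
    (X : corrType A A) : corrType B B :=
  match e in _ = D return corrType D D with erefl => X end.

(* The condition on a chain of length m = n.+1:
   X ~= R_1 (x) S_1,  S_m (x) R_m ~= Y,  and
   S_i (x) R_i ~= R_{i+1} (x) S_{i+1}  for  1 <= i <= m - 1. *)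
Definition chain_links (R : realType) (A B : cstarAlgType R) (n : nat)
    (X : corrType A A) (Y : corrType B B) (c : chain A B n.+1) : Prop :=
  [/\ iso_tensor (transport_corr (alg_first c) X) (corR c 0) (corS c 0),
      iso_tensor (transport_corr (alg_last c) Y) (corS c n) (corR c n) &
      forall i : nat, (i < n)%N ->
        tensor_iso_tensor (corS c i) (corR c i) (corR c i.+1) (corS c i.+1)].

(* Main.v *)
(* For a correspondence Z and ideals I, J let pull Z I be the ideal of all a with
   <z, a z'> in I for all z, z', and push Z J the closed span of <Z, J Z>; both
   are compatible with tensor products.  Pulling 0 back along S_i, ..., S_1 gives
   ideals I_i of C_i, and injectivity of X and Y makes them compatible with all
   R_i, S_i and zero at both ends.  Pushing A forward along R_1, ..., R_i and B
   along S_m, ..., S_(i+1) gives two ideals of C_i; let J_i be the ideal that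
   they generate.  The new chain consists of the images of J_i in C_i / I_i and
   of the correspondences induced on them, which now act injectively.

   Compactness: if a acts compactly on Z (x) Z', then <r, a r'> acts compactly on
   Z', being T_r^* a T_r' with T_r y = r (x) y, and, if Z' is injective, a acts
   compactly on Z.  The first fact passes from Z (x) Z' to Z' (x) Z, so that both
   generating ideals of C_i act compactly on the next correspondence.  In the
   full case the first of them is already the whole algebra. *)

Require Import Defs.
From HB Require Import structures.
From mathcomp Require Import all_boot all_order all_algebra.
From mathcomp Require Import complex.
From mathcomp Require Import all_classical all_reals all_analysis.
From mathcomp Require Import lra ring.

Set Implicit Arguments.
Unset Strict Implicit.
Unset Printing Implicit Defensive.

Import Order.TTheory GRing.Theory Num.Theory.
Import numFieldNormedType.Exports.

Local Open Scope classical_set_scope.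
Local Open Scope complex_scope.
Local Open Scope ring_scope.

(** * Real-valued norms *)

(** No single [R_i] or [S_i] is assumed injective, proper or full; only the two end products are
    controlled, so each property has to travel through the links. One pushed family of ideals would
    not do: pushing only [A] forward ends in an ideal of [B] that may be proper without fullness,
    and pushing only [B] back has the same defect at [A]. The ideal generated by both keeps both end
    algebras whole. Since [J_i] need not contain [I_i], the reduced algebra is [J_i / (J_i /\ I_i)].
    A correspondence is cut down to the closed span of [J_i Z], which keeps it non-degenerate, and
    divided by the vectors that are null modulo the ideal of the right algebra. The algebras need
    not be unital and no spectrum is used. Square roots come from an iteration in the unitization,
    approximate units have the form [1 - (1 - b)^n], and the isometry of injective actions, on which
    the second compactness fact rests, comes from comparing the growth of powers with Bernoulli's
    inequality. *)

(* Norms in [Defs] take their values in the partially ordered field [R[i]];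
   [nm] is the same norm as an element of [R], where [lra] applies. *)
Definition nm (R : realType) (V : normedZmodType R[i]) (x : V) : R :=
  complex.Re `|x|.

Section RealNorm.
Variable R : realType.

Lemma nmE (V : normedZmodType R[i]) (x : V) : `|x| = (nm x)%:C.
Proof. by rewrite /nm RRe_real // ger0_real // normr_ge0. Qed.

Section Zmod.
Variable V : normedZmodType R[i].
Implicit Types x y z : V.

Lemma nm_ge0 x : 0 <= nm x.
Proof. by rewrite -lecR -nmE normr_ge0. Qed.

Lemma nm0 : nm (0 : V) = 0.
Proof. by rewrite /nm normr0. Qed.

Lemma nm_eq0 x : nm x = 0 -> x = 0.
Proof. by move=> h; apply/normr0_eq0; rewrite nmE h. Qed.

Lemma nm_gt0 x : nm x != 0 -> 0 < nm x.
Proof. by rewrite lt_neqAle eq_sym nm_ge0 andbT. Qed.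

Lemma nmN x : nm (- x) = nm x.
Proof. by rewrite /nm normrN. Qed.

Lemma nmD x y : nm (x + y) <= nm x + nm y.
Proof. by rewrite -lecR rmorphD /= -!nmE ler_normD. Qed.

Lemma nmB x y : nm (x - y) <= nm x + nm y.
Proof. by rewrite -(nmN y) nmD. Qed.

Lemma nm_distC x y : nm (x - y) = nm (y - x).
Proof. by rewrite -nmN opprB. Qed.

Lemma nm_tri x y z : nm (x - z) <= nm (x - y) + nm (y - z).
Proof. by rewrite (le_trans _ (nmD _ _)) // addrA subrK. Qed.

Lemma nm_subr x y : nm x <= nm (x - y) + nm y.
Proof. by rewrite (le_trans _ (nmD _ _)) // subrK. Qed.

Lemma nm_sum I (r : seq I) (F : I -> V) : nm (\sum_(i <- r) F i) <= \sum_(i <- r) nm (F i).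
Proof.
elim: r => [|i r IH]; first by rewrite !big_nil nm0.
by rewrite !big_cons (le_trans (nmD _ _)) // lerD2l.
Qed.

Lemma nm_small x : (forall e : R, 0 < e -> nm x <= e) -> x = 0.
Proof.
move=> h; apply: nm_eq0; apply/eqP; rewrite eq_le nm_ge0 andbT.
by apply/ler_addgt0Pr => e /h; rewrite add0r.
Qed.

End Zmod.

Lemma nmZ (V : normedModType R[i]) (c : R[i]) (x : V) : nm (c *: x) = nm c * nm x.
Proof.
apply: (@complexI R); rewrite rmorphM /= -[LHS]nmE normrZ.
by rewrite (nmE x) (nmE (c : R[i])).
Qed.

Lemma nmC (c : R) : nm (c%:C : R[i]) = `|c|.
Proof. by rewrite /nm normc_def /= expr0n /= addr0 sqrtr_sqr. Qed.

Lemma nmCM (c d : R[i]) : nm (c * d) = nm c * nm d.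
Proof. by apply: (@complexI R); rewrite rmorphM /= -!nmE normrM. Qed.

Lemma nmV (c : R[i]) : nm c^-1 = (nm c)^-1.
Proof. by apply: (@complexI R); rewrite fmorphV /= -!nmE normfV. Qed.

Lemma nmCJ (c : R[i]) : nm (Num.conj c) = nm c.
Proof. by rewrite /nm norm_conjC. Qed.

Lemma nmZr (V : normedModType R[i]) (c : R) (x : V) : 0 <= c -> nm (c%:C *: x) = c * nm x.
Proof. by move=> c0; rewrite nmZ nmC ger0_norm. Qed.

Lemma mul_div_succ (c e : R) : 0 <= c -> 0 < e -> c * (e / (c + 1)) <= e.
Proof.
move=> c0 e0; have c1 : 0 < c + 1 by rewrite ltr_wpDl.
by rewrite mulrCA ler_piMr ?(ltW e0) // ler_pdivrMr // mul1r lerDl.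
Qed.

Lemma inv_succ_small (e : R) : 0 < e ->
  exists N, forall n, (N <= n)%N -> n.+1%:R^-1 < e.
Proof.
move=> e0; exists (Num.trunc e^-1) => n hn; rewrite invf_plt ?posrE ?ltr0n //.
by rewrite (lt_le_trans (truncnS_gt _)) // ler_nat.
Qed.

Lemma div_succ_gt0 (c e : R) : 0 <= c -> 0 < e -> 0 < e / (c + 1).
Proof. by move=> c0 e0; rewrite divr_gt0 // ltr_wpDl. Qed.

(** * Closed subspaces *)

Section LinSpan.
Variable V : lmodType R[i].
Implicit Types (S : set V) (x y : V).

Lemma lin_span_gen S x : S x -> lin_span S x.
Proof.
move=> Sx; exists 1%N, (fun=> 1), (fun=> x); split=> //.
by rewrite big_ord1 scale1r.
Qed.

Lemma lin_spanD S x y :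
  lin_span S x -> lin_span S y -> lin_span S (x + y).
Proof.
move=> [n [c [s [Ss ->]]]] [m [d [t [St ->]]]].
exists (n + m)%N, (fun i => match fintype.split i with inl j => c j | inr j => d j end),
  (fun i => match fintype.split i with inl j => s j | inr j => t j end); split.
  by move=> i; case: (fintype.split i).
rewrite big_split_ord /=; congr (_ + _); apply: eq_bigr => i _.
  by rewrite -/(unsplit (inl i)) unsplitK.
by rewrite -/(unsplit (inr i)) unsplitK.
Qed.

Lemma lin_spanZ S k x :
  lin_span S x -> lin_span S (k *: x).
Proof.
move=> [n [c [s [Ss ->]]]]; exists n, (fun i => k * c i), s; split=> //.
by rewrite scaler_sumr; apply: eq_bigr => i _; rewrite scalerA.
Qed.

Lemma lin_span0 S : lin_span S 0.
Proof.
by exists 0%N, (fun=> 0), (fun=> 0); split; [case | rewrite big_ord0].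
Qed.

End LinSpan.

Section ClosedSubspaces.
Variable V : normedModType R[i].
Implicit Types (P Q : V -> Prop) (S : set V) (x y : V).

Lemma closure_nm S x :
  closure S x <-> forall e : R, 0 < e -> exists2 y, S y & nm (x - y) < e.
Proof.
split=> [h e e0|h B /nbhs_ballP[e /= e0 eB]].
  have [|y [Sy]] := h (ball x e%:C); first by apply: nbhsx_ballx; rewrite ltcR.
  by rewrite -ball_normE /ball_/= nmE ltcR => ?; exists y.
have [|y Sy xy] := h (complex.Re e).
  by rewrite -ltcR RRe_real ?gtr0_real.
exists y; split=> //; apply: eB; rewrite -ball_normE /ball_/= nmE.
by rewrite -[e]RRe_real ?gtr0_real // ltcR.
Qed.

Definition closed_subspace P : Prop :=
  [/\ P 0, forall x y, P x -> P y -> P (x + y), forall c x, P x -> P (c *: x) &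
   forall x, (forall e : R, 0 < e -> exists2 y, P y & nm (x - y) < e) -> P x].

Lemma closed_span_subspace S :
  closed_subspace (closed_span S).
Proof.
split.
- by apply: subset_closure; apply: lin_span0.
- move=> x y /closure_nm hx /closure_nm hy; apply/closure_nm => e e0.
  have e2 : 0 < e / 2 by lra.
  have [x' Sx xx] := hx _ e2; have [y' Sy yy] := hy _ e2.
  exists (x' + y'); first exact: lin_spanD.
  by rewrite opprD addrACA (le_lt_trans (nmD _ _)) //; lra.
- move=> c x /closure_nm hx; apply/closure_nm => e e0.
  have c1 : 0 < nm c + 1 by have := nm_ge0 c; lra.
  have [|x' Sx xx] := hx (e / (nm c + 1)); first by rewrite divr_gt0.
  exists (c *: x'); first exact: lin_spanZ.
  rewrite -scalerBr nmZ (le_lt_trans (y := (nm c + 1) * nm (x - x'))) //.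
    by rewrite ler_wpM2r ?nm_ge0 //; lra.
  by rewrite mulrC -ltr_pdivlMr.
- move=> x hx; apply/closure_nm => e e0.
  have e2 : 0 < e / 2 by lra.
  have [y /closure_nm hy xy] := hx _ e2; have [z Sz yz] := hy _ e2.
  by exists z => //; rewrite (le_lt_trans (nm_tri _ y _)) //; lra.
Qed.

Lemma closed_span_gen S x : S x -> closed_span S x.
Proof. by move=> Sx; apply: subset_closure; apply: lin_span_gen. Qed.

Lemma subspace_sum P n (F : 'I_n -> V) :
  closed_subspace P -> (forall i, P (F i)) -> P (\sum_i F i).
Proof. by move=> [P0 PD _ _] PF; elim/big_ind: _. Qed.

(** The induction principle for closed spans; most density arguments below reduce to it. *)
Lemma closed_span_min S P :
  closed_subspace P -> (forall x, S x -> P x) -> forall x, closed_span S x -> P x.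
Proof.
move=> cP SP x /closure_nm hx; case: (cP) => _ _ PZ Pcl; apply: Pcl => e /hx.
move=> [y [n [c [s [Ss ->]]]] xy]; exists (\sum_(i < n) c i *: s i) => //.
by apply: subspace_sum => // i; apply: PZ; apply: SP.
Qed.

Lemma subspaceB P x y :
  closed_subspace P -> P x -> P y -> P (x - y).
Proof.
by case=> _ PD PZ _ Px Py; apply: PD => //; rewrite -scaleN1r; apply: PZ.
Qed.

Lemma subspace_approx P x : closed_subspace P ->
  (forall e : R, 0 < e -> exists2 y, P y & nm (x - y) <= e) -> P x.
Proof.
case=> _ _ _ Pcl h; apply: Pcl => e e0.
have e2 : 0 < e / 2 by lra.
by have [y Py ?] := h _ e2; exists y => //; lra.
Qed.

Lemma subspace0 : closed_subspace (fun x : V => x = 0).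
Proof.
split=> //.
- by move=> x y -> ->; rewrite addr0.
- by move=> c x ->; rewrite scaler0.
- move=> x h; apply: nm_small => e /h[y ->]; rewrite subr0 => /ltW //.
Qed.

Lemma subspaceT : closed_subspace (fun x : V => True).
Proof. by split. Qed.

Lemma subspaceI P Q :
  closed_subspace P -> closed_subspace Q -> closed_subspace (fun x => P x /\ Q x).
Proof.
move=> [P0 PD PZ Pcl] [Q0 QD QZ Qcl]; split=> //.
- by move=> x y [? ?] [? ?]; split; [apply: PD | apply: QD].
- by move=> c x [? ?]; split; [apply: PZ | apply: QZ].
- move=> x h; split; [apply: Pcl | apply: Qcl] => e /h[y [? ?] ?]; by exists y.
Qed.

Lemma subspace_forall T (P : T -> V -> Prop) :
  (forall t, closed_subspace (P t)) -> closed_subspace (fun x => forall t, P t x).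
Proof.
move=> h; split.
- by move=> t; have [] := h t.
- by move=> x y Px Py t; have [_ hD _ _] := h t; apply: hD.
- by move=> c x Px t; have [_ _ hZ _] := h t; apply: hZ.
- by move=> x hx t; have [_ _ _ hc] := h t; apply: hc => e /hx[y Py]; exists y.
Qed.

End ClosedSubspaces.

(* The second assumption on [f] also covers conjugate linear maps. *)
Lemma subspace_preim (V W : normedModType R[i]) (f : V -> W) (M : R) (P : W -> Prop) :
  closed_subspace P -> (forall x y, f (x + y) = f x + f y) ->
  (forall c x, exists d, f (c *: x) = d *: f x) ->
  (forall x, nm (f x) <= M * nm x) -> closed_subspace (fun x => P (f x)).
Proof.
move=> [P0 PD PZ Pcl] fD fZ fb.
have f0 : f 0 = 0 by apply: (addrI (f 0)); rewrite -fD !addr0.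
have fN x : f (- x) = - f x by apply: (addrI (f x)); rewrite -fD !subrr f0.
split; first by rewrite f0.
- by move=> x y; rewrite fD; apply: PD.
- by move=> c x Px; have [d ->] := fZ c x; apply: PZ.
- move=> x hx; apply: Pcl => e e0.
  have M1 : 0 < `|M| + 1 by have := normr_ge0 M; lra.
  have [|y Py xy] := hx (e / (`|M| + 1)); first by rewrite divr_gt0.
  exists (f y) => //; rewrite -fN -fD (le_lt_trans (fb _)) //.
  rewrite (le_lt_trans (y := (`|M| + 1) * nm (x - y))) //.
    by rewrite ler_wpM2r ?nm_ge0 //; have := ler_norm M; lra.
  by rewrite mulrC -ltr_pdivlMr.
Qed.

(** * Completeness by sequences *)

Definition seq_lim (V : normedZmodType R[i]) (u : nat -> V) (l : V) : Prop :=
  forall e : R, 0 < e -> exists N, forall n, (N <= n)%N -> nm (u n - l) <= e.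

Definition seq_cauchy (V : normedZmodType R[i]) (u : nat -> V) : Prop :=
  forall e : R, 0 < e ->
    exists N, forall m n, (N <= m)%N -> (N <= n)%N -> nm (u m - u n) <= e.

Lemma seq_complete (V : completeNormedModType R[i]) (u : nat -> V) :
  seq_cauchy u -> exists l, seq_lim u l.
Proof.
move=> cu; have cu' : cvg (u @ \oo).
  apply/cauchy_cvgP/cauchy_ballP => e e0.
  have e0' : 0 < complex.Re e by rewrite -ltcR RRe_real ?gtr0_real.
  have [|N hN] := cu (complex.Re e / 2); first by lra.
  exists (u @` [set n | (N <= n)%N], u @` [set n | (N <= n)%N]).
    by split; exists N => // n Nn; exists n.
  move=> [_ _] /= [[m hm <-] [n hn <-]]; rewrite -ball_normE /ball_/= nmE.
  rewrite -[e]RRe_real ?gtr0_real // ltcR.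
  by have := hN _ _ hm hn; lra.
exists (lim (u @ \oo)) => e e0.
have /cvgrPdist_lt := cu'.
move=> /(_ e%:C); rewrite ltcR => /(_ e0)[N _ hN]; exists N => n /hN /=.
by rewrite nmE ltcR nm_distC => /ltW.
Qed.

Section SeqLim.
Variable V : normedModType R[i].
Implicit Types (u v : nat -> V) (l : V).

Lemma seq_lim_uniq u l l' : seq_lim u l -> seq_lim u l' -> l = l'.
Proof.
move=> h h'; apply/eqP; rewrite -subr_eq0; apply/eqP/nm_small => e e0.
have e2 : 0 < e / 2 by lra.
have [N hN] := h _ e2; have [N' hN'] := h' _ e2.
have := hN (maxn N N') (leq_maxl _ _); have := hN' (maxn N N') (leq_maxr _ _).
have := nm_tri l (u (maxn N N')) l'; rewrite (nm_distC l (u _)); lra.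
Qed.

Lemma seq_limD u v l l' : seq_lim u l -> seq_lim v l' ->
  seq_lim (fun n => u n + v n) (l + l').
Proof.
move=> h h' e e0; have e2 : 0 < e / 2 by lra.
have [N hN] := h _ e2; have [N' hN'] := h' _ e2.
exists (maxn N N') => n; rewrite geq_max => /andP[/hN a /hN' b].
by rewrite opprD addrACA (le_trans (nmD _ _)) //; lra.
Qed.

Lemma seq_lim_map (W : normedModType R[i]) (f : V -> W) (M : R) u l :
  (forall x y, nm (f x - f y) <= M * nm (x - y)) -> seq_lim u l ->
  seq_lim (fun n => f (u n)) (f l).
Proof.
move=> fM h e e0; have M1 : 0 < `|M| + 1 by have := normr_ge0 M; lra.
have [|N hN] := h (e / (`|M| + 1)); first by rewrite divr_gt0.
exists N => n /hN; rewrite ler_pdivlMr // mulrC => h1.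
rewrite (le_trans (fM _ _)) // (le_trans _ h1) // ler_wpM2r ?nm_ge0 //.
by have := ler_norm M; lra.
Qed.

Lemma seq_lim_cst (l : V) : seq_lim (fun=> l) l.
Proof. by move=> e e0; exists 0%N => n _; rewrite subrr nm0 ltW. Qed.

Lemma seq_lim_shift u l : seq_lim u l -> seq_lim (fun n => u n.+1) l.
Proof. by move=> h e /h[N hN]; exists N => n hn; apply: hN; apply: leqW. Qed.

Lemma seq_lim_bound u l M : seq_lim u l -> (forall n, nm (u n) <= M) -> nm l <= M.
Proof.
move=> h hM; apply/ler_addgt0Pr => e /h[N /(_ N (leqnn _))].
rewrite nm_distC; have := hM N; have := nm_subr l (u N); lra.
Qed.

End SeqLim.

(** * Banach spaces from a real-valued norm *)

(** Completeness is asked for sequences only; filters are treated once, in [banach_complete]. The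
    unitization and the quotients are both built from this record. *)
Record banach_data := BanachData {
  bd_lmod : lmodType R[i];
  bd_nm : bd_lmod -> R;
  bd_nmD : forall x y, bd_nm (x + y) <= bd_nm x + bd_nm y;
  bd_nmZ : forall c x, bd_nm (c *: x) = nm c * bd_nm x;
  bd_nm0 : forall x, bd_nm x = 0 -> x = 0;
  bd_complete : forall u : nat -> bd_lmod,
    (forall e : R, 0 < e -> exists N, forall m n, (N <= m)%N -> (N <= n)%N ->
       bd_nm (u m - u n) <= e) ->
    exists l, forall e : R, 0 < e -> exists N, forall n, (N <= n)%N ->
       bd_nm (u n - l) <= e
}.

End RealNorm.

Definition banach_of (R : realType) (b : banach_data R) : Type := bd_lmod b.

Section BanachOf.
Variables (R : realType) (b : banach_data R).
HB.instance Definition _ := GRing.Lmodule.on (banach_of b).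

Let norm (x : banach_of b) : R[i] := (bd_nm x)%:C.

Let normD x y : norm (x + y) <= norm x + norm y.
Proof. by rewrite /norm -rmorphD lecR bd_nmD. Qed.

Let normZ (c : R[i]) x : norm (c *: x) = `|c| * norm x.
Proof. by rewrite /norm bd_nmZ rmorphM /= -nmE. Qed.

Let norm0 x : norm x = 0 -> x = 0.
Proof. by move=> h; apply: (@bd_nm0 R b); apply: (@complexI R). Qed.

HB.instance Definition _ :=
  Lmodule_isNormed.Build R[i] (banach_of b) normD normZ norm0.

Lemma nm_banach_of (x : banach_of b) : nm x = bd_nm x.
Proof. by []. Qed.

(** For each [n] a Cauchy filter contains a ball of radius [1/(n+1)]. The centres form a Cauchy
    sequence because two members of the filter meet, and its limit is a limit of the filter. *)
Lemma banach_complete (F : set_system (banach_of b)) :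
  ProperFilter F -> cauchy F -> cvg F.
Proof.
move=> FF /cauchy_ballP Fc; have Fc' (n : nat) : exists x : banach_of b,
    F [set y | nm (x - y) < n.+1%:R^-1].
  have e0 : 0 < (n.+1%:R^-1 : R)%:C by rewrite ltcR invr_gt0.
  have [[P Q] [/= FP FQ] PQ] := Fc _ e0.
  have [x Px] := filter_ex FP; exists x; apply: filterS FQ => y Qy.
  by have := PQ (x, y) (conj Px Qy); rewrite /= -ball_normE /ball_ /= nmE ltcR.
have [u hu] := choice Fc'.
have cu (m n : nat) : nm (u m - u n) <= m.+1%:R^-1 + n.+1%:R^-1.
  have [x [h1 h2]] := filter_ex (filterI (hu m) (hu n)).
  apply: le_trans (nm_tri (u m) x (u n)) _.
  by rewrite lerD //; [apply: ltW h1 | rewrite nm_distC; apply: ltW h2].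
have [l hl] : exists l : banach_of b, seq_lim u l.
  apply: (@bd_complete R b u).
  move=> e e0; have [|N hN] := @inv_succ_small R (e / 2); first by lra.
  exists N => m n /hN hm /hN hn; apply: le_trans (cu m n) _.
  by rewrite (splitr e) lerD // ltW.
apply/cvg_ex; exists l; apply/cvgrPdist_lt => e e0.
have e0' : 0 < complex.Re e by rewrite -ltcR RRe_real ?gtr0_real.
have [|N hN] := @inv_succ_small R (complex.Re e / 2); first by lra.
have [|N' hN'] := hl (complex.Re e / 2); first by lra.
have h1 := hN' (maxn N N') (leq_maxr _ _).
have h2 := hN _ (leq_maxl N N').
apply: filterS (hu (maxn N N')) => y /= h3.
rewrite nmE -[e]RRe_real ?gtr0_real // ltcR.
apply: le_lt_trans (nm_tri l (u (maxn N N')) y) _.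
rewrite (splitr (complex.Re e)) ler_ltD //; first by rewrite nm_distC.
exact: lt_trans h3 h2.
Qed.

HB.instance Definition _ := Uniform_isComplete.Build (banach_of b) banach_complete.

End BanachOf.

(** * The unitization of a C*-algebra *)

Section CStarBasics.
Variables (R : realType) (A : cstarAlgType R).
Implicit Types a b : A.

Lemma cmul0l a : cmul 0 a = 0.
Proof. by apply: (addrI (cmul 0 a)); rewrite -cmulDl !addr0. Qed.

Lemma cmul0r a : cmul a 0 = 0.
Proof. by apply: (addrI (cmul a 0)); rewrite -cmulDr !addr0. Qed.

Lemma cmulNl a b : cmul (- a) b = - cmul a b.
Proof. by apply: (addrI (cmul a b)); rewrite -cmulDl !subrr cmul0l. Qed.

Lemma cmulNr a b : cmul a (- b) = - cmul a b.
Proof. by apply: (addrI (cmul a b)); rewrite -cmulDr !subrr cmul0r. Qed.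

Lemma star0 : star (0 : A) = 0.
Proof. by apply: (addrI (star 0)); rewrite -starD !addr0. Qed.

Lemma starN a : star (- a) = - star a.
Proof. by apply: (addrI (star a)); rewrite -starD !subrr star0. Qed.

Lemma starB a b : star (a - b) = star a - star b.
Proof. by rewrite starD starN. Qed.

Lemma nm_cmul a b : nm (cmul a b) <= nm a * nm b.
Proof. by rewrite -lecR rmorphM /= -!nmE normr_cmul. Qed.

Lemma nm_cstar a : nm (cmul (star a) a) = nm a ^+ 2.
Proof. by apply: (@complexI R); rewrite rmorphXn /= -!nmE cstar_identity. Qed.

Lemma nm_star a : nm (star a) = nm a.
Proof.
suff h b : nm b <= nm (star b).
  by apply/eqP; rewrite eq_le h andbT (le_trans (h (star a))) // starK.
have [->|b0] := eqVneq (nm b) 0; first exact: nm_ge0.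
have b0' := nm_gt0 b0.
by rewrite -(ler_pM2r b0') -expr2 -nm_cstar nm_cmul.
Qed.

End CStarBasics.

Lemma conjC_real (R : realType) (c : R) : Num.conj (c%:C : R[i]) = c%:C.
Proof. by rewrite conj_Creal // complex_real. Qed.

(** * Sequential completeness of the scalars *)

Section RealSequences.
Variable R : realType.

Lemma real_complete (u : nat -> R) :
  (forall e, 0 < e -> exists N, forall m n, (N <= m)%N -> (N <= n)%N ->
     `|u m - u n| <= e) ->
  exists l, forall e, 0 < e -> exists N, forall n, (N <= n)%N -> `|u n - l| <= e.
Proof.
move=> cu; have : cvg (u @ \oo).
  apply/cauchy_cvgP/cauchy_ballP => e e0.
  have [|N hN] := cu (e / 2); first by lra.
  exists (u @` [set n | (N <= n)%N], u @` [set n | (N <= n)%N]).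
    by split; exists N => // n Nn; exists n.
  move=> [_ _] /= [[m hm <-] [n hn <-]]; rewrite -ball_normE /ball_/=.
  by have := hN _ _ hm hn; lra.
move=> /cvgrPdist_lt cu'; exists (lim (u @ \oo)) => e /cu'[N _ hN].
by exists N => n /hN /=; rewrite distrC => /ltW.
Qed.

Lemma complex_complete (u : nat -> R[i]) :
  (forall e : R, 0 < e -> exists N, forall m n, (N <= m)%N -> (N <= n)%N ->
     nm (u m - u n) <= e) ->
  exists l, forall e : R, 0 < e -> exists N, forall n, (N <= n)%N ->
    nm (u n - l) <= e.
Proof.
have nRe (z : R[i]) : `|complex.Re z| <= nm z.
  by rewrite -lecR -nmE normc_ge_Re.
have nIm (z : R[i]) : `|complex.Im z| <= nm z.
  case: z => x y; rewrite /nm normc_def /= -sqrtr_sqr ler_wsqrtr //.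
  by rewrite lerDr sqr_ge0.
have nD (z : R[i]) : nm z <= `|complex.Re z| + `|complex.Im z|.
  case: z => x y; rewrite /nm normc_def /= -[X in _ <= X]ger0_norm ?addr_ge0 //.
  rewrite -sqrtr_sqr ler_wsqrtr // sqrrD !real_normK ?num_real // -addrA lerD2l.
  by rewrite lerDr mulrn_wge0 // mulr_ge0.
move=> cu.
have [|x hx] := @real_complete (fun n => complex.Re (u n)).
  move=> e /cu[N hN]; exists N => m n hm hn.
  by rewrite (le_trans _ (hN _ _ hm hn)) // (le_trans _ (nRe _)) // raddfB.
have [|y hy] := @real_complete (fun n => complex.Im (u n)).
  move=> e /cu[N hN]; exists N => m n hm hn.
  by rewrite (le_trans _ (hN _ _ hm hn)) // (le_trans _ (nIm _)) // raddfB.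
exists (x +i* y) => e e0; have e2 : 0 < e / 2 by lra.
have [N hN] := hx _ e2; have [M hM] := hy _ e2.
exists (maxn N M) => n; rewrite geq_max => /andP[/hN h1 /hM h2].
rewrite (le_trans (nD _)) // !raddfB /=; lra.
Qed.

End RealSequences.

Section Unitization.
Variables (R : realType) (A : cstarAlgType R).
Local Notation T := (R[i]^o * A)%type.
Implicit Types u v : T.

Definition uact u (x : A) : A := u.1 *: x + cmul u.2 x.

Definition uset u : set R := [set r | exists2 x : A, nm x <= 1 & r = nm (uact u x)].

Definition uopn u : R := sup (uset u).

Let umul u v : T := (u.1 * v.1, u.1 *: v.2 + v.1 *: u.2 + cmul u.2 v.2).
Let ustar u : T := (Num.conj u.1, star u.2).

Lemma uactZ u c x : uact u (c *: x) = c *: uact u x.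
Proof. by rewrite /uact cmulZr scalerDr !scalerA mulrC. Qed.

Lemma uactM u v x : uact (umul u v) x = uact u (uact v x).
Proof.
by rewrite /uact /umul /= !cmulDl !cmulZl scalerDr scalerA cmulDr cmulZr cmulA -!addrA.
Qed.

Lemma uact_star u x y : cmul (star (uact u x)) y = cmul (star x) (uact (ustar u) y).
Proof.
by rewrite /uact /ustar /= starD starZ starM cmulDl cmulDr cmulZl cmulZr cmulA.
Qed.

Lemma uset_bound u : ubound (uset u) (nm u.1 + nm u.2).
Proof.
move=> _ [x x1 ->]; rewrite /uact (le_trans (nmD _ _)) // lerD //.
  by rewrite nmZ ler_piMr // nm_ge0.
by rewrite (le_trans (nm_cmul _ _)) // ler_piMr // nm_ge0.
Qed.

Lemma uset_sup u : has_sup (uset u).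
Proof.
split; last by exists (nm u.1 + nm u.2); exact: uset_bound.
by exists (nm (uact u 0)); exists 0 => //; rewrite nm0.
Qed.

Lemma uopn_ge0 u : 0 <= uopn u.
Proof.
apply: (le_trans (nm_ge0 (uact u 0))); apply: sup_upper_bound (uset_sup u) _ _.
by exists 0 => //; rewrite nm0.
Qed.

Lemma uopnP u x : nm (uact u x) <= uopn u * nm x.
Proof.
have [x0|x0] := eqVneq (nm x) 0.
  by rewrite (nm_eq0 x0) /uact scaler0 cmul0r addr0 nm0 mulr0.
have x0' := nm_gt0 x0.
rewrite -ler_pdivrMr // mulrC.
have xV : 0 <= (nm x)^-1 by rewrite invr_ge0 ltW.
rewrite -(nmZr _ xV) -uactZ; apply: sup_upper_bound (uset_sup u) _ _.
by exists ((nm x)^-1%:C *: x) => //; rewrite nmZr // mulVf.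
Qed.

Lemma uopn_le u M : 0 <= M -> (forall x, nm (uact u x) <= M * nm x) -> uopn u <= M.
Proof.
move=> M0 h; apply: sup_le_ub; first by case: (uset_sup u).
by move=> _ [x x1 ->]; rewrite (le_trans (h x)) // ler_piMr.
Qed.

(** The operator norm alone fails to be definite when [A] has a unit [e], since [1 - e] then acts as
    0. Adding the scalar coordinate amounts to the embedding in the sum of the scalars and the
    operators on [A], which is injective in every case. *)
Let unm u : R := Num.max (nm u.1) (uopn u).

Let unmD u v : unm (u + v) <= unm u + unm v.
Proof.
have h1 : nm u.1 <= unm u by rewrite le_max lexx.
have h2 : nm v.1 <= unm v by rewrite le_max lexx.
have h3 : uopn u <= unm u by rewrite le_max lexx orbT.
have h4 : uopn v <= unm v by rewrite le_max lexx orbT.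
rewrite {1}/unm ge_max (le_trans (nmD _ _)) ?lerD //=.
rewrite (le_trans _ (lerD h3 h4)) //; apply: uopn_le => [|x].
  by rewrite addr_ge0 ?uopn_ge0.
have -> : uact (u + v) x = uact u x + uact v x.
  by rewrite /uact scalerDl cmulDl addrACA.
by rewrite (le_trans (nmD _ _)) // mulrDl lerD // uopnP.
Qed.

Let unmZ (c : R[i]) u : unm (c *: u) = nm c * unm u.
Proof.
have hZ d v x : uact (d *: v) x = d *: uact v x.
  by rewrite /uact scalerDr scalerA cmulZl.
have h d v : uopn (d *: v) <= nm d * uopn v.
  apply: uopn_le => [|x]; first by rewrite mulr_ge0 ?nm_ge0 ?uopn_ge0.
  by rewrite hZ nmZ -mulrA ler_wpM2l ?nm_ge0 ?uopnP.
rewrite /unm maxr_pMr ?nm_ge0 // -nmCM; congr Num.max; apply/le_anti.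
rewrite h /=; have [->|c0] := eqVneq c 0; first by rewrite nm0 mul0r uopn_ge0.
have nc0 : 0 < nm c.
  by apply: nm_gt0; apply: contra c0 => /eqP/nm_eq0/eqP.
by rewrite -ler_pdivlMl // -nmV; have := h c^-1 (c *: u); rewrite scalerK.
Qed.

(** Evaluate [u] at [star u.2] and use the C*-identity. With [unm_le] this makes [unm] equivalent to
    the sum norm, hence definite and complete. *)
Let unm_snd u : nm u.2 <= 2 * unm u.
Proof.
have [u0|u0] := eqVneq (nm u.2) 0.
  by rewrite u0 mulr_ge0 // le_max nm_ge0.
have u0' : 0 < nm (star u.2) by rewrite nm_star nm_gt0.
have e : cmul u.2 (star u.2) = uact u (star u.2) - u.1 *: star u.2.
  by rewrite /uact addrC addKr.
have h1 : nm u.1 <= unm u by rewrite le_max lexx.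
have h3 : uopn u <= unm u by rewrite le_max lexx orbT.
rewrite -(ler_pM2r u0') -{1}(starK u.2) nm_star -expr2 -nm_cstar starK e.
rewrite (le_trans (nmB _ _)) // nmZ mulr_natl mulr2n mulrDl lerD //.
  by rewrite (le_trans (uopnP _ _)) // ler_wpM2r // nm_ge0.
by rewrite ler_wpM2r // nm_ge0.
Qed.

Let unm0 u : unm u = 0 -> u = 0.
Proof.
move=> h; have h1 : u.1 = 0.
  apply: nm_eq0; apply/eqP; rewrite eq_le nm_ge0 andbT -h le_max lexx //.
have h2 : u.2 = 0.
  by apply: nm_eq0; apply/eqP; rewrite eq_le nm_ge0 andbT (le_trans (unm_snd _)) // h mulr0.
by case: u h1 h2 {h} => ? ? /= -> ->.
Qed.

Let unm_le u : unm u <= nm u.1 + nm u.2.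
Proof.
rewrite ge_max lerDl nm_ge0 /= uopn_le // => [|x]; first by rewrite addr_ge0 ?nm_ge0.
by rewrite (le_trans (nmD _ _)) // mulrDl nmZ lerD // nm_cmul.
Qed.

Let unm_complete (s : nat -> T) :
  (forall e : R, 0 < e -> exists N, forall m n, (N <= m)%N -> (N <= n)%N ->
     unm (s m - s n) <= e) ->
  exists l, forall e : R, 0 < e -> exists N, forall n, (N <= n)%N ->
     unm (s n - l) <= e.
Proof.
move=> cs; have [|x hx] := @complex_complete R (fun n => (s n).1).
  move=> e /cs[N hN]; exists N => m n hm hn; rewrite (le_trans _ (hN _ _ hm hn)) //.
  by rewrite le_max lexx.
have [|y hy] := @seq_complete R A (fun n => (s n).2).
  move=> e e0; have [|N hN] := cs (e / 2); first by lra.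
  exists N => m n hm hn; have := hN _ _ hm hn; have := unm_snd (s m - s n).
  by rewrite /=; lra.
exists (x, y) => e e0; have e2 : 0 < e / 2 by lra.
have [N hN] := hx _ e2; have [M hM] := hy _ e2.
exists (maxn N M) => n; rewrite geq_max => /andP[/hN h1 /hM h2].
by rewrite (le_trans (unm_le _)) //= (splitr e) lerD.
Qed.

Definition unitz_data := BanachData unmD unmZ unm0 unm_complete.
Definition unitz := banach_of unitz_data.
HB.instance Definition _ := CompleteNormedModule.on unitz.

Let one : unitz := (1, 0).

Let umulA : associative (umul : unitz -> unitz -> unitz).
Proof.
move=> [l a] [k b] [m c]; rewrite /umul /=; congr pair; first exact: mulrA.
rewrite !(scalerDr, cmulDl, cmulDr, cmulZl, cmulZr, scalerA, cmulA) !addrA.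
by rewrite [LHS](ACl (1*2*4*6*3*5*7)) /= ![m * _]mulrC.
Qed.

Let umul1 : left_id one umul.
Proof. by move=> [l a]; rewrite /umul /= mul1r scale1r scaler0 cmul0l !addr0. Qed.

Let umulr1 : right_id one umul.
Proof. by move=> [l a]; rewrite /umul /= mulr1 scale1r scaler0 cmul0r add0r addr0. Qed.

Let umulDl : left_distributive umul (+%R : T -> T -> T).
Proof.
move=> [l a] [k b] [m c]; rewrite /umul /=; congr pair; first exact: mulrDl.
rewrite scalerDl scalerDr cmulDl !addrA.
by rewrite [LHS](ACl (1*3*5*2*4*6)).
Qed.

Let umulDr : right_distributive umul (+%R : T -> T -> T).
Proof.
move=> [l a] [k b] [m c]; rewrite /umul /=; congr pair; first exact: mulrDr.
rewrite scalerDl scalerDr cmulDr !addrA.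
by rewrite [LHS](ACl (1*3*5*2*4*6)).
Qed.

Let one_neq0 : one != 0.
Proof. by apply/eqP => -[] /eqP; rewrite oner_eq0. Qed.

HB.instance Definition _ := GRing.Zmodule_isNzRing.Build unitz
  umulA umul1 umulr1 umulDl umulDr one_neq0.

Let scaleAl (c : R[i]) (u v : unitz) : c *: (u * v) = (c *: u) * v.
Proof.
case: u v => [l a] [k b]; congr pair => /=; first exact: mulrA.
by rewrite !scalerDr !scalerA cmulZl [k * c]mulrC.
Qed.

HB.instance Definition _ := GRing.Lmodule_isLalgebra.Build R[i] unitz scaleAl.

Let scaleAr (c : R[i]) (u v : unitz) : c *: (u * v) = u * (c *: v).
Proof.
case: u v => [l a] [k b]; congr pair => /=; first exact: mulrCA.
by rewrite !scalerDr !scalerA cmulZr [l * c]mulrC.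
Qed.

HB.instance Definition _ := GRing.Lalgebra_isAlgebra.Build R[i] unitz scaleAr.

Implicit Types (a b : A) (w : unitz).

Definition ust (u : unitz) : unitz := ustar u.
Definition uinj (a : A) : unitz := (0, a).
Definition uscal (u : unitz) : R[i] := u.1.
Definition upart (u : unitz) : A := u.2.
Definition uapp (u : unitz) : A -> A := uact u.

Lemma unm_def (u : unitz) : nm u = unm u.
Proof. exact: nm_banach_of. Qed.

Lemma unitzE (u : unitz) : u = uscal u *: 1 + uinj (upart u).
Proof.
case: u => l a; congr pair => /=; first by rewrite addr0 [_ *: _]mulr1.
by rewrite scaler0 add0r.
Qed.

Lemma uscalM (u v : unitz) : uscal (u * v) = uscal u * uscal v.
Proof. by []. Qed.
Lemma uscalD (u v : unitz) : uscal (u + v) = uscal u + uscal v.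
Proof. by []. Qed.
Lemma uscalN (u : unitz) : uscal (- u) = - uscal u.
Proof. by []. Qed.
Lemma uscalZ c (u : unitz) : uscal (c *: u) = c * uscal u.
Proof. by []. Qed.
Lemma uscal1 : uscal 1 = 1.
Proof. by []. Qed.
Lemma uscal_inj a : uscal (uinj a) = 0.
Proof. by []. Qed.

Lemma nm_uscal (u : unitz) : nm (uscal u) <= nm u.
Proof. by rewrite unm_def le_max lexx. Qed.

Lemma uscal0P (u : unitz) : uscal u = 0 -> u = uinj (upart u).
Proof. by case: u => l a /= ->. Qed.

Lemma uinj_inj : injective uinj.
Proof. by move=> a b []. Qed.

Lemma uinjD a b : uinj (a + b) = uinj a + uinj b.
Proof. by congr pair; rewrite /= addr0. Qed.

Lemma uinjZ c a : uinj (c *: a) = c *: uinj a.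
Proof. by congr pair; rewrite /= scaler0. Qed.

Lemma uinjM a b : uinj (cmul a b) = uinj a * uinj b.
Proof. by congr pair; rewrite /= ?mul0r // !scale0r !add0r. Qed.

Lemma uinj_star a : uinj (star a) = ust (uinj a).
Proof. by congr pair; rewrite /= rmorph0. Qed.

Lemma uinj0 : uinj 0 = 0. Proof. by []. Qed.

Lemma uinjN a : uinj (- a) = - uinj a.
Proof. by rewrite -scaleN1r uinjZ scaleN1r. Qed.

Lemma uinjB a b : uinj (a - b) = uinj a - uinj b.
Proof. by rewrite uinjD uinjN. Qed.

Lemma nm_uinj a : nm (uinj a) = nm a.
Proof.
apply/le_anti; rewrite {1}unm_def (le_trans (unm_le _)) /=; last by rewrite nm0 add0r.
have [->|a0] := eqVneq (nm a) 0; first exact: nm_ge0.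
have a0' : 0 < nm (star a) by rewrite nm_star nm_gt0.
rewrite -(ler_pM2r a0') -{1}(starK a) nm_star -expr2 -nm_cstar starK.
have := uopnP (uinj a) (star a); rewrite {1}/uact /= scale0r add0r => h.
by rewrite (le_trans h) // ler_wpM2r ?nm_ge0 // unm_def le_max lexx orbT.
Qed.

Lemma ustK : involutive ust.
Proof. by move=> [l a]; rewrite /ust /ustar /= starK conjCK. Qed.

Lemma ustD (u v : unitz) : ust (u + v) = ust u + ust v.
Proof. by congr pair; rewrite /= ?rmorphD // starD. Qed.

Lemma ustZ c (u : unitz) : ust (c *: u) = Num.conj c *: ust u.
Proof. by congr pair; rewrite /= ?rmorphM // starZ. Qed.

Lemma ustM (u v : unitz) : ust (u * v) = ust v * ust u.
Proof.
congr pair => /=; first by rewrite rmorphM mulrC.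
by rewrite !starD !starZ starM [X in X + _]addrC.
Qed.

Lemma ust1 : ust 1 = 1.
Proof. by congr pair; rewrite /= ?rmorph1 // star0. Qed.

Lemma uinj_ideall (u : unitz) a : u * uinj a = uinj (uapp u a).
Proof. by congr pair; rewrite /= ?mulr0 // scale0r addr0. Qed.

Lemma uinj_idealr (u : unitz) a : uinj a * u = uinj (star (uapp (ust u) (star a))).
Proof. by rewrite uinj_star -uinj_ideall ustM ustK -uinj_star starK. Qed.

Lemma nm_uM (u v : unitz) : nm (u * v) <= nm u * nm v.
Proof.
rewrite !unm_def /unm ge_max; apply/andP; split.
  by rewrite nmCM ler_pM ?nm_ge0 // le_max lexx.
apply: (@le_trans _ _ (uopn u * uopn v)).
  apply: uopn_le => [|x]; first by rewrite mulr_ge0 ?uopn_ge0.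
  by rewrite uactM (le_trans (uopnP _ _)) // -mulrA ler_wpM2l ?uopn_ge0 ?uopnP.
by rewrite ler_pM ?uopn_ge0 // le_max lexx orbT.
Qed.

(** On the operator part, [|u x|^2 = |x^* (u^* u) x| <= uopn (u^* u) |x|^2]; on the scalar part the
    identity is that of complex numbers. *)
Lemma nm_ucstar_ge (u : unitz) : nm u ^+ 2 <= nm (ust u * u).
Proof.
rewrite !unm_def /unm; set v := ust u * u.
have v1 : nm v.1 = nm u.1 ^+ 2 by rewrite nmCM nmCJ expr2.
have v2 : uopn u ^+ 2 <= uopn v.
  suff : uopn u <= Num.sqrt (uopn v).
    by rewrite -ler_sqr ?nnegrE ?uopn_ge0 ?sqrtr_ge0 // sqr_sqrtr ?uopn_ge0.
  apply: uopn_le => [|x]; first exact: sqrtr_ge0.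
  rewrite -ler_sqr ?nnegrE ?nm_ge0 ?mulr_ge0 ?nm_ge0 ?sqrtr_ge0 //.
  rewrite exprMn sqr_sqrtr ?uopn_ge0 // -nm_cstar uact_star -uactM.
  rewrite (le_trans (nm_cmul _ _)) // nm_star mulrC expr2 mulrA.
  by rewrite ler_wpM2r ?nm_ge0 // uopnP.
rewrite v1; case: (leP (nm u.1) (uopn u)) => h.
  by rewrite (le_trans v2) // le_max lexx orbT.
by rewrite le_max lexx.
Qed.

Lemma nm_ust (u : unitz) : nm (ust u) = nm u.
Proof.
suff h (w : unitz) : nm w <= nm (ust w).
  apply/le_anti/andP; split; last exact: h.
  by apply: le_trans (h _) _; rewrite ustK.
have [->|b0] := eqVneq (nm w) 0; first exact: nm_ge0.
have b0' := nm_gt0 b0.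
by rewrite -(ler_pM2r b0') -expr2 (le_trans (nm_ucstar_ge w)) ?nm_uM.
Qed.

Lemma nm_ucstar (u : unitz) : nm (ust u * u) = nm u ^+ 2.
Proof.
by apply/le_anti; rewrite nm_ucstar_ge (le_trans (nm_uM _ _)) // nm_ust expr2 lexx.
Qed.

End Unitization.

(** * Positive elements *)

Section Positive.
Variables (R : realType) (A : cstarAlgType R).
Local Notation U := (unitz A).
Implicit Types (h u v w x y z : U) (s t : R).

Definition ur t : U := t%:C *: 1.

Lemma urE t x : ur t * x = t%:C *: x.
Proof. by rewrite /ur -scalerAl mul1r. Qed.

Lemma urEr t x : x * ur t = t%:C *: x.
Proof. by rewrite /ur -scalerAr mulr1. Qed.

Lemma ur_comm t x : GRing.comm x (ur t).
Proof. by rewrite /GRing.comm urE urEr. Qed.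

Lemma urD s t : ur (s + t) = ur s + ur t.
Proof. by rewrite /ur rmorphD scalerDl. Qed.

Lemma urM s t : ur (s * t) = ur s * ur t.
Proof. by rewrite urE /ur scalerA rmorphM. Qed.

Lemma ur0 : ur 0 = 0.
Proof. by rewrite /ur scale0r. Qed.

Lemma ur1 : ur 1 = 1.
Proof. by rewrite /ur scale1r. Qed.

Lemma ust_ur t : ust (ur t) = ur t.
Proof. by rewrite /ur ustZ conjC_real ust1. Qed.

Lemma ust0 : ust (0 : U) = 0.
Proof. by rewrite -ur0 ust_ur. Qed.

Lemma ustN x : ust (- x) = - ust x.
Proof. by rewrite -scaleN1r ustZ rmorphN rmorph1 scaleN1r. Qed.

Lemma ustB x y : ust (x - y) = ust x - ust y.
Proof. by rewrite ustD ustN. Qed.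

Lemma nm_u1 : nm (1 : U) = 1.
Proof.
have h : nm (1 : U) ^+ 2 = nm (1 : U) by rewrite -nm_ucstar ust1 mul1r.
have : nm (1 : U) != 0 by apply/eqP => /nm_eq0/eqP; rewrite oner_eq0.
by move=> n1; apply: (mulfI n1); rewrite -expr2 mulr1.
Qed.

(* The iteration [y <- (x + y^2) / 2] is dominated in norm by the same iteration
   in [R] at [x = 1], and its limit satisfies [(1 - y)^2 = 1 - x]. *)
Fixpoint sq_iter x n : U :=
  if n is m.+1 then (2^-1)%:C *: (x + sq_iter x m * sq_iter x m) else 0.

Fixpoint sq_iterR n : R :=
  if n is m.+1 then 2^-1 * (1 + sq_iterR m * sq_iterR m) else 0.

Lemma sq_iterR_bound n : 0 <= sq_iterR n <= 1.
Proof. elim: n => [|n IH] /=; nra. Qed.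

Lemma sq_iterR_cauchy e : 0 < e -> exists N, forall m n, (N <= n)%N -> (n <= m)%N ->
  sq_iterR m - sq_iterR n <= e.
Proof.
have nd : {homo sq_iterR : n m / (n <= m)%N >-> n <= m}.
  apply/nondecreasing_seqP => n; have := sq_iterR_bound n; rewrite /=; nra.
have cs : cvgn sq_iterR.
  apply: nondecreasing_is_cvgn => //; exists 1 => _ [n _ <-].
  by have /andP[] := sq_iterR_bound n.
move=> e0; move/cvgrPdist_lt: cs => /(_ (e / 2)); rewrite divr_gt0 // => /(_ isT).
move=> [N _ hN]; exists N => m n hn hm.
have := hN n hn; have := hN m (leq_trans hn hm) => /=.
rewrite !ltr_norml => /andP[? ?] /andP[? ?]; lra.
Qed.

Lemma sq_iter_comm x n z : GRing.comm z x -> GRing.comm z (sq_iter x n).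
Proof.
move=> zx; elim: n => [|n IH] /=; first exact: commr0.
by rewrite /GRing.comm -scalerAr -scalerAl; congr (_ *: _); apply: commrD => //; apply: commrM.
Qed.

Lemma sq_iter_bound x n : nm x <= 1 -> nm (sq_iter x n) <= sq_iterR n.
Proof.
move=> x1; elim: n => [|n IH] /=; first by rewrite nm0.
rewrite nmZr ?invr_ge0 // ler_pM2l ?invr_gt0 // (le_trans (nmD _ _)) // lerD //.
by rewrite (le_trans (nm_uM _ _)) // ler_pM ?nm_ge0.
Qed.

(** The iterates commute, so [a^2 - b^2 = (a - b)(a + b)], and both factors are dominated by their
    scalar counterparts. *)
Lemma sq_iter_cauchy x n k : nm x <= 1 ->
  nm (sq_iter x (n + k) - sq_iter x n) <= sq_iterR (n + k) - sq_iterR n.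
Proof.
move=> x1; elim: n => [|n IH]; first by rewrite add0n !subr0 sq_iter_bound.
rewrite addSn /= -scalerBr -mulrBr nmZr ?invr_ge0 // ler_pM2l ?invr_gt0 //.
set a := sq_iter x (n + k) in IH *; set b := sq_iter x n in IH *.
have ab : GRing.comm a b by apply: sq_iter_comm; apply/commr_sym/sq_iter_comm/commr_refl.
have -> : x + a * a - (x + b * b) = (a - b) * (a + b).
  rewrite opprD addrACA subrr add0r mulrDr !mulrBl ab addrA subrK //.
have -> : forall c d : R, 1 + c * c - (1 + d * d) = (c - d) * (c + d) by move=> c d; ring.
rewrite (le_trans (nm_uM _ _)) // ler_pM ?nm_ge0 //.
by rewrite (le_trans (nmD _ _)) // lerD ?sq_iter_bound.
Qed.

(** The commutation clause replaces functional calculus: it passes from the iterates, which are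
    polynomials in [x], to their limit. *)
Lemma sq_one_sub x : nm x <= 1 -> ust x = x -> exists y,
  [/\ nm y <= 1, ust y = y, (1 - y) * (1 - y) = 1 - x &
      forall z, GRing.comm z x -> GRing.comm z y].
Proof.
move=> x1 xs; have [|y hy] := @seq_complete R U (sq_iter x).
  move=> e /sq_iterR_cauchy[N hN]; exists N.
  suff h m n : (N <= n)%N -> (n <= m)%N -> nm (sq_iter x m - sq_iter x n) <= e.
    move=> m n hm hn; have /orP[le|le] := leq_total n m; first exact: h.
    by rewrite nm_distC; apply: h.
  move=> hn hm; rewrite -(subnKC hm) (le_trans (sq_iter_cauchy _ _ x1)) // hN //.
  exact: leq_addr.
have y1 : nm y <= 1.
  apply: (seq_lim_bound hy) => n; rewrite (le_trans (sq_iter_bound _ x1)) //.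
  by have /andP[] := sq_iterR_bound n.
have ys : ust y = y.
  have it_s n : ust (sq_iter x n) = sq_iter x n.
    elim: n => [|n IH] /=; first exact: ust0.
    by rewrite ustZ conjC_real ustD ustM xs IH.
  apply: (@seq_lim_uniq R U (sq_iter x)) => //.
  have -> : sq_iter x = (fun n => ust (sq_iter x n)) by apply/funext.
  refine (@seq_lim_map R U U (@ust R A) 1 (sq_iter x) y _ hy) => a b.
  by rewrite mul1r -ustB nm_ust.
have ycomm z : GRing.comm z x -> GRing.comm z y.
  move=> zx; apply: (@seq_lim_uniq R U (fun n => z * sq_iter x n)).
    refine (@seq_lim_map R U U (fun a => z * a) (nm z) (sq_iter x) y _ hy) => a b.
    by rewrite -mulrBr nm_uM.
  have -> : (fun n => z * sq_iter x n) = (fun n => sq_iter x n * z).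
    by apply/funext => n; apply: sq_iter_comm.
  refine (@seq_lim_map R U U (fun a => a * z) (nm z) (sq_iter x) y _ hy) => a b.
  by rewrite -mulrBl mulrC nm_uM.
exists y; split=> //.
have yE : y = (2^-1)%:C *: (x + y * y).
  apply: (@seq_lim_uniq R U (fun n => sq_iter x n.+1)); first exact: seq_lim_shift.
  refine (@seq_lim_map R U U (fun a => (2^-1)%:C *: a) 2^-1 (fun n => x + sq_iter x n * sq_iter x n) _ _ _).
    by move=> a b; rewrite -scalerBr nmZr // invr_ge0.
  refine (seq_limD (@seq_lim_cst R U x) _) => e e0.
  have [|N hN] := hy (e / 2); first by lra.
  exists N => n /hN; set a := sq_iter x n => h.
  have -> : a * a - y * y = a * (a - y) + (a - y) * y by rewrite mulrBr mulrBl addrA subrK.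
  rewrite (le_trans (nmD _ _)) // (splitr e) lerD // (le_trans (nm_uM _ _)) //.
    rewrite (le_trans _ h) // ler_piMl ?nm_ge0 // (le_trans (sq_iter_bound _ x1)) //.
    by have /andP[] := sq_iterR_bound n.
  by rewrite (le_trans _ h) // ler_piMr ?nm_ge0.
have y2 : y + y = x + y * y.
  have {1 2}-> := yE; rewrite -scalerDl -rmorphD /=.
  by rewrite -[in RHS](scale1r (x + _)); congr (_%:C *: _); lra.
have -> : x = y + y - y * y by rewrite y2 addrK.
by rewrite mulrBl mul1r mulrBr mulr1 -addrA -opprD addrA.
Qed.

(** [V = u + i w] satisfies [V^* V = 1], so it has norm 1, and [u] is the mean of [V] and its
    adjoint. *)
Lemma unit_circle_norm u w : ust u = u -> ust w = w -> GRing.comm u w ->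
  u * u + w * w = 1 -> nm u <= 1.
Proof.
move=> us ws uw uw1; pose V : U := u + 'i *: w.
have Vs : ust V = u - 'i *: w by rewrite ustD ustZ conjCi us ws scaleNr.
have V1 : nm V = 1.
  have : nm V ^+ 2 = 1.
    rewrite -nm_ucstar Vs /V mulrDr !mulrBl -!scalerAr -!scalerAl scalerA.
    rewrite -(expr2 'i) sqrCi scaleN1r opprK (_ : u * w = w * u) // addrA subrK.
    by rewrite uw1 nm_u1.
  move=> /eqP; rewrite sqrf_eq1 => /orP[/eqP //|/eqP h].
  by have := nm_ge0 V; rewrite h; lra.
have -> : u = (2^-1)%:C *: (V + ust V).
  rewrite Vs /V addrACA subrr addr0 scalerDr -scalerDl -rmorphD /= -[LHS]scale1r.
  by congr (_%:C *: _); lra.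
rewrite nmZr ?invr_ge0 // (le_trans (y := 2^-1 * (1 + 1))) //; last by lra.
by rewrite ler_pM2l ?invr_gt0 // (le_trans (nmD _ _)) // nm_ust V1.
Qed.

(** Write [1 - u^2 = w^2] with [w] commuting with [u]; then [w^2 + u^2 = 1] and [unit_circle_norm]
    bounds [w]. *)
Lemma norm_one_sub_sq u : ust u = u -> nm u <= 1 -> nm (1 - u * u) <= 1.
Proof.
move=> us u1; have [||y [_ ys yy yc]] := @sq_one_sub (u * u).
- by rewrite (le_trans (nm_uM _ _)) // mulr_ile1 ?nm_ge0.
- by rewrite ustM us.
have uy : GRing.comm u y by apply: yc; rewrite /GRing.comm mulrA.
rewrite -yy; set w := 1 - y.
have w1 : nm w <= 1.
  apply: (@unit_circle_norm w u).
  - by rewrite ustB ust1 ys.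
  - by [].
  - by apply/commr_sym/commrB => //; apply: commr1.
  - by rewrite yy subrK.
by rewrite (le_trans (nm_uM _ _)) // mulr_ile1 ?nm_ge0.
Qed.

(** The norm characterization of positivity. It does not mention the spectrum, and closure under
    sums is immediate. *)
Definition pos h : Prop := ust h = h /\ exists2 t, 0 <= t & nm (ur t - h) <= t.

Lemma pos_sa h : pos h -> ust h = h. Proof. by case. Qed.

Lemma pos0 : pos 0.
Proof. by split; [exact: ust0 | exists 0; rewrite // ur0 subrr nm0]. Qed.

Lemma posD h k : pos h -> pos k -> pos (h + k).
Proof.
move=> [hs [s s0 hn]] [ks [t t0 kn]]; split; first by rewrite ustD hs ks.
exists (s + t); first exact: addr_ge0.
by rewrite urD opprD addrACA (le_trans (nmD _ _)) // lerD.
Qed.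

Lemma posZ c h : 0 <= c -> pos h -> pos (c%:C *: h).
Proof.
move=> c0 [hs [t t0 hn]]; split; first by rewrite ustZ conjC_real hs.
exists (c * t); first exact: mulr_ge0.
by rewrite urM urE -scalerBr nmZr // ler_wpM2l.
Qed.

Lemma pos_ur t : 0 <= t -> pos (ur t).
Proof. by move=> t0; split; [exact: ust_ur | exists t; rewrite // subrr nm0]. Qed.

Lemma pos_ur_sub h t : ust h = h -> nm h <= t -> pos (ur t - h).
Proof.
move=> hs hn; split; first by rewrite ustB ust_ur hs.
by exists t; [exact: le_trans (nm_ge0 h) hn | rewrite subKr].
Qed.

(** Rescaling, [h = t (1 - x)] with [|x| <= 1], and [sq_one_sub] extracts the root of [1 - x]. *)
Lemma pos_sqrt h : pos h -> exists k, [/\ pos k, k * k = h &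
  forall z, GRing.comm z h -> GRing.comm z k].
Proof.
move=> [hs [t t0 hn]]; have [t_eq|tn0] := eqVneq t 0.
  move: hn; rewrite t_eq ur0 sub0r nmN => hn.
  have -> : h = 0 by apply/nm_eq0/le_anti; rewrite hn nm_ge0.
  exists 0; split; [exact: pos0 | by rewrite mulr0 | by move=> z _; exact: commr0].
have tp : 0 < t by rewrite lt_neqAle eq_sym tn0.
have x1 : nm (1 - (t^-1)%:C *: h) <= 1.
  rewrite -(ler_pM2l tp) -nmZr // mulr1 scalerBr scalerA -rmorphM /= mulfV //.
  by rewrite scale1r.
have [//||y [y1 ys yy yc]] := @sq_one_sub (1 - (t^-1)%:C *: h).
  by rewrite ustB ust1 ustZ conjC_real hs.
have sp := sqrtr_ge0 t; exists ((Num.sqrt t)%:C *: (1 - y)); split.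
- split; first by rewrite ustZ conjC_real ustB ust1 ys.
  exists (Num.sqrt t) => //.
  by rewrite -scalerBr opprB addrC subrK nmZr // ler_piMr.
- rewrite -scalerAl -scalerAr scalerA -rmorphM /= -expr2 sqr_sqrtr // yy subKr.
  by rewrite scalerA -rmorphM /= mulfV // scale1r.
- move=> z zh; rewrite /GRing.comm -scalerAr -scalerAl; congr (_ *: _).
  apply: commrB; first exact: commr1.
  apply: yc; apply: commrB; first exact: commr1.
  by rewrite /GRing.comm -scalerAr -scalerAl zh.
Qed.

Lemma pos_sq k : ust k = k -> pos (k * k).
Proof.
move=> ks; have [k0|k0] := eqVneq (nm k) 0.
  by rewrite (nm_eq0 k0) mulr0; exact: pos0.
have kp := nm_gt0 k0.
have kVp : 0 <= (nm k)^-1 by rewrite invr_ge0 ltW.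
set u : U := ((nm k)^-1)%:C *: k.
have us : ust u = u by rewrite ustZ conjC_real ks.
have u1 : nm u <= 1 by rewrite nmZr // mulVf.
have kE : k * k = (nm k ^+ 2)%:C *: (u * u).
  rewrite /u -scalerAl -scalerAr !scalerA -!rmorphM /= -mulrA expr2.
  by rewrite mulrA mulfK // mulfV // scale1r.
rewrite kE; apply: posZ; first exact: sqr_ge0.
split; first by rewrite ustM us.
by exists 1 => //; rewrite ur1; exact: norm_one_sub_sq.
Qed.

(** For [s > 0] the roots [k] of [h] and [l] of [s - h] commute, and the squares of [k / sqrt s] and
    [l / sqrt s] add up to 1, so [unit_circle_norm] applies. The case of general [t] follows by
    taking [s = t + e]. *)
Lemma pos_norm h t : 0 <= t -> pos h -> pos (ur t - h) -> nm h <= t.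
Proof.
suff main s : 0 < s -> pos h -> pos (ur s - h) -> nm h <= s.
  move=> t0 ph pt; apply/ler_addgt0Pr => e e0; apply: main => //.
    exact: ltr_wpDl.
  by rewrite urD addrAC; apply: posD => //; apply: pos_ur; exact: ltW.
move=> s0 ph ps; have [k [pk kk kc]] := pos_sqrt ph.
have [l [pl ll lc]] := pos_sqrt ps.
have sn : Num.sqrt s != 0 by rewrite gt_eqF // sqrtr_gt0.
have c0 : 0 <= (Num.sqrt s)^-1 by rewrite invr_ge0 sqrtr_ge0.
set c := (Num.sqrt s)^-1 in c0.
have cc : c * c = s^-1 by rewrite -invfM -expr2 sqr_sqrtr // ltW.
have kl : GRing.comm k l.
  apply: lc; apply: commrB; first exact: ur_comm.
  by apply/commr_sym/kc/commr_refl.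
have : nm (c%:C *: k) <= 1.
  apply: (@unit_circle_norm _ (c%:C *: l)).
  - by rewrite ustZ conjC_real pos_sa.
  - by rewrite ustZ conjC_real pos_sa.
  - by rewrite /GRing.comm -!scalerAl -!scalerAr kl.
  - rewrite -!scalerAl -!scalerAr !scalerA -rmorphM /= cc -scalerDr kk ll.
    by rewrite addrC subrK -urE -urM mulVf ?ur1 // gt_eqF.
rewrite nmZr // /c ler_pdivrMl ?sqrtr_gt0 // mulr1 => h1.
have ss : s = Num.sqrt s * Num.sqrt s by rewrite -expr2 sqr_sqrtr // ltW.
by rewrite -kk ss (le_trans (nm_uM _ _)) // ler_pM ?nm_ge0.
Qed.

Lemma pos_le_norm h k : pos h -> pos (k - h) -> nm h <= nm k.
Proof.
move=> ph pkh; apply: pos_norm => //; first exact: nm_ge0.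
have ks : ust k = k by rewrite -(subrK h k) ustD !pos_sa.
rewrite -(subrKA k); apply: posD => //.
by apply: pos_ur_sub.
Qed.

End Positive.

(** * Positivity of the elements [b^* b] *)

Section Kaplansky.
Variables (R : realType) (A : cstarAlgType R).
Local Notation U := (unitz A).
Implicit Types (b c h u v w x y z : U) (s t : R).

Lemma nm_sa_sq x : ust x = x -> nm (x * x) = nm x ^+ 2.
Proof. by move=> xs; rewrite -{1}xs nm_ucstar. Qed.

(* Write [c'] for [ust c].  If [v = - c' c] is positive then so is [c c'], and
   comparing the norms of the two sides of [(N - c c') c = c (N + v)], where
   [N = |c|^2], gives [c = 0]. *)
Lemma neg_star_mul c : pos (- (ust c * c)) -> c = 0.
Proof.
set v := - _ => pv; have vE : ust c * c = - v by rewrite /v opprK.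
pose N := nm c ^+ 2; have N0 : 0 <= N by exact: sqr_ge0.
have nv : nm v = N by rewrite /v nmN nm_ucstar.
(* With [p] and [q] twice the real and imaginary parts of [c], [c c' + c' c = (p^2 + q^2) / 2], so
   [c c'] is the sum of this and of [v]. *)
have pw : pos (c * ust c).
  pose p := c + ust c; pose q : U := 'i *: (ust c - c).
  have ps : ust p = p by rewrite /p ustD ustK addrC.
  have qs : ust q = q by rewrite /q ustZ conjCi ustB ustK scaleNr -scalerN opprB.
  have qq : q * q = - ((ust c - c) * (ust c - c)).
    by rewrite /q -scalerAl -scalerAr scalerA -(expr2 'i) sqrCi scaleN1r.
  have cd (d : U) : (c + d) * (c + d) - (d - c) * (d - c) = (c * d + d * c) + (c * d + d * c).
    have sE (a b : U) : a * a - b * b = a * (a - b) + (a - b) * b.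
      by rewrite mulrBr mulrBl addrA subrK.
    have e : c + d - (d - c) = c + c by rewrite opprB addrCA addrK.
    rewrite sE e !mulrDl !mulrDr !mulrN !addrA.
    by rewrite [LHS](ACl ((1*6)*(2*8)*((5*3)*(7*4)))) /= subrr !add0r !addrA.
  have -> : c * ust c = (2^-1)%:C *: (p * p + q * q) + v.
    rewrite qq cd scalerDr -scalerDl -rmorphD /= (_ : 2^-1 + 2^-1 = 1 :> R); last by lra.
    by rewrite scale1r /v addrK.
  by apply: posD => //; apply: posZ; rewrite ?invr_ge0 //; apply: posD; apply: pos_sq.
have nw : nm (c * ust c) = N by rewrite -{1}(ustK c) nm_ucstar nm_ust.
have nNw : nm (ur A N - c * ust c) <= N.
  apply: pos_norm => //; last by rewrite subKr.
  by apply: pos_ur_sub; rewrite ?nw // pos_sa.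
pose D := (ur A N - c * ust c) * c.
have DE : D = c * (ur A N + v).
  by rewrite /D mulrBl mulrDr -ur_comm -mulrA vE mulrN opprK.
have D1 : nm D ^+ 2 <= N ^+ 2 * N.
  have : nm D <= N * nm c by rewrite (le_trans (nm_uM _ _)) // ler_wpM2r // nm_ge0.
  by move=> h; rewrite -exprMn ler_sqr // ?nnegrE ?nm_ge0 // mulr_ge0 ?nm_ge0.
have D2 : nm D ^+ 2 = nm ((ur A N + v) * v * (ur A N + v)).
  rewrite -nm_ucstar DE ustM ustD ust_ur (pos_sa pv) -mulrA (mulrA (ust c)) vE.
  by rewrite mulNr mulrN nmN mulrA.
(* [(N + v) v (N + v) - 2 N v^2 = N^2 v + v^3] is positive. Together with [D1] this gives
   [2 N^3 <= N^3]. *)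
have D3 : (N + N) * N ^+ 2 <= nm D ^+ 2.
  have -> : (N + N) * N ^+ 2 = nm ((N + N)%:C *: (v * v)).
    by rewrite nmZr ?addr_ge0 // nm_sa_sq ?nv // pos_sa.
  rewrite D2; have [z [pz zz zc]] := pos_sqrt pv.
  have vz : GRing.comm v z by exact: zc.
  apply: pos_le_norm; first by apply: posZ; rewrite ?addr_ge0 //; apply: pos_sq; exact: pos_sa.
  have -> : (ur A N + v) * v * (ur A N + v) - (N + N)%:C *: (v * v) =
      (N ^+ 2)%:C *: v + (v * z) * (v * z).
    rewrite !mulrDl !mulrDr !urE !urEr -!scalerAl scalerA -rmorphM /= -(expr2 N).
    rewrite (_ : v * z * (v * z) = v * v * v); last first.
      by rewrite -(mulrA v z) (mulrA z) -vz -(mulrA v z) zz mulrA.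
    rewrite !addrA [LHS](ACl ((1*4)*((2*3)*5))) /= -scalerDl -scalerBl.
    by rewrite -rmorphD -rmorphB /= subrr scale0r addr0.
  apply: posD; first by apply: posZ => //; exact: sqr_ge0.
  by apply: pos_sq; rewrite ustM !pos_sa.
have : N = 0.
  apply/le_anti; rewrite N0 andbT leNgt; apply/negP => Np.
  have : (N + N) * N ^+ 2 <= N ^+ 2 * N by exact: le_trans D3 D1.
  by rewrite mulrDl (mulrC N (N ^+ 2)) gerDl leNgt (mulr_gt0 (exprn_gt0 2 Np) Np).
by move=> /eqP; rewrite /N sqrf_eq0 => /eqP/nm_eq0.
Qed.

(** Here [k] is the absolute value of [h] and [x = k - h] is twice its negative part. From
    [x (k + h) = 0] one gets [x h x = - x k x], so [- (b x)^* (b x)] is positive and [b x = 0] by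
    [neg_star_mul]. Then [x^3 = 0], hence [x = 0] and [h = k]. *)
Theorem pos_star b : pos (ust b * b).
Proof.
set h := ust b * b; have hs : ust h = h by rewrite ustM ustK.
have [k [pk kk kc]] := pos_sqrt (pos_sq hs).
have hk : GRing.comm h k by apply: kc; rewrite /GRing.comm mulrA.
have [w [pw ww wc]] := pos_sqrt pk.
have wk : GRing.comm w k by apply/commr_sym/wc/commr_refl.
have wh : GRing.comm w h by apply/commr_sym/wc.
pose x := k - h; have xs : ust x = x by rewrite ustB hs pos_sa.
have xy : x * (k + h) = 0.
  by rewrite mulrBl !mulrDr kk hk [h * h + _]addrC subrr.
have xhx : x * h * x = - (x * k * x).
  by apply/eqP; rewrite -subr_eq0 opprK -mulrDl -mulrDr addrC xy mul0r.
have xw : GRing.comm w x by apply: commrB.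
have pxkx : pos (x * k * x).
  have -> : x * k * x = (w * x) * (w * x) by rewrite -ww !mulrA xw.
  by apply: pos_sq; rewrite ustM xs pos_sa // xw.
have c0 : b * x = 0.
  apply: neg_star_mul; rewrite ustM xs -mulrA (mulrA (ust b)) -/h mulrA xhx opprK.
  exact: pxkx.
have xhx0 : x * h * x = 0 by rewrite /h -!mulrA c0 !mulr0.
have x3 : x * x * x = 0.
  have xkx0 : x * k * x = 0 by apply/eqP; rewrite -oppr_eq0 -xhx xhx0.
  have -> : x * x * x = x * k * x - x * h * x by rewrite -mulrBl -mulrBr.
  by rewrite xkx0 xhx0 subr0.
have x2 : x * x = 0.
  apply/nm_eq0/eqP; rewrite -sqrf_eq0 -nm_sa_sq ?ustM ?xs // mulrA x3 mul0r nm0 //.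
have : x = 0 by apply/nm_eq0/eqP; rewrite -sqrf_eq0 -nm_sa_sq // x2 nm0.
by move=> /eqP; rewrite subr_eq0 => /eqP <-.
Qed.

Lemma pos_conj x h : pos h -> pos (ust x * h * x).
Proof.
move=> /pos_sqrt[k [pk <- _]].
by rewrite -{1}(pos_sa pk) mulrA -ustM -mulrA; apply: pos_star.
Qed.

Lemma pos_sq_comm x h : ust x = x -> pos h -> GRing.comm x h -> pos (x * x * h).
Proof. by move=> xs ph xh; rewrite -mulrA xh mulrA -{1}xs; apply: pos_conj. Qed.

(* By the Bernoulli type inequality
   [(1 - b)^(n+1) + (n + 1) b (1 - b)^n <= 1] for [0 <= b <= 1]. *)
Lemma norm_mul_one_sub_exp b n : pos b -> nm b <= 1 ->
  n.+1%:R * nm (b * (1 - b) ^+ n) <= 1.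
Proof.
move=> pb b1; have [k [pk kk kc]] := pos_sqrt pb.
have pc : pos (1 - b) by rewrite -ur1; apply: pos_ur_sub => //; exact: pos_sa.
have [l [pl ll lc]] := pos_sqrt pc.
have lb : GRing.comm l b.
  have : GRing.comm l (1 - b) by apply/commr_sym/lc/commr_refl.
  by move=> h; rewrite -[b](subKr 1); apply: commrB => //; exact: commr1.
have ls m : ust (l ^+ m) = l ^+ m.
  elim: m => [|m IH]; first by rewrite ust1.
  by rewrite {1}exprS ustM IH (pos_sa pl) -exprSr.
have cl m : (1 - b) ^+ m = l ^+ m * l ^+ m.
  by rewrite -ll -(expr2 l) -exprM mulnC exprM expr2.
have lbm m : GRing.comm (l ^+ m) b by apply/commr_sym/commrX/commr_sym.
have pcm m : pos ((1 - b) ^+ m) by rewrite cl; apply: pos_sq.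
have pbc m : pos (b * (1 - b) ^+ m).
  by rewrite cl mulrA -lbm -mulrA -lbm mulrA; apply: pos_sq_comm.
have pbbc m : pos (b * (b * (1 - b) ^+ m)).
  have -> : b * (b * (1 - b) ^+ m) = b * b * (1 - b) ^+ m by rewrite mulrA.
  apply: pos_sq_comm => //; first exact: pos_sa.
  by rewrite cl; apply: commrM; apply: commr_sym.
have main : pos (1 - (1 - b) ^+ n.+1 - (n.+1%:R)%:C *: (b * (1 - b) ^+ n)).
  elim: n => [|n IH].
    by rewrite expr1 expr0 mulr1 scale1r subKr subrr; exact: pos0.
  have -> : 1 - (1 - b) ^+ n.+2 - (n.+2%:R)%:C *: (b * (1 - b) ^+ n.+1) =
     (1 - (1 - b) ^+ n.+1 - (n.+1%:R)%:C *: (b * (1 - b) ^+ n)) +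
     (n.+1%:R)%:C *: (b * (b * (1 - b) ^+ n)).
    set f := b * (1 - b) ^+ n; set c := (1 - b) ^+ n.+1; set d := b * c.
    have -> : (1 - b) ^+ n.+2 = c - d by rewrite exprS mulrBl mul1r.
    have dE : d = f - b * f by rewrite /d /c exprS mulrBl mul1r mulrBr.
    rewrite -natr1 rmorphD scalerDl scale1r {2}dE scalerBr !opprD !opprK !addrA.
    by rewrite [LHS](ACl (1*2*4*5*(3*6))) /= subrr addr0.
  by apply: posD => //; apply: posZ.
have n0 : 0 <= n.+1%:R :> R by rewrite ler0n.
rewrite -nmZr //; apply: (le_trans (y := nm (1 : U))); last by rewrite nm_u1.
apply: pos_le_norm; first exact: posZ.
have -> : 1 - (n.+1%:R)%:C *: (b * (1 - b) ^+ n) =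
    (1 - (1 - b) ^+ n.+1 - (n.+1%:R)%:C *: (b * (1 - b) ^+ n)) + (1 - b) ^+ n.+1.
  by rewrite addrAC subrK.
exact: posD.
Qed.

End Kaplansky.

(** * Hilbert modules *)

Section PositiveInAlgebra.
Variables (R : realType) (A : cstarAlgType R).
Implicit Types a b : A.

Lemma cpositive_pos a : cpositive a -> pos (uinj a).
Proof. by move=> [b ->]; rewrite uinjM uinj_star; apply: pos_star. Qed.

(** The scalar part is multiplicative, so that of the root has square 0 and the root stays in
    [A]. *)
Lemma pos_sqrt_mem a : pos (uinj a) -> exists k : A,
  [/\ pos (uinj k), star k = k & cmul k k = a].
Proof.
move=> /pos_sqrt[k [pk kk _]]; have k0 : uscal k = 0.
  by apply/eqP; rewrite -[_ == _]orbb -mulf_eq0 -uscalM kk.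
rewrite (uscal0P k0) in pk kk; exists (upart k); split => //.
  by apply: uinj_inj; rewrite uinj_star pos_sa.
by apply: uinj_inj; rewrite uinjM.
Qed.

Definition cideal (J : A -> Prop) : Prop :=
  [/\ closed_subspace J, forall a b, J a -> J (cmul a b),
      forall a b, J b -> J (cmul a b) & forall a, J a -> J (star a)].

Lemma cideal_uapp J (u : unitz A) a : cideal J -> J a -> J (uapp u a).
Proof.
move=> [[_ JD JZ _] _ Jl _] Ja; rewrite /uapp /uact; apply: JD; [exact: JZ | exact: Jl].
Qed.

(* [1 - u] is an approximate unit for [a]. *)
Lemma approx_unit (J : A -> Prop) a (e : R) : cideal J -> J a -> pos (uinj a) ->
  0 < e -> exists2 u : unitz A,
  [/\ uscal u = 1, J (upart u), ust u = u, nm u <= 1 & nm (u * uinj a * u) <= e] &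
  exists n, u = (1 - ((nm a + 1)^-1)%:C *: uinj a) ^+ n.
Proof.
move=> cJ Ja pa e0; have [[J0 JD JZ _] _ _ Js] := cJ.
pose s := nm a + 1; have s0 : 0 < s by have := nm_ge0 a; rewrite /s; lra.
have sV0 : 0 < s^-1 by rewrite invr_gt0.
pose b : unitz A := (s^-1)%:C *: uinj a; have pb : pos b by apply: posZ; rewrite ?ltW.
have b1 : nm b <= 1.
  by rewrite nmZr ?(ltW sV0) // nm_uinj ler_pdivrMl // mulr1 /s lerDl.
(* Since [uinj a = s b], the norm of [u a u] is [s |b (1 - b)^(2n)|], at most [s / (2n + 1)] by
   [norm_mul_one_sub_exp]; [n + 1 > s / e] is enough. *)
pose n := Num.trunc (s / e); pose u : unitz A := (1 - b) ^+ n.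
have sc m : uscal ((1 - b) ^+ m) = 1.
  elim: m => [|m IH] //; rewrite exprS uscalM IH mulr1 uscalD uscalN uscalZ uscal_inj.
  by rewrite mulr0 subr0.
have bu : GRing.comm b u.
  by apply: commrX; apply: commrB; [exact: commr1 | exact: commr_refl].
have us m : ust ((1 - b) ^+ m) = (1 - b) ^+ m.
  elim: m => [|m IH]; first by rewrite ust1.
  by rewrite {1}exprS ustM IH ustB ust1 (pos_sa pb) -exprSr.
have Jm m : J (upart ((1 - b) ^+ m)).
  elim: m => [|m IH] //; rewrite exprS mulrBl mul1r.
  have -> : upart ((1 - b) ^+ m - b * (1 - b) ^+ m) =
      upart ((1 - b) ^+ m) + - upart (b * (1 - b) ^+ m) by [].
  apply: JD => //; rewrite -scaleN1r; apply/JZ; rewrite /b -scalerAl uinj_idealr.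
  exact: JZ _ _ (Js _ (cideal_uapp _ cJ (Js _ Ja))).
have nm1 : nm (1 - b) <= 1.
  apply: pos_norm => //; rewrite ?ur1 ?subKr //.
  by rewrite -(ur1 A); apply: pos_ur_sub => //; exact: pos_sa.
have nmm m : nm ((1 - b) ^+ m) <= 1.
  elim: m => [|m IH]; first by rewrite expr0 nm_u1.
  by rewrite exprS (le_trans (nm_uM _ _)) // mulr_ile1 ?nm_ge0.
(* The explicit power is recorded because [quasi_unit] reproduces it by composing operators [1 - F]
   with [F] of finite rank. *)
exists u; last by exists n.
split; [exact: sc | exact: Jm | exact: us | exact: nmm | ].
have -> : uinj a = s%:C *: b.
  by rewrite /b scalerA -rmorphM /= mulfV ?scale1r // gt_eqF.
rewrite -scalerAr -scalerAl nmZr ?(ltW s0) // -bu -mulrA.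
have -> : u * u = (1 - b) ^+ (n + n) by rewrite exprD.
have := norm_mul_one_sub_exp (n + n) pb b1; set x := nm _ => h.
have n1 : s / e < n.+1%:R by rewrite truncnS_gt.
rewrite ltr_pdivrMr // in n1.
have h2 : n.+1%:R * x <= 1.
  apply: le_trans h; rewrite ler_wpM2r ?nm_ge0 // ler_nat ltnS; exact: leq_addr.
have n0 : 0 < n.+1%:R :> R by rewrite ltr0n.
rewrite -(ler_pM2l n0) mulrCA (le_trans _ (ltW n1)) //.
by rewrite -[X in _ <= X]mulr1 ler_pM2l.
Qed.

End PositiveInAlgebra.

Section HilbertBasics.
Variables (R : realType) (B : cstarAlgType R) (X : hilbertModType B).
Implicit Types (x y z : X) (b c : B).

Lemma innerDl x y z : inner (x + y) z = inner x z + inner y z.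
Proof. by rewrite -inner_star innerDr starD !inner_star. Qed.

Lemma innerZl (k : R[i]) x y : inner (k *: x) y = Num.conj k *: inner x y.
Proof. by rewrite -inner_star innerZr starZ inner_star. Qed.

Lemma inner_ractl x y b : inner (ract x b) y = cmul (star b) (inner x y).
Proof. by rewrite -inner_star inner_ract starM inner_star. Qed.

Lemma inner0r x : inner x (0 : X) = 0.
Proof. by rewrite -(scale0r (0 : X)) innerZr scale0r. Qed.

Lemma inner0l x : inner (0 : X) x = 0.
Proof. by rewrite -inner_star inner0r star0. Qed.

Lemma innerNr x y : inner x (- y) = - inner x y.
Proof. by rewrite -scaleN1r innerZr scaleN1r. Qed.

Lemma innerNl x y : inner (- x) y = - inner x y.
Proof. by rewrite -inner_star innerNr starN inner_star. Qed.

Lemma innerBr x y z : inner x (y - z) = inner x y - inner x z.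
Proof. by rewrite innerDr innerNr. Qed.

Lemma innerBl x y z : inner (x - y) z = inner x z - inner y z.
Proof. by rewrite innerDl innerNl. Qed.

Lemma inner_sumr I (r : seq I) (F : I -> X) x :
  inner x (\sum_(i <- r) F i) = \sum_(i <- r) inner x (F i).
Proof.
by elim: r => [|i r IH]; rewrite ?big_nil ?inner0r // !big_cons innerDr IH.
Qed.

Lemma inner_suml I (r : seq I) (F : I -> X) x :
  inner (\sum_(i <- r) F i) x = \sum_(i <- r) inner (F i) x.
Proof.
by elim: r => [|i r IH]; rewrite ?big_nil ?inner0l // !big_cons innerDl IH.
Qed.

Lemma nm_inner x : nm x ^+ 2 = nm (inner x x).
Proof. by apply: (@complexI R); rewrite rmorphXn /= -!nmE normr_inner. Qed.

Lemma nm_le_inner x (c : R) : 0 <= c -> nm (inner x x) <= c * nm x -> nm x <= c.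
Proof.
have [-> //|x0] := eqVneq (nm x) 0.
by move=> c0; rewrite -nm_inner expr2 ler_pM2r // nm_gt0.
Qed.

Lemma inner_eq0 x : inner x x = 0 -> x = 0.
Proof. by move=> h; apply/nm_eq0/eqP; rewrite -sqrf_eq0 nm_inner h nm0. Qed.

Lemma inner_ext x y : (forall z, inner z x = inner z y) -> x = y.
Proof.
move=> h; apply/eqP; rewrite -subr_eq0; apply/eqP/inner_eq0.
by rewrite innerBr h subrr.
Qed.

Lemma pos_inner x : pos (uinj (inner x x)).
Proof. exact: cpositive_pos (inner_ge0 x). Qed.

Lemma ract0r x : ract x 0 = 0.
Proof. by rewrite -(scale0r (0 : B)) ractZr scale0r. Qed.

Lemma ract0l b : ract (0 : X) b = 0.
Proof. by rewrite -(scale0r (0 : X)) ractZl !scale0r. Qed.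

Lemma ractNl x b : ract (- x) b = - ract x b.
Proof. by rewrite -scaleN1r ractZl scaleN1r. Qed.

Lemma ractNr x b : ract x (- b) = - ract x b.
Proof. by rewrite -scaleN1r ractZr scaleN1r. Qed.

Lemma ractBl x y b : ract (x - y) b = ract x b - ract y b.
Proof. by rewrite ractDl ractNl. Qed.

Lemma ractBr x b c : ract x (b - c) = ract x b - ract x c.
Proof. by rewrite ractDr ractNr. Qed.

Lemma ract_suml I (r : seq I) (F : I -> X) b :
  ract (\sum_(i <- r) F i) b = \sum_(i <- r) ract (F i) b.
Proof.
by elim: r => [|i r IH]; rewrite ?big_nil ?ract0l // !big_cons ractDl IH.
Qed.

(** The right action of the unitization, which makes [x - x e] the action of the single element
    [1 - e]. *)
Definition rau x (u : unitz B) : X := uscal u *: x + ract x (upart u).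

Lemma inner_raur x y u : uinj (inner x (rau y u)) = uinj (inner x y) * u.
Proof.
rewrite [in RHS](unitzE u) mulrDr -scalerAr mulr1.
by rewrite /rau innerDr innerZr inner_ract uinjD uinjZ uinjM.
Qed.

Lemma inner_raul x y u : uinj (inner (rau x u) y) = ust u * uinj (inner x y).
Proof. by rewrite -inner_star uinj_star inner_raur ustM -uinj_star inner_star. Qed.

Lemma nm_rau_sq x u : nm (rau x u) ^+ 2 = nm (ust u * uinj (inner x x) * u).
Proof. by rewrite nm_inner -nm_uinj inner_raur inner_raul. Qed.

Lemma nm_rau x u : nm (rau x u) <= nm x * nm u.
Proof.
rewrite -ler_sqr ?nnegrE ?mulr_ge0 ?nm_ge0 // nm_rau_sq.
rewrite (le_trans (nm_uM _ _)) // exprMn [nm u ^+ 2]expr2 mulrA ler_wpM2r ?nm_ge0 //.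
by rewrite (le_trans (nm_uM _ _)) // nm_ust nm_uinj -nm_inner mulrC.
Qed.

Lemma rau_uinj x b : rau x (uinj b) = ract x b.
Proof. by rewrite /rau uscal_inj scale0r add0r. Qed.

Lemma nm_ract x b : nm (ract x b) <= nm x * nm b.
Proof. by rewrite -rau_uinj (le_trans (nm_rau _ _)) // nm_uinj. Qed.

(** Cauchy-Schwarz. With [t = |x|^2], [a = <x, y>] and [z = y - x a / t], adding the positive
    [a^* (t - <x, x>) a / t^2] to [<z, z>] leaves [<y, y> - a^* a / t], which is therefore
    positive. *)
Lemma nm_innerM x y : nm (inner x y) <= nm x * nm y.
Proof.
have [x0|x0] := eqVneq (nm x) 0.
  by rewrite (nm_eq0 x0) inner0l !nm0 mul0r.
have xp := nm_gt0 x0.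
set t := nm x ^+ 2; have t0 : 0 < t by rewrite exprn_gt0.
have tV0 : 0 <= t^-1 by rewrite invr_ge0 ltW.
set a := inner x y; set p := inner x x.
pose z := y - ract x ((t^-1)%:C *: a).
have zz : uinj (inner z z) = uinj (inner y y) - (t^-1)%:C *: (ust (uinj a) * uinj a)
   - ((t^-1)%:C *: (ust (uinj a) * uinj a) -
      (t^-1 * t^-1)%:C *: (ust (uinj a) * uinj p * uinj a)).
  rewrite /z innerBr !innerBl inner_ract !inner_ractl inner_ract -/a -/p.
  rewrite starZ conjC_real -[inner y x]inner_star -/a.
  rewrite !cmulZl !cmulZr scalerA -rmorphM /= !uinjB !uinjZ !uinjM !uinj_star.
  by rewrite mulrA.
have ph : pos ((t^-1 * t^-1)%:C *: (ust (uinj a) * (ur B t - uinj p) * uinj a)).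
  apply: posZ; first exact: mulr_ge0.
  apply: pos_conj; apply: pos_ur_sub; first exact: pos_sa (pos_inner x).
  by rewrite nm_uinj -nm_inner.
have pz := pos_inner z; rewrite zz in pz.
have pd : pos (uinj (inner y y) - (t^-1)%:C *: (ust (uinj a) * uinj a)).
  have := posD pz ph; rewrite mulrBr urEr mulrBl -scalerAl scalerBr scalerA.
  rewrite -rmorphM /= (divfK (lt0r_neq0 t0)).
  by rewrite subrK.
have pa : pos ((t^-1)%:C *: (ust (uinj a) * uinj a)) by apply: posZ => //; apply: pos_star.
have := pos_le_norm pa pd; rewrite nmZr // nm_ucstar !nm_uinj -nm_inner.
rewrite ler_pdivrMl // -exprMn ler_sqr // ?nnegrE ?mulr_ge0 ?nm_ge0 //.
Qed.

(* [rau x u = x - x e] with [e = - upart u] in [J] *)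
Lemma approx_ract (J : B -> Prop) x (e : R) : cideal J -> J (inner x x) -> 0 < e ->
  exists2 u : unitz B, [/\ uscal u = 1, J (upart u), ust u = u & nm u <= 1] &
    nm (rau x u) <= e.
Proof.
move=> cJ Jx e0; have e2 : 0 < e ^+ 2 by rewrite exprn_gt0.
have [u [u1 Ju us un h] _] := approx_unit cJ Jx (pos_inner x) e2.
exists u => //; rewrite -ler_sqr ?nnegrE ?nm_ge0 ?(ltW e0) //.
by rewrite nm_rau_sq us.
Qed.

Lemma rau_sub x u : uscal u = 1 -> rau x u = x - ract x (- upart u).
Proof. by move=> u1; rewrite /rau u1 scale1r ractNr opprK. Qed.

End HilbertBasics.

(** * Correspondences *)

Section Adjoint.
Variables (R : realType) (B : cstarAlgType R) (X : hilbertModType B).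
Variables (T T' : X -> X).
Hypothesis TT' : adjoint_pair T T'.

Lemma adjoint_pair_sym : adjoint_pair T' T.
Proof. by move=> x y; rewrite -inner_star -TT' inner_star. Qed.

Lemma adjointD x y : T (x + y) = T x + T y.
Proof. by apply: inner_ext => z; rewrite innerDr -!adjoint_pair_sym innerDr. Qed.

Lemma adjointZ k x : T (k *: x) = k *: T x.
Proof. by apply: inner_ext => z; rewrite innerZr -!adjoint_pair_sym innerZr. Qed.

Lemma adjoint_ract x b : T (ract x b) = ract (T x) b.
Proof. by apply: inner_ext => z; rewrite inner_ract -!adjoint_pair_sym inner_ract. Qed.

Lemma adjointN x : T (- x) = - T x.
Proof. by rewrite -scaleN1r adjointZ scaleN1r. Qed.

Lemma adjointB x y : T (x - y) = T x - T y.
Proof. by rewrite adjointD adjointN. Qed.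

End Adjoint.

Section CorrBasics.
Variables (R : realType) (A B : cstarAlgType R) (X : corrType A B).
Implicit Types (x y z : X) (a : A) (b : B).

Definition lactDr a := adjointD (lact_star (s := X) a).
Definition lactZr a := adjointZ (lact_star (s := X) a).
Definition lact_ract a := adjoint_ract (lact_star (s := X) a).
Definition lactBr a := adjointB (lact_star (s := X) a).

Lemma lact0l x : lact (0 : A) x = 0.
Proof. by rewrite -(scale0r (0 : A)) lactZ scale0r. Qed.

Lemma lactNl a x : lact (- a) x = - lact a x.
Proof. by rewrite -scaleN1r lactZ scaleN1r. Qed.

Lemma lactBl a a' x : lact (a - a') x = lact a x - lact a' x.
Proof. by rewrite lactD lactNl. Qed.

Definition lau (u : unitz A) x : X := uscal u *: x + lact (upart u) x.

Lemma inner_lau u x y : inner (lau u x) y = inner x (lau (ust u) y).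
Proof. by rewrite /lau innerDl innerZl innerDr innerZr lact_star. Qed.

Lemma lauM u v x : lau (u * v) x = lau u (lau v x).
Proof.
rewrite /lau uscalM scalerDr scalerA lactDr lactZr -!addrA; congr (_ + _).
have -> : upart (u * v) = uscal u *: upart v + uscal v *: upart u + cmul (upart u) (upart v) by [].
by rewrite !lactD !lactZ lactM addrA.
Qed.

Lemma lau_uinj a x : lau (uinj a) x = lact a x.
Proof. by rewrite /lau uscal_inj scale0r add0r. Qed.

Lemma lauD u v x : lau (u + v) x = lau u x + lau v x.
Proof.
rewrite /lau uscalD scalerDl.
have -> : upart (u + v) = upart u + upart v by [].
by rewrite lactD addrACA.
Qed.

Lemma lauZ c u x : lau (c *: u) x = c *: lau u x.
Proof.
rewrite /lau uscalZ.
have -> : upart (c *: u) = c *: upart u by [].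
by rewrite lactZ scalerDr scalerA.
Qed.

Lemma lau1 x : lau 1 x = x.
Proof. by rewrite /lau uscal1 scale1r lact0l addr0. Qed.

Lemma lau_ur t x : lau (ur A t) x = t%:C *: x.
Proof. by rewrite /ur lauZ lau1. Qed.

Lemma lauB u v x : lau (u - v) x = lau u x - lau v x.
Proof. by rewrite lauD -(scaleN1r v) lauZ scaleN1r. Qed.

Lemma lauZr c u x : lau u (c *: x) = c *: lau u x.
Proof. by rewrite /lau lactZr scalerDr !scalerA mulrC. Qed.

Lemma pos_lau (h : unitz A) x : pos h -> pos (uinj (inner x (lau h x))).
Proof.
move=> /pos_sqrt[k [pk <- _]]; rewrite lauM -{1}(pos_sa pk) -inner_lau.
exact: pos_inner.
Qed.

(** [|u|^2 - u^* u] is positive, and [pos_lau] turns this into [<u x, u x> <= |u|^2 <x, x>]. *)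
Lemma nm_lau u x : nm (lau u x) <= nm u * nm x.
Proof.
have h : pos (ur A (nm u ^+ 2) - ust u * u).
  by apply: pos_ur_sub; [rewrite ustM ustK | rewrite nm_ucstar].
have := pos_lau x h; rewrite lauB lauM innerBr -inner_lau lau_ur innerZr uinjB => h1.
have := pos_le_norm (pos_inner _) h1.
rewrite !nm_uinj -nm_inner nmZr ?sqr_ge0 // -nm_inner -exprMn.
by rewrite ler_sqr // ?nnegrE ?mulr_ge0 ?nm_ge0.
Qed.

Lemma nm_lact a x : nm (lact a x) <= nm a * nm x.
Proof. by rewrite -lau_uinj (le_trans (nm_lau _ _)) // nm_uinj. Qed.

End CorrBasics.

(** * Quotients of closed subspaces *)

Section BanachQuotient.
Variables (R : realType) (V : completeNormedModType R[i]).

Record subquot := SubQuot {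
  sq_W : V -> Prop;
  sq_N : V -> Prop;
  sq_Wclosed : closed_subspace sq_W;
  sq_Nclosed : closed_subspace sq_N;
  sq_NW : forall x, sq_N x -> sq_W x
}.

Variable s : subquot.
Local Notation W := (sq_W s).
Local Notation N := (sq_N s).

Let W0 : W 0. Proof. by have [] := sq_Wclosed s. Qed.
Let WD x y : W x -> W y -> W (x + y). Proof. by have [_ h _ _] := sq_Wclosed s; apply: h. Qed.
Let WZ c x : W x -> W (c *: x). Proof. by have [_ _ h _] := sq_Wclosed s; apply: h. Qed.
Let WB x y : W x -> W y -> W (x - y). Proof. exact: subspaceB (sq_Wclosed s). Qed.
Let N0 : N 0. Proof. by have [] := sq_Nclosed s. Qed.
Let ND x y : N x -> N y -> N (x + y). Proof. by have [_ h _ _] := sq_Nclosed s; apply: h. Qed.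
Let NZ c x : N x -> N (c *: x). Proof. by have [_ _ h _] := sq_Nclosed s; apply: h. Qed.
Let NB x y : N x -> N y -> N (x - y). Proof. exact: subspaceB (sq_Nclosed s). Qed.

(** [xget] depends only on the set, so vectors of one class receive the same representative. The
    default 0 is never reached, since the class contains [x]. *)
Definition qrep (x : V) : V := xget 0 [set y | N (y - x)].

Lemma qrepP x : N (qrep x - x).
Proof.
rewrite /qrep; case: (xgetP 0 [set y | N (y - x)]) => [y -> //|h].
by case: (h x); rewrite /= subrr.
Qed.

Lemma qrepE x y : N (x - y) -> qrep x = qrep y.
Proof.
move=> h; rewrite /qrep; congr (xget 0 _); apply/seteqP; split=> z /= hz.
  by rewrite -(subrK x z) -addrA; apply: ND.
by rewrite -(subrK y z) -addrA; apply: ND => //; rewrite -opprB -sub0r; apply: NB.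
Qed.

(* The elements of the quotient are the chosen representatives of the classes. *)
Record qT := QT { qval : V; qvalP : `[< W qval /\ qrep qval = qval >] }.

HB.instance Definition _ := [isSub for qval].
HB.instance Definition _ := [Choice of qT by <:].

Let qpi_proof x : W x -> `[< W (qrep x) /\ qrep (qrep x) = qrep x >].
Proof.
move=> Wx; apply/asboolP; split; last exact: qrepE (qrepP x).
by rewrite -(subrK x (qrep x)); apply: WD => //; apply: sq_NW; apply: qrepP.
Qed.

(** Made total by sending everything outside [W] to the class of 0. *)
Definition qpi (x : V) : qT :=
  match pselect (W x) with
  | left h => QT (qpi_proof h)
  | right _ => QT (qpi_proof W0)
  end.

Lemma qval_W d : W (qval d).
Proof. by case: d => x /= /asboolP[]. Qed.

Lemma qval_pi x : W x -> qval (qpi x) = qrep x.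
Proof. by move=> Wx; rewrite /qpi; case: pselect. Qed.

Lemma qvalK d : qpi (qval d) = d.
Proof.
apply: val_inj; rewrite /= qval_pi; last exact: qval_W.
by case: d => x /= /asboolP[].
Qed.

Lemma qpi_eq x y : W x -> W y -> N (x - y) -> qpi x = qpi y.
Proof. by move=> Wx Wy h; apply: val_inj; rewrite /= !qval_pi //; apply: qrepE. Qed.

Lemma qpi_inj x y : W x -> W y -> qpi x = qpi y -> N (x - y).
Proof.
move=> Wx Wy /(congr1 qval); rewrite !qval_pi // => h.
rewrite -(subrKA (qrep y)); apply: ND; last exact: qrepP.
by rewrite -h -opprB -sub0r; apply: NB => //; apply: qrepP.
Qed.

Lemma qpi_val x : W x -> N (qval (qpi x) - x).
Proof. by move=> Wx; rewrite qval_pi //; apply: qrepP. Qed.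

Let qadd d e := qpi (qval d + qval e).
Let qopp d := qpi (- qval d).
Let qscale c d := qpi (c *: qval d).

Let qpiD x y : W x -> W y -> qadd (qpi x) (qpi y) = qpi (x + y).
Proof.
move=> Wx Wy; apply: qpi_eq; [by apply: WD; apply: qval_W | exact: WD |].
by rewrite opprD addrACA; apply: ND; apply: qpi_val.
Qed.

Let qpiZ c x : W x -> qscale c (qpi x) = qpi (c *: x).
Proof.
move=> Wx; apply: qpi_eq; [by apply: WZ; apply: qval_W | exact: WZ |].
by rewrite -scalerBr; apply: NZ; apply: qpi_val.
Qed.

Let qpi_surj d : exists2 x, W x & qpi x = d.
Proof. by exists (qval d); [exact: qval_W | exact: qvalK]. Qed.

Let qaddA : associative qadd.
Proof.
move=> d e f; have [x Wx <-] := qpi_surj d; have [y Wy <-] := qpi_surj e.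
have [z Wz <-] := qpi_surj f.
by rewrite !qpiD ?addrA //; apply: WD.
Qed.

Let qaddC : commutative qadd.
Proof. by move=> d e; rewrite /qadd addrC. Qed.

Let qadd0 : left_id (qpi 0) qadd.
Proof. by move=> d; have [x Wx <-] := qpi_surj d; rewrite qpiD // add0r. Qed.

Let qaddN : left_inverse (qpi 0) qopp qadd.
Proof.
move=> d; have [x Wx <-] := qpi_surj d.
rewrite /qopp qpiD ?qvalK; last 2 first.
- by rewrite -scaleN1r; apply: WZ; apply: qval_W.
- by [].
apply: qpi_eq => //.
  by apply: WD => //; rewrite -scaleN1r; apply: WZ; apply: qval_W.
by rewrite subr0 addrC -opprB -sub0r; apply: NB => //; apply: qpi_val.
Qed.

HB.instance Definition _ := GRing.isZmodule.Build qT qaddA qaddC qadd0 qaddN.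

Lemma qpi_add x y : W x -> W y -> qpi (x + y) = qpi x + qpi y.
Proof. by move=> Wx Wy; rewrite -qpiD. Qed.

Let qscaleA a b d : qscale a (qscale b d) = qscale (a * b) d.
Proof.
by have [x Wx <-] := qpi_surj d; rewrite !qpiZ ?scalerA //; apply: WZ.
Qed.

Let qscale1 : left_id 1 qscale.
Proof. by move=> d; have [x Wx <-] := qpi_surj d; rewrite !qpiZ ?scale1r. Qed.

Let qscaleDr : right_distributive qscale +%R.
Proof.
move=> c d e; have [x Wx <-] := qpi_surj d; have [y Wy <-] := qpi_surj e.
by rewrite -qpi_add // !qpiZ ?scalerDr ?qpi_add //; first [exact: WZ | exact: WD].
Qed.

Let qscaleDl d : {morph qscale^~ d : a b / a + b}.
Proof.
move=> a b; have [x Wx <-] := qpi_surj d.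
by rewrite !qpiZ // scalerDl qpi_add //; apply: WZ.
Qed.

HB.instance Definition _ := GRing.Zmodule_isLmodule.Build R[i] qT
  qscaleA qscale1 qscaleDr qscaleDl.

Lemma qpi_scale c x : W x -> qpi (c *: x) = c *: qpi x.
Proof. by move=> Wx; rewrite -qpiZ. Qed.

Lemma qpi0 : qpi 0 = 0. Proof. by []. Qed.

Definition qset (d : qT) : set R := [set r | exists x, [/\ W x, qpi x = d & r = nm x]].
Definition qnm (d : qT) : R := inf (qset d).

Let qset_inf d : has_inf (qset d).
Proof.
split; last by exists 0 => _ [x [_ _ ->]]; exact: nm_ge0.
by have [x Wx <-] := qpi_surj d; exists (nm x), x.
Qed.

Lemma qnm_le x : W x -> qnm (qpi x) <= nm x.
Proof. by move=> Wx; apply: ge_inf; [case: (qset_inf (qpi x)) | exists x]. Qed.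

Lemma qnm_lift d (e : R) : 0 < e -> exists x, [/\ W x, qpi x = d & nm x < qnm d + e].
Proof.
by move=> e0; have [_ [x [Wx <- ->]] h] := inf_adherent e0 (qset_inf d); exists x.
Qed.

Lemma qnm_ge0 d : 0 <= qnm d.
Proof.
by apply: lb_le_inf; [case: (qset_inf d) | move=> _ [x [_ _ ->]]; exact: nm_ge0].
Qed.

Let qnmD d e : qnm (d + e) <= qnm d + qnm e.
Proof.
apply/ler_addgt0Pr => r r0; have r2 : 0 < r / 2 by rewrite divr_gt0.
have [x [Wx <- hx]] := qnm_lift d r2; have [y [Wy <- hy]] := qnm_lift e r2.
rewrite -qpi_add // (le_trans (qnm_le (WD Wx Wy))) // (le_trans (nmD _ _)) //.
by rewrite (splitr r) addrACA lerD // ltW.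
Qed.

Let qnmZ_le c d : qnm (c *: d) <= nm c * qnm d.
Proof.
apply/ler_addgt0Pr => r r0; have [x [Wx <- hx]] := qnm_lift d (div_succ_gt0 (nm_ge0 c) r0).
rewrite -qpi_scale // (le_trans (qnm_le (WZ c Wx))) // nmZ.
rewrite (le_trans (ler_wpM2l (nm_ge0 c) (ltW hx))) // mulrDr lerD2l.
exact: mul_div_succ (nm_ge0 c) r0.
Qed.

Let qnmZ c d : qnm (c *: d) = nm c * qnm d.
Proof.
apply/le_anti; rewrite qnmZ_le /=; have [->|c0] := eqVneq c 0.
  by rewrite nm0 mul0r qnm_ge0.
have nc0 : 0 < nm c.
  by apply: nm_gt0; apply: contra c0 => /eqP/nm_eq0/eqP.
by rewrite -ler_pdivlMl // -nmV; have := qnmZ_le c^-1 (c *: d); rewrite scalerK.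
Qed.

Let qnm0 d : qnm d = 0 -> d = 0.
Proof.
move=> h; have [x Wx dx] := qpi_surj d; rewrite -dx -qpi0; apply: qpi_eq => //.
have [_ _ _ Ncl] := sq_Nclosed s; rewrite subr0; apply: Ncl => e e0.
have [y [Wy yd hy]] := qnm_lift d e0; rewrite h add0r in hy.
exists (x - y); first by apply: qpi_inj => //; rewrite dx yd.
by rewrite opprB addrC subrK.
Qed.

(** Pass to a subsequence [M] whose successive differences are at most [ep k = 2^-k], lift the
    differences to vectors of norm at most [2 ep k], and sum the lifts in [V]; the class of the sum
    is the limit. *)
Let qnm_complete (u : nat -> qT) :
  (forall e : R, 0 < e -> exists K, forall m n, (K <= m)%N -> (K <= n)%N ->
     qnm (u m - u n) <= e) ->
  exists l, forall e : R, 0 < e -> exists K, forall n, (K <= n)%N ->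
     qnm (u n - l) <= e.
Proof.
move=> cu; pose ep (k : nat) : R := 2^-1 ^+ k.
have ep0 k : 0 < ep k by rewrite exprn_gt0 // invr_gt0.
have epS k : ep k = ep k.+1 + ep k.+1 by rewrite /ep exprS; lra.
have [K hK] := choice (fun k => cu (ep k) (ep0 k)).
have hL (d : qT) (k : nat) : exists x, [/\ W x, qpi x = d & nm x < qnm d + ep k].
  exact: qnm_lift.
have [L HL] := choice (fun p : qT * nat => hL p.1 p.2).
pose M := fix M k := if k is j.+1 then maxn (M j) (K k) else K 0%N.
have MK k j : (k <= j)%N -> (K k <= M j)%N.
  elim: j => [|j IH]; first by rewrite leqn0 => /eqP ->.
  rewrite leq_eqVlt ltnS => /orP[/eqP ->|/IH h]; first by rewrite leq_maxr.
  exact: leq_trans h (leq_maxl _ _).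
pose x := fix x k := if k is j.+1 then x j + L (u (M k) - u (M j), j) else L (u (M 0%N), 0%N).
have xP k : W (x k) /\ qpi (x k) = u (M k).
  elim: k => [|k [Wk pk]] /=; first by have [] := HL (u (K 0%N), 0%N).
  have [/= WL pL _] := HL (u (maxn (M k) (K k.+1)) - u (M k), k).
  by split; [exact: WD | rewrite qpi_add // pk pL addrC subrK].
have xS k : nm (x k.+1 - x k) <= ep k + ep k.
  rewrite /= addrAC subrr add0r.
  have [_ _ /ltW h] := HL (u (maxn (M k) (K k.+1)) - u (M k), k).
  apply: (le_trans h); rewrite lerD2r; apply: hK; last exact: MK.
  by rewrite leq_max MK.
(* The geometric sum in telescoping form: [2 ep k = 4 ep k - 4 ep k.+1]. *)
have xc k j : nm (x (k + j)%N - x k) <= 4 * ep k - 4 * ep (k + j)%N.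
  elim: j => [|j IH]; first by rewrite addn0 !subrr nm0.
  rewrite addnS (le_trans (nm_tri _ (x (k + j)%N) _)) //.
  by have := xS (k + j)%N; have := epS (k + j)%N; lra.
have small (e : R) : 0 < e -> exists k, ep k <= e.
  move=> e0; have [k hk] : exists k : nat, e^-1 < k%:R.
    by exists (Num.trunc e^-1).+1; rewrite truncnS_gt.
  exists k; rewrite /ep exprVn invf_ple ?posrE ?exprn_gt0 //.
  rewrite (le_trans (ltW hk)) // -natrX ler_nat; apply: ltnW; exact: ltn_expl.
have [|l hl] := @seq_complete R V x.
  move=> e e0; have [|k hk] := small (e / 8); first by lra.
  exists k => m n hm hn; rewrite -(subnKC hm) -(subnKC hn).
  apply: le_trans (nm_tri _ (x k) _) _; rewrite (nm_distC (x k)).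
  have := xc k (m - k)%N; have := xc k (n - k)%N.
  have := ep0 (k + (m - k))%N; have := ep0 (k + (n - k))%N; lra.
have Wl : W l.
  have [_ _ _ Wcl] := sq_Wclosed s; apply: Wcl => e e0.
  have [|k hk] := hl (e / 2); first by lra.
  exists (x k); first by have [] := xP k.
  by rewrite nm_distC; have := hk k (leqnn _); lra.
exists (qpi l) => e e0.
have [|k hk] := small (e / 2); first by lra.
have [|k' hk'] := hl (e / 2); first by lra.
exists (M k) => n hn; pose j := maxn k k'.
have [Wj pj] := xP j.
rewrite -(subrK (u (M j)) (u n)) -addrA (le_trans (qnmD _ _)) // (splitr e) lerD //.
  rewrite (le_trans _ hk) //; apply: hK; first exact: leq_trans (MK _ _ (leqnn _)) hn.
  by rewrite MK // leq_maxl.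
rewrite -pj -scaleN1r -qpi_scale // -qpi_add ?scaleN1r //; last by rewrite -scaleN1r; apply: WZ.
by rewrite (le_trans (qnm_le (WB Wj Wl))) // hk' // leq_maxr.
Qed.

Definition quot_data := BanachData qnmD qnmZ qnm0 qnm_complete.
Definition quot := banach_of quot_data.
HB.instance Definition _ := CompleteNormedModule.on quot.

Definition qproj (x : V) : quot := qpi x.
Definition qsec (d : quot) : V := qval d.

Lemma qsecW d : W (qsec d). Proof. exact: qval_W. Qed.

Lemma qsecK d : qproj (qsec d) = d. Proof. exact: qvalK. Qed.

Lemma qprojD x y : W x -> W y -> qproj (x + y) = qproj x + qproj y.
Proof. exact: qpi_add. Qed.

Lemma qprojZ c x : W x -> qproj (c *: x) = c *: qproj x.
Proof. exact: qpi_scale. Qed.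

Lemma qproj_eq x y : W x -> W y -> qproj x = qproj y <-> N (x - y).
Proof. by move=> Wx Wy; split; [exact: qpi_inj | exact: qpi_eq]. Qed.

Lemma nm_qproj x : W x -> nm (qproj x) <= nm x.
Proof. exact: qnm_le. Qed.

Lemma quot_lift d (e : R) : 0 < e -> exists x, [/\ W x, qproj x = d & nm x < nm d + e].
Proof. exact: qnm_lift. Qed.

End BanachQuotient.

(** * Quotients of C*-algebras and of correspondences *)

Section Ideals.
Variables (R : realType) (A : cstarAlgType R).
Implicit Types (J : A -> Prop) (a b : A).

Lemma uinj_mulr1 a (u : unitz A) : uscal u = 1 ->
  uinj a * u = uinj (a + cmul a (upart u)).
Proof.
by move=> u1; rewrite [in LHS](unitzE u) u1 scale1r mulrDr mulr1 -uinjM -uinjD.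
Qed.

Lemma nm_uM_lel (u v : unitz A) : nm u <= 1 -> nm (u * v) <= nm v.
Proof. by move=> u1; rewrite (le_trans (nm_uM _ _)) // ler_piMl ?nm_ge0. Qed.

Lemma nm_uM_ler (u v : unitz A) : nm u <= 1 -> nm (v * u) <= nm v.
Proof. by move=> u1; rewrite (le_trans (nm_uM _ _)) // ler_piMr ?nm_ge0. Qed.

(** Applied with [u = 1 - e], [e] an approximate unit of an ideal and [b] a perturbation in that
    ideal: [u] nearly kills [b] and does not enlarge [a]. Both quotient norms below are computed
    with it. *)
Lemma nm_conj_add (u : unitz A) a b : uscal u = 1 -> nm u <= 1 ->
  nm (u * uinj (a + b) * u) <= nm a + nm (b + cmul b (upart u)).
Proof.
move=> u1 un; rewrite uinjD mulrDr mulrDl; apply: le_trans (nmD _ _) _; apply: lerD.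
  by rewrite -(nm_uinj a); apply: le_trans (nm_uM_ler _ un) (nm_uM_lel _ un).
by rewrite -mulrA; apply: le_trans (nm_uM_lel _ un) _; rewrite uinj_mulr1 // nm_uinj.
Qed.

Lemma cideal_span J : cideal J -> closed_subspace J.
Proof. by case. Qed.

Lemma cideal_dual J a : cideal J -> (forall e : R, 0 < e -> exists2 b, J b & nm (a - b) <= e) -> J a.
Proof. by move=> [cJ _ _ _]; exact: subspace_approx. Qed.

(* [|a u|^2 = |u (a^* a) u|] *)
Lemma approx_right J a (e : R) : cideal J -> J (cmul (star a) a) -> 0 < e ->
  exists u : unitz A, [/\ uscal u = 1, J (upart u), ust u = u, nm u <= 1 &
    nm (a + cmul a (upart u)) <= e].
Proof.
move=> cJ Ja e0; have e2 : 0 < e ^+ 2 by rewrite exprn_gt0.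
have pa : pos (uinj (cmul (star a) a)) by rewrite uinjM uinj_star; apply: pos_star.
have [u [u1 Ju us un h] _] := approx_unit cJ Ja pa e2; exists u; split=> //.
rewrite -ler_sqr ?nnegrE ?nm_ge0 ?(ltW e0) // -nm_uinj -uinj_mulr1 //.
by rewrite -nm_ucstar ustM us mulrA -(mulrA u) -uinj_star -uinjM.
Qed.

Lemma cideal_hereditary J a : cideal J -> J (cmul (star a) a) -> J a.
Proof.
move=> cJ Ja; have [_ _ Jl _] := cJ; apply: (cideal_dual cJ) => e e0.
have [u [u1 Ju us un h]] := approx_right cJ Ja e0.
exists (- cmul a (upart u)); last by rewrite opprK.
by rewrite -cmulNr; apply: Jl; rewrite -scaleN1r; have [[_ _ JZ _] _ _ _] := cJ; apply: JZ.
Qed.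

Lemma approx_left J a (e : R) : cideal J -> J a -> 0 < e ->
  exists2 b, J b & nm (a - cmul b a) <= e.
Proof.
move=> cJ Ja e0; have [[_ _ JZ _] Jr Jl Js] := cJ.
have Ja' : J (cmul (star (star a)) (star a)) by apply: Jl; apply: Js.
have [u [u1 Ju us un h]] := approx_right cJ Ja' e0.
exists (- star (upart u)); first by rewrite -scaleN1r; apply: JZ; apply: Js.
by rewrite cmulNl opprK -nm_star starD starM starK.
Qed.

(** The root has to lie in [J] to have an image under a map like [ra_q]; this is how inner products
    stay positive after reduction. *)
Lemma cideal_pos_root J a : cideal J -> J a -> cpositive a ->
  exists2 b, J b & a = cmul (star b) b.
Proof.
move=> cJ Ja /cpositive_pos/pos_sqrt_mem[k [_ ks kk]]; exists k; last by rewrite ks.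
by apply: cideal_hereditary => //; rewrite ks kk.
Qed.

End Ideals.

(* An algebra [ra_D] with a surjection [ra_q] from a closed ideal [ra_J];
   [ra_q] is meaningless outside the ideal. *)
Record redalg (R : realType) (A : cstarAlgType R) := RedAlg {
  ra_D : cstarAlgType R;
  ra_J : A -> Prop;
  ra_q : A -> ra_D;
  ra_cideal : cideal ra_J;
  ra_qD : forall a b, ra_J a -> ra_J b -> ra_q (a + b) = ra_q a + ra_q b;
  ra_qZ : forall c a, ra_J a -> ra_q (c *: a) = c *: ra_q a;
  ra_qM : forall a b, ra_J a -> ra_J b -> ra_q (cmul a b) = cmul (ra_q a) (ra_q b);
  ra_qS : forall a, ra_J a -> ra_q (star a) = star (ra_q a);
  ra_lift : forall d (e : R), 0 < e -> exists a, [/\ ra_J a, ra_q a = d & nm a < nm d + e];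
  ra_nm : forall a, ra_J a -> nm (ra_q a) <= nm a
}.

Lemma cidealT (R : realType) (A : cstarAlgType R) : cideal (fun _ : A => True).
Proof. by split=> //; exact: subspaceT. Qed.

Definition id_redalg (R : realType) (A : cstarAlgType R) : redalg A.
Proof.
apply: (@RedAlg R A A (fun=> True) id (cidealT A)) => // d e e0.
by exists d; split=> //; rewrite ltrDl.
Defined.

Record idealpair (R : realType) (A : cstarAlgType R) := IdealPair {
  ip_J : A -> Prop;
  ip_I : A -> Prop;
  ip_Jideal : cideal ip_J;
  ip_Iideal : cideal ip_I
}.

Section AlgebraQuotient.
Variables (R : realType) (A : cstarAlgType R) (p : idealpair A).
Local Notation J := (ip_J p).
Local Notation I := (ip_I p).
Local Notation N := (fun a => J a /\ I a).

Let cN : cideal N.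
Proof.
have [cJ Jr Jl Js] := ip_Jideal p; have [cI Ir Il Is] := ip_Iideal p.
split; first exact: subspaceI.
- by move=> a b [? ?]; split; [apply: Jr | apply: Ir].
- by move=> a b [? ?]; split; [apply: Jl | apply: Il].
- by move=> a [? ?]; split; [apply: Js | apply: Is].
Qed.

(** [J / (J /\ I)] stands for the image of [J] in [A / I]; in this form no closedness of an image
    has to be shown. *)
Definition alg_subquot : subquot A :=
  @SubQuot R A J N (cideal_span (ip_Jideal p)) (cideal_span cN) (fun x h => proj1 h).

Definition algquot : Type := quot alg_subquot.
HB.instance Definition _ := CompleteNormedModule.on algquot.

Let pi : A -> algquot := @qproj R A alg_subquot.
Let sec : algquot -> A := @qsec R A alg_subquot.
Let J_sec d : J (sec d). Proof. exact: qsecW. Qed.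
Let secK d : pi (sec d) = d. Proof. exact: qsecK. Qed.
Let piD x y : J x -> J y -> pi (x + y) = pi x + pi y. Proof. exact: (@qprojD R A alg_subquot). Qed.
Let piZ c x : J x -> pi (c *: x) = c *: pi x. Proof. exact: (@qprojZ R A alg_subquot). Qed.
Let pi_eq x y : J x -> J y -> pi x = pi y <-> N (x - y). Proof. exact: (@qproj_eq R A alg_subquot). Qed.
Let nm_pi x : J x -> nm (pi x) <= nm x. Proof. exact: (@nm_qproj R A alg_subquot). Qed.
Let lift d (e : R) : 0 < e -> exists x, [/\ J x, pi x = d & nm x < nm d + e].
Proof. exact: (@quot_lift R A alg_subquot). Qed.
Let surj d : exists2 x, J x & pi x = d.
Proof. by exists (sec d). Qed.
Let JM x y : J x -> J (cmul x y). Proof. by have [_ h _ _] := ip_Jideal p; apply: h. Qed.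
Let JS x : J x -> J (star x). Proof. by have [_ _ _ h] := ip_Jideal p; apply: h. Qed.
Let JD x y : J x -> J y -> J (x + y). Proof. by have [[_ h _ _] _ _ _] := ip_Jideal p; apply: h. Qed.
Let JZ c x : J x -> J (c *: x). Proof. by have [[_ _ h _] _ _ _] := ip_Jideal p; apply: h. Qed.

Let mul (d e : algquot) : algquot := pi (cmul (sec d) (sec e)).
Let st (d : algquot) : algquot := pi (star (sec d)).

Let piM x y : J x -> J y -> pi (cmul x y) = mul (pi x) (pi y).
Proof.
move=> Jx Jy; apply/esym/pi_eq; [exact: JM | exact: JM |].
have hx : N (sec (pi x) - x) by apply/pi_eq => //; rewrite secK.
have hy : N (sec (pi y) - y) by apply/pi_eq => //; rewrite secK.
have -> : cmul (sec (pi x)) (sec (pi y)) - cmul x y =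
  cmul (sec (pi x)) (sec (pi y) - y) + cmul (sec (pi x) - x) y.
  by rewrite cmulDr cmulDl cmulNl cmulNr addrA subrK.
have [[_ ND _ _] Nr Nl _] := cN; apply: ND; [exact: Nl | exact: Nr].
Qed.

Let piS x : J x -> pi (star x) = st (pi x).
Proof.
move=> Jx; apply/esym/pi_eq; [exact: JS | exact: JS |].
have hx : N (sec (pi x) - x) by apply/pi_eq => //; rewrite secK.
by have [_ _ _ Ns] := cN; rewrite -starB; apply: Ns.
Qed.

Let mulA : associative mul.
Proof.
move=> d e f; have [x Jx <-] := surj d; have [y Jy <-] := surj e.
by have [z Jz <-] := surj f; rewrite -!piM ?cmulA //; apply: JM.
Qed.

Let mulDl : left_distributive mul +%R.
Proof.
move=> d e f; have [x Jx <-] := surj d; have [y Jy <-] := surj e.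
have [z Jz <-] := surj f.
by rewrite -piD // -!piM ?cmulDl ?piD //; first [exact: JM | exact: JD].
Qed.

Let mulDr : right_distributive mul +%R.
Proof.
move=> d e f; have [x Jx <-] := surj d; have [y Jy <-] := surj e.
have [z Jz <-] := surj f.
by rewrite -piD // -!piM ?cmulDr ?piD //; first [exact: JM | exact: JD].
Qed.

Let mulZl (c : R[i]) d e : mul (c *: d) e = c *: mul d e.
Proof.
have [x Jx <-] := surj d; have [y Jy <-] := surj e.
by rewrite -piZ // -!piM ?cmulZl ?piZ //; first [exact: JM | exact: JZ].
Qed.

Let mulZr (c : R[i]) d e : mul d (c *: e) = c *: mul d e.
Proof.
have [x Jx <-] := surj d; have [y Jy <-] := surj e.
by rewrite -piZ // -!piM ?cmulZr ?piZ //; first [exact: JM | exact: JZ].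
Qed.

Let stK : involutive st.
Proof. by move=> d; have [x Jx <-] := surj d; rewrite -!piS ?starK //; apply: JS. Qed.

Let stD : {morph st : a b / a + b}.
Proof.
move=> d e; have [x Jx <-] := surj d; have [y Jy <-] := surj e.
by rewrite -piD // -!piS ?starD ?piD //; first [exact: JS | exact: JD].
Qed.

Let stZ (c : R[i]) d : st (c *: d) = Num.conj c *: st d.
Proof.
have [x Jx <-] := surj d.
by rewrite -piZ // -!piS ?starZ ?piZ //; first [exact: JS | exact: JZ].
Qed.

Let stM d e : st (mul d e) = mul (st e) (st d).
Proof.
have [x Jx <-] := surj d; have [y Jy <-] := surj e.
by rewrite -piM // -!piS // -?piM ?starM //; first [exact: JS | exact: JM].
Qed.

Let nm_mul d e : nm (mul d e) <= nm d * nm e.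
Proof.
have h x : J x -> nm (mul (pi x) e) <= nm x * nm e.
  move=> Jx; apply/ler_addgt0Pr => r r0.
  have [y [Jy <- hy]] := lift e (div_succ_gt0 (nm_ge0 x) r0).
  have Jxy : J (cmul x y) by exact: JM.
  rewrite -piM //; apply: le_trans (nm_pi Jxy) _; apply: le_trans (nm_cmul _ _) _.
  rewrite (le_trans (ler_wpM2l (nm_ge0 x) (ltW hy))) // mulrDr lerD2l.
  exact: mul_div_succ (nm_ge0 x) r0.
apply/ler_addgt0Pr => r r0; have [x [Jx <- hx]] := lift d (div_succ_gt0 (nm_ge0 e) r0).
rewrite (le_trans (h x Jx)) // (le_trans (ler_wpM2r (nm_ge0 e) (ltW hx))) //.
by rewrite mulrDl lerD2l mulrC mul_div_succ ?nm_ge0.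
Qed.

Let nm_st_le d : nm (st d) <= nm d.
Proof.
apply/ler_addgt0Pr => r r0; have [x [Jx <- /ltW hx]] := lift d r0.
by rewrite -piS // (le_trans (nm_pi (JS Jx))) // nm_star.
Qed.

(** Take a lift [z] of [d^* d] of almost minimal norm and any lift [x] of [d], so that
    [x^* x = z + i] with [i] in [N]. For [u = 1 - e] with [e] an approximate unit in [N], [x u]
    still lifts [d] and [|x u|^2 = |u (z + i) u|] is at most [|z|] up to a small error. *)
Let nm_cs_ge d : nm d ^+ 2 <= nm (mul (st d) d).
Proof.
apply/ler_addgt0Pr => r r0; have r2 : 0 < r / 2 by rewrite divr_gt0.
have [z [Jz zE /ltW hz]] := lift (mul (st d) d) r2.
have [x Jx dx] := surj d; rewrite -dx -piS // -piM // in zE; last exact: JS.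
have Nz : N (cmul (star x) x - z) by apply/pi_eq => //; apply: JM; apply: JS.
set i := _ - z in Nz.
have Ni : N (cmul (star i) i) by have [_ _ Nl _] := cN; apply: Nl.
have [u [u1 Nu us un h]] := approx_right cN Ni r2.
have xu : pi (x + cmul x (upart u)) = d.
  have [_ _ Nl _] := cN; rewrite -dx; apply/pi_eq => //.
    by apply: JD => //; apply: JM.
  by rewrite addrC addKr; apply: Nl.
have hd : nm d <= nm (x + cmul x (upart u)).
  by rewrite -{1}xu nm_pi //; apply: JD => //; apply: JM.
apply: (le_trans (y := nm (x + cmul x (upart u)) ^+ 2)).
  by rewrite ler_sqr ?nnegrE ?nm_ge0.
rewrite -nm_uinj -uinj_mulr1 // -nm_ucstar ustM us mulrA -(mulrA u) -uinj_star -uinjM.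
have -> : cmul (star x) x = z + i by rewrite addrC subrK.
rewrite (splitr r) [leRHS]addrA; exact: le_trans (nm_conj_add _ _ u1 un) (lerD hz h).
Qed.

Let nm_st d : nm (st d) = nm d.
Proof. by apply/le_anti; rewrite nm_st_le /= -{1}(stK d) nm_st_le. Qed.

Let nm_cs d : nm (mul (st d) d) = nm d ^+ 2.
Proof.
by apply/le_anti; rewrite nm_cs_ge andbT (le_trans (nm_mul _ _)) // nm_st expr2.
Qed.

Let normr_mul d e : `|mul d e| <= `|d| * `|e|.
Proof. by rewrite !nmE -rmorphM lecR. Qed.

Let cs_id d : `|mul (st d) d| = `|d| ^+ 2.
Proof. by rewrite !nmE -rmorphXn nm_cs. Qed.

HB.instance Definition _ := isCStarAlgebra.Build R algquot
  mulA mulDl mulDr mulZl mulZr stK stD stZ stM normr_mul cs_id.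

Definition quot_redalg : redalg A :=
  @RedAlg R A algquot J pi (ip_Jideal p) piD piZ piM piS lift nm_pi.

Lemma quot_redalg_eq0 a : J a -> ra_q quot_redalg a = 0 -> I a.
Proof.
move=> Ja h; have J0 : J 0 by have [[]] := ip_Jideal p.
have : N (a - 0) by apply/pi_eq => //; exact: h.
by rewrite subr0 => -[].
Qed.

Lemma quot_redalg_ker a : J a -> I a -> ra_q quot_redalg a = 0.
Proof.
move=> Ja Ia; have J0 : J 0 by have [[]] := ip_Jideal p.
by apply/(@pi_eq a 0) => //; rewrite subr0.
Qed.

End AlgebraQuotient.

Section RedAlgTheory.
Variables (R : realType) (A : cstarAlgType R) (ra : redalg A).
Local Notation J := (ra_J ra).
Local Notation q := (@ra_q R A ra).

Lemma ra_J0 : J 0. Proof. by have [[]] := ra_cideal ra. Qed.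
Lemma ra_JD a b : J a -> J b -> J (a + b).
Proof. by have [[_ h _ _] _ _ _] := ra_cideal ra; apply: h. Qed.
Lemma ra_JZ c a : J a -> J (c *: a).
Proof. by have [[_ _ h _] _ _ _] := ra_cideal ra; apply: h. Qed.
Lemma ra_JN a : J a -> J (- a).
Proof. by move=> Ja; rewrite -scaleN1r; apply: ra_JZ. Qed.
Lemma ra_JB a b : J a -> J b -> J (a - b).
Proof. by move=> Ja Jb; apply: ra_JD => //; apply: ra_JN. Qed.
Lemma ra_JMl a b : J a -> J (cmul a b).
Proof. by have [_ h _ _] := ra_cideal ra; apply: h. Qed.
Lemma ra_JMr a b : J b -> J (cmul a b).
Proof. by have [_ _ h _] := ra_cideal ra; apply: h. Qed.
Lemma ra_JS a : J a -> J (star a).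
Proof. by have [_ _ _ h] := ra_cideal ra; apply: h. Qed.

Lemma ra_q0 : q 0 = 0.
Proof. by rewrite -(scale0r (0 : A)) ra_qZ ?scale0r //; exact: ra_J0. Qed.

Lemma ra_qN a : J a -> q (- a) = - q a.
Proof. by move=> Ja; rewrite -scaleN1r ra_qZ // scaleN1r. Qed.

Lemma ra_qB a b : J a -> J b -> q (a - b) = q a - q b.
Proof. by move=> Ja Jb; rewrite ra_qD ?ra_qN //; apply: ra_JN. Qed.

Lemma ra_surj d : exists2 a, J a & q a = d.
Proof. by have [a [Ja <- _]] := ra_lift d (@ltr01 R); exists a. Qed.

Definition ra_sec d : A := xget 0 [set a | J a /\ q a = d].

Lemma ra_secP d : J (ra_sec d) /\ q (ra_sec d) = d.
Proof.
rewrite /ra_sec; case: (xgetP 0 [set a | J a /\ q a = d]) => [a -> //|h].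
by have [a Ja qa] := ra_surj d; case: (h a).
Qed.

Lemma ra_preim (P : ra_D ra -> Prop) : closed_subspace P ->
  closed_subspace (fun a => J a /\ P (q a)).
Proof.
move=> [P0 PD PZ Pcl]; have [[_ _ _ Jcl] _ _ _] := ra_cideal ra; split.
- by split; [exact: ra_J0 | rewrite ra_q0].
- by move=> a b [Ja Pa] [Jb Pb]; split; [exact: ra_JD | rewrite ra_qD //; exact: PD].
- by move=> c a [Ja Pa]; split; [exact: ra_JZ | rewrite ra_qZ //; exact: PZ].
- move=> a h; have Ja : J a by apply: Jcl => e /h[b [Jb _]]; exists b.
  split=> //; apply: Pcl => e /h[b [Jb Pb] ab]; exists (q b) => //.
  by rewrite -ra_qB // (le_lt_trans _ ab) // ra_nm //; apply: ra_JB.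
Qed.

Definition ra_ker a : Prop := J a /\ q a = 0.

(** An ideal of the whole of [A], although [ra_q] is multiplicative only on [J]. *)
Lemma ra_ker_ideal : cideal ra_ker.
Proof.
have kS a : ra_ker a -> ra_ker (star a).
  by move=> [Ja qa]; split; [exact: ra_JS | rewrite ra_qS // qa star0].
(* [b] may lie outside of [J]; with [c' = star c], use [(a b) (a b)' = a (b b' a')] *)
have kr a b : ra_ker a -> ra_ker (cmul a b).
  move=> [Ja qa]; have Jab : J (cmul a b) by exact: ra_JMl.
  split=> //; apply/nm_eq0/eqP; rewrite -sqrf_eq0 -nm_star -nm_cstar starK.
  rewrite -ra_qS // -ra_qM //; last exact: ra_JS.
  rewrite starM -cmulA ra_qM //; last by do 2!apply: ra_JMr; exact: ra_JS.
  by rewrite qa cmul0l nm0.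
split=> //; first exact: ra_preim (subspace0 _).
by move=> a b kb; rewrite -(starK (cmul a b)) starM; apply/kS/kr/kS.
Qed.

End RedAlgTheory.

Section CorrNorm.
Variables (R : realType) (A B : cstarAlgType R) (X : corrType A B).

Definition act_span (J : A -> Prop) : X -> Prop :=
  closed_span [set z : X | exists a x, J a /\ z = lact a x].

Lemma subspace_innerr (P : B -> Prop) (x : X) : closed_subspace P ->
  closed_subspace (fun y => P (inner x y)).
Proof.
by move=> cP; apply: (subspace_preim (f := fun y => inner x y) (M := nm x) cP) => [y z|c y|y];
  [exact: innerDr | exists c; exact: innerZr | exact: nm_innerM].
Qed.

Lemma subspace_innerl (P : B -> Prop) (y : X) : closed_subspace P ->
  closed_subspace (fun x => P (inner x y)).
Proof.
by move=> cP; apply: (subspace_preim (f := fun x => inner x y) (M := nm y) cP) => [x z|c x|x];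
  [exact: innerDl | exists (Num.conj c); exact: innerZl | rewrite mulrC nm_innerM].
Qed.

Lemma subspace_ractl (P : X -> Prop) (b : B) : closed_subspace P ->
  closed_subspace (fun x => P (ract x b)).
Proof.
by move=> cP; apply: (subspace_preim (f := fun x => ract x b) (M := nm b) cP) => [x z|c x|x];
  [exact: ractDl | exists c; exact: ractZl | rewrite mulrC nm_ract].
Qed.

Lemma subspace_lactr (P : X -> Prop) (a : A) : closed_subspace P ->
  closed_subspace (fun x => P (lact a x)).
Proof.
by move=> cP; apply: (subspace_preim (f := fun x => lact a x) (M := nm a) cP) => [x y|c x|x];
  [exact: lactDr | exists c; exact: lactZr | exact: nm_lact].
Qed.

Lemma subspace_lactl (P : X -> Prop) (x : X) : closed_subspace P ->
  closed_subspace (fun a => P (lact a x)).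
Proof.
by move=> cP; apply: (subspace_preim (f := fun a => lact a x) (M := nm x) cP) => [a b|c a|a];
  [exact: lactD | exists c; exact: lactZ | rewrite mulrC nm_lact].
Qed.

Variable J : A -> Prop.
Hypothesis cJ : cideal J.

Lemma act_span_subspace : closed_subspace (act_span J).
Proof. exact: closed_span_subspace. Qed.

Lemma act_span_gen a x : J a -> act_span J (lact a x).
Proof. by move=> Ja; apply: closed_span_gen; exists a, x. Qed.

Lemma act_span_ind (P : X -> Prop) : closed_subspace P ->
  (forall a x, J a -> P (lact a x)) -> forall x, act_span J x -> P x.
Proof. by move=> cP h; apply: closed_span_min => // _ [a [x [Ja ->]]]; apply: h. Qed.

Lemma act_span_lact a x : act_span J x -> act_span J (lact a x).
Proof.
move: x; apply: act_span_ind; first exact: subspace_lactr act_span_subspace.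
move=> b x Jb; rewrite -lactM; apply: act_span_gen; have [_ _ h _] := cJ; exact: h.
Qed.

Lemma act_span_ract x b : act_span J x -> act_span J (ract x b).
Proof.
move: x; apply: act_span_ind; first exact: subspace_ractl act_span_subspace.
by move=> a x Ja; rewrite -lact_ract; apply: act_span_gen.
Qed.

Lemma act_spanT x : act_span (fun=> True) x.
Proof.
have : closed_span [set z : X | exists a x, z = lact a x] x by rewrite lact_nondegenerate.
apply: closed_span_min; first exact: closed_span_subspace.
by move=> _ [a [y ->]]; apply: closed_span_gen; exists a, y.
Qed.

End CorrNorm.

(* [Z'] is the correspondence that [Z] induces on the reduced algebras; [p] is
   meaningful on the closed span of [ra_J ra . Z]. *)
Record redcorr (R : realType) (A B : cstarAlgType R) (Z : corrType A B)
    (ra : redalg A) (rb : redalg B) (Z' : corrType (ra_D ra) (ra_D rb))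
    (p : Z -> Z') : Prop := RedCorr {
  rc_J : forall c (z z' : Z), ra_J ra c -> ra_J rb (inner z (lact c z'));
  rc_D : forall x y, act_span (ra_J ra) x -> act_span (ra_J ra) y -> p (x + y) = p x + p y;
  rc_Z : forall c x, act_span (ra_J ra) x -> p (c *: x) = c *: p x;
  rc_inner : forall x y, act_span (ra_J ra) x -> act_span (ra_J ra) y ->
    inner (p x) (p y) = ra_q rb (inner x y);
  rc_ract : forall x b, act_span (ra_J ra) x -> ra_J rb b ->
    p (ract x b) = ract (p x) (ra_q rb b);
  rc_lact : forall a x, ra_J ra a -> act_span (ra_J ra) x ->
    p (lact a x) = lact (ra_q ra a) (p x);
  rc_surj : forall d, exists2 x, act_span (ra_J ra) x & p x = d
}.

(** The conditions under which the induced correspondence exists: [cr_J] puts the inner products in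
    the domain of the right reduction, and [cr_ker] makes the left action well defined on
    classes. *)
Record corrred (R : realType) (A B : cstarAlgType R) := CorrRed {
  cr_Z : corrType A B;
  cr_a : redalg A;
  cr_b : redalg B;
  cr_J : forall c (z z' : cr_Z), ra_J cr_a c -> ra_J cr_b (inner z (lact c z'));
  cr_ker : forall c (z z' : cr_Z), ra_J cr_a c -> ra_q cr_a c = 0 ->
    ra_q cr_b (inner z (lact c z')) = 0
}.

Section CorrQuotient.
Variables (R : realType) (A B : cstarAlgType R) (p : corrred A B).
Local Notation Z := (cr_Z p).
Local Notation ra := (cr_a p).
Local Notation rb := (cr_b p).
Local Notation Ja := (ra_J (cr_a p)).
Local Notation Jb := (ra_J (cr_b p)).
Local Notation qa := (@ra_q _ _ (cr_a p)).
Local Notation qb := (@ra_q _ _ (cr_b p)).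
Local Notation W := (@act_span R A B (cr_Z p) (ra_J (cr_a p))).
Implicit Types (w x y z : Z).

Lemma cr_W : closed_subspace W. Proof. exact: act_span_subspace. Qed.

Lemma cr_innerr z w : W w -> Jb (inner z w).
Proof.
move: w; apply: act_span_ind; first exact: subspace_innerr (cideal_span (ra_cideal _)).
by move=> c x Jc; apply: cr_J.
Qed.

Lemma cr_innerl z w : W w -> Jb (inner w z).
Proof. by move=> Ww; rewrite -inner_star; apply: ra_JS; apply: cr_innerr. Qed.

Definition cr_N w : Prop := W w /\ forall z, W z -> qb (inner z w) = 0.

Lemma cr_N_subspace : closed_subspace cr_N.
Proof.
have [W0 WD WZ Wcl] := cr_W; split.
- by split=> // z _; rewrite inner0r ra_q0.
- move=> x y [Wx hx] [Wy hy]; split=> [|z Wz]; first exact: WD.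
  by rewrite innerDr ra_qD ?hx ?hy ?addr0 //; apply: cr_innerl.
- move=> c x [Wx hx]; split=> [|z Wz]; first exact: WZ.
  by rewrite innerZr ra_qZ ?hx ?scaler0 //; apply: cr_innerl.
- move=> x hx; have Wx : W x by apply: Wcl => e /hx[y [Wy _]]; exists y.
  split=> // z Wz; apply: nm_small => e e0; have [y [Wy hy] xy] := hx _ (div_succ_gt0 (nm_ge0 z) e0).
  have Jxy : Jb (inner z (x - y)) by exact: cr_innerl.
  have -> : qb (inner z x) = qb (inner z (x - y)).
    by rewrite innerBr ra_qB ?hy ?subr0 //; apply: cr_innerl.
  apply: le_trans (ra_nm Jxy) _; apply: le_trans (nm_innerM _ _) _.
  rewrite (le_trans (ler_wpM2l (nm_ge0 z) (ltW xy))) //.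
  exact: mul_div_succ (nm_ge0 z) e0.
Qed.

Definition corr_subquot : subquot Z :=
  @SubQuot R Z W cr_N cr_W cr_N_subspace (fun x h => proj1 h).

Definition corrquot : Type := quot corr_subquot.
HB.instance Definition _ := CompleteNormedModule.on corrquot.

Let pi : Z -> corrquot := @qproj R Z corr_subquot.
Let sec : corrquot -> Z := @qsec R Z corr_subquot.
Let W_sec d : W (sec d). Proof. exact: (@qsecW R Z corr_subquot d). Qed.
Let secK d : pi (sec d) = d. Proof. exact: (@qsecK R Z corr_subquot d). Qed.
Let piD x y : W x -> W y -> pi (x + y) = pi x + pi y.
Proof. exact: (@qprojD R Z corr_subquot). Qed.
Let piZ c x : W x -> pi (c *: x) = c *: pi x.
Proof. exact: (@qprojZ R Z corr_subquot). Qed.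
Let pi_eq x y : W x -> W y -> pi x = pi y <-> cr_N (x - y).
Proof. exact: (@qproj_eq R Z corr_subquot). Qed.
Let nm_pi x : W x -> nm (pi x) <= nm x. Proof. exact: (@nm_qproj R Z corr_subquot). Qed.
Let lift d (e : R) : 0 < e -> exists x, [/\ W x, pi x = d & nm x < nm d + e].
Proof. exact: (@quot_lift R Z corr_subquot). Qed.
Let surj d : exists2 x, W x & pi x = d.
Proof. by exists (sec d). Qed.
Let WD x y : W x -> W y -> W (x + y). Proof. by have [_ h _ _] := cr_W; apply: h. Qed.
Let WZ c x : W x -> W (c *: x). Proof. by have [_ _ h _] := cr_W; apply: h. Qed.
Let Wl c x : W x -> W (lact c x). Proof. exact: act_span_lact (ra_cideal ra) _ _. Qed.
Let Wr x b : W x -> W (ract x b). Proof. exact: act_span_ract. Qed.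

Let N_sec x : W x -> cr_N (sec (pi x) - x).
Proof. by move=> Wx; apply/pi_eq => //; rewrite secK. Qed.

Let N_inner x w : W x -> cr_N w -> qb (inner x w) = 0.
Proof. by move=> Wx [_ h]; apply: h. Qed.

Let inn (d e : corrquot) : ra_D rb := qb (inner (sec d) (sec e)).

Let inn_pi x y : W x -> W y -> inn (pi x) (pi y) = qb (inner x y).
Proof.
move=> Wx Wy.
have NW u : cr_N u -> W u by case.
have e u v : W u -> cr_N (v - u) -> forall z, W z -> qb (inner z v) = qb (inner z u).
  move=> Wu Nvu z Wz; rewrite -{1}(subrK u v) innerDr ra_qD ?(N_inner Wz Nvu) ?add0r //.
    by apply: cr_innerr; apply: NW.
  exact: cr_innerr.
rewrite /inn (e _ _ Wy (N_sec Wy)) // -inner_star ra_qS; last exact: cr_innerr.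
rewrite (e _ _ Wx (N_sec Wx)) // -ra_qS ?inner_star //; exact: cr_innerr.
Qed.

Let rmul (d : corrquot) (b : ra_D rb) : corrquot := pi (ract (sec d) (ra_sec b)).

Let rmul_pi x b : W x -> Jb b -> rmul (pi x) (qb b) = pi (ract x b).
Proof.
move=> Wx Jb'; have [Js qs] := ra_secP (qb b).
apply/pi_eq; [exact: Wr | exact: Wr |].
have -> : ract (sec (pi x)) (ra_sec (qb b)) - ract x b =
   ract (sec (pi x) - x) (ra_sec (qb b)) + ract x (ra_sec (qb b) - b).
  by rewrite ractBl ractBr addrA subrK.
have [Wn hn] := N_sec Wx.
split=> [|z Wz]; first by apply: WD; exact: Wr.
have Jzx : Jb (inner z x) by exact: cr_innerr.
have Jsb : Jb (ra_sec (qb b) - b) by exact: ra_JB.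
rewrite innerDr !inner_ract ra_qD ?ra_qM //; [|exact: cr_innerr | exact: ra_JMr | exact: ra_JMr].
by rewrite hn // cmul0l add0r ra_qB // qs subrr cmul0r.
Qed.

Let lmul (a : ra_D ra) (d : corrquot) : corrquot := pi (lact (ra_sec a) (sec d)).

Let lmul_pi a x : Ja a -> W x -> lmul (qa a) (pi x) = pi (lact a x).
Proof.
move=> Ja' Wx; have [Js qs] := ra_secP (qa a).
apply/pi_eq; [exact: Wl | exact: Wl |].
have -> : lact (ra_sec (qa a)) (sec (pi x)) - lact a x =
   lact (ra_sec (qa a)) (sec (pi x) - x) + lact (ra_sec (qa a) - a) x.
  by rewrite lactBr lactBl addrA subrK.
have [Wn hn] := N_sec Wx.
have Jsa : Ja (ra_sec (qa a) - a) by exact: ra_JB.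
split=> [|z Wz]; first by apply: WD; exact: Wl.
rewrite innerDr ra_qD; [|by apply: cr_innerr; exact: Wl | by apply: cr_innerr; exact: Wl].
rewrite [X in _ + X]cr_ker ?addr0 //; last by rewrite ra_qB // qs subrr.
have := lact_star (s := Z) (star (ra_sec (qa a))) z (sec (pi x) - x).
by rewrite starK => <-; apply: hn; exact: Wl.
Qed.

(** Completeness comes with the quotient norm, which must therefore be the norm of the inner
    product. For [<=], lift [<w, w>] modulo the kernel with almost minimal norm and replace [w] by
    [w u], which has the same class, as in [nm_cs_ge]. For [>=], use lifts of almost minimal norm of
    the class itself. *)
Let inn_nm d : nm d ^+ 2 = nm (inn d d).
Proof.
have [w Ww <-] := surj d; rewrite inn_pi //.
have Jww : Jb (inner w w) by exact: cr_innerr.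
apply/le_anti/andP; split.
  apply/ler_addgt0Pr => e e0; have e2 : 0 < e / 2 by rewrite divr_gt0.
  have [b [Jb' qE /ltW nb]] := ra_lift (qb (inner w w)) e2.
  pose i := inner w w - b; have ki : ra_ker rb (cmul (star i) i).
    have [_ _ Kl _] := ra_ker_ideal rb; apply: Kl.
    by split; [exact: ra_JB | rewrite ra_qB // qE subrr].
  have [u [u1 [Ju qu] us un h]] := approx_right (ra_ker_ideal rb) ki e2.
  have hw : pi (rau w u) = pi w.
    rewrite /rau u1 scale1r; apply/pi_eq => //; first by apply: WD => //; exact: Wr.
    rewrite addrC addKr; split=> [|z Wz]; first exact: Wr.
    by rewrite inner_ract ra_qM ?qu ?cmul0r //; exact: cr_innerr.
  have Wu : W (rau w u) by rewrite /rau u1 scale1r; apply: WD => //; exact: Wr.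
  have le1 : nm (pi w) <= nm (rau w u) by rewrite -{1}hw nm_pi.
  apply: (le_trans (y := nm (rau w u) ^+ 2)); first by rewrite ler_sqr ?nnegrE ?nm_ge0.
  rewrite nm_rau_sq us (_ : uinj (inner w w) = uinj (b + i)); last by rewrite addrC subrK.
  rewrite (splitr e) [leRHS]addrA; exact: le_trans (nm_conj_add _ _ u1 un) (lerD nb h).
rewrite -(@sqr_sqrtr _ (nm (qb (inner w w)))) ?nm_ge0 // ler_sqr ?nnegrE ?sqrtr_ge0 ?nm_ge0 //.
apply/ler_addgt0Pr => e e0; have [x [Wx xE /ltW nx]] := lift (pi w) e0.
apply: le_trans nx; rewrite -inn_pi // -xE inn_pi //.
rewrite -(ger0_norm (nm_ge0 x)) -sqrtr_sqr ler_wsqrtr // nm_inner.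
by apply: ra_nm; exact: cr_innerr.
Qed.

Let rsurj b : exists2 b', Jb b' & qb b' = b. Proof. exact: ra_surj. Qed.
Let lsurj a : exists2 a', Ja a' & qa a' = a. Proof. exact: ra_surj. Qed.

Let rmulDl d e b : rmul (d + e) b = rmul d b + rmul e b.
Proof.
have [x Wx <-] := surj d; have [y Wy <-] := surj e; have [c Jc <-] := rsurj b.
by rewrite -piD // !rmul_pi ?ractDl ?piD //; first [exact: Wr | exact: WD].
Qed.

Let rmulDr d b c : rmul d (b + c) = rmul d b + rmul d c.
Proof.
have [x Wx <-] := surj d; have [b' Jb' <-] := rsurj b; have [c' Jc <-] := rsurj c.
by rewrite -ra_qD // !rmul_pi ?ractDr ?piD //; first [exact: Wr | exact: ra_JD].
Qed.

Let rmulZl (k : R[i]) d b : rmul (k *: d) b = k *: rmul d b.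
Proof.
have [x Wx <-] := surj d; have [c Jc <-] := rsurj b.
by rewrite -piZ // !rmul_pi ?ractZl ?piZ //; first [exact: Wr | exact: WZ].
Qed.

Let rmulZr (k : R[i]) d b : rmul d (k *: b) = k *: rmul d b.
Proof.
have [x Wx <-] := surj d; have [c Jc <-] := rsurj b.
by rewrite -ra_qZ // !rmul_pi ?ractZr ?piZ //; first [exact: Wr | exact: ra_JZ].
Qed.

Let rmulM d b c : rmul d (cmul b c) = rmul (rmul d b) c.
Proof.
have [x Wx <-] := surj d; have [b' Jb' <-] := rsurj b; have [c' Jc <-] := rsurj c.
by rewrite -ra_qM // !rmul_pi ?ractM //; first [exact: Wr | exact: ra_JMl].
Qed.

Let innDr d e f : inn d (e + f) = inn d e + inn d f.
Proof.
have [x Wx <-] := surj d; have [y Wy <-] := surj e; have [z Wz <-] := surj f.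
rewrite -piD // !inn_pi // ?innerDr ?ra_qD //; first [exact: WD | exact: cr_innerr].
Qed.

Let innZr (k : R[i]) d e : inn d (k *: e) = k *: inn d e.
Proof.
have [x Wx <-] := surj d; have [y Wy <-] := surj e.
rewrite -piZ // !inn_pi // ?innerZr ?ra_qZ //; first [exact: WZ | exact: cr_innerr].
Qed.

Let inn_rmul d e b : inn d (rmul e b) = cmul (inn d e) b.
Proof.
have [x Wx <-] := surj d; have [y Wy <-] := surj e; have [c Jc <-] := rsurj b.
rewrite rmul_pi // !inn_pi // ?inner_ract ?ra_qM //; first [exact: Wr | exact: cr_innerr].
Qed.

Let inn_star d e : star (inn d e) = inn e d.
Proof.
have [x Wx <-] := surj d; have [y Wy <-] := surj e.
by rewrite !inn_pi // -ra_qS ?inner_star //; exact: cr_innerr.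
Qed.

Let inn_ge0 d : cpositive (inn d d).
Proof.
have [x Wx <-] := surj d; rewrite inn_pi //.
have Jxx : Jb (inner x x) by exact: cr_innerr.
have [b Jb' bE] := cideal_pos_root (ra_cideal rb) Jxx (inner_ge0 x).
by exists (qb b); rewrite -ra_qS // -ra_qM ?bE //; exact: ra_JS.
Qed.

Let normr_inn d : `|d| ^+ 2 = `|inn d d|.
Proof. by rewrite !nmE -rmorphXn inn_nm. Qed.

HB.instance Definition _ := isHilbertModule.Build R (ra_D rb) corrquot
  rmulDl rmulDr rmulZl rmulZr rmulM innDr innZr inn_rmul inn_star inn_ge0 normr_inn.

Let lmulD a b d : lmul (a + b) d = lmul a d + lmul b d.
Proof.
have [x Wx <-] := surj d; have [a' Ja' <-] := lsurj a; have [b' Jb' <-] := lsurj b.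
by rewrite -ra_qD // !lmul_pi ?lactD ?piD //; first [exact: Wl | exact: ra_JD].
Qed.

Let lmulZ (k : R[i]) a d : lmul (k *: a) d = k *: lmul a d.
Proof.
have [x Wx <-] := surj d; have [a' Ja' <-] := lsurj a.
by rewrite -ra_qZ // !lmul_pi ?lactZ ?piZ //; first [exact: Wl | exact: ra_JZ].
Qed.

Let lmulM a b d : lmul (cmul a b) d = lmul a (lmul b d).
Proof.
have [x Wx <-] := surj d; have [a' Ja' <-] := lsurj a; have [b' Jb' <-] := lsurj b.
by rewrite -ra_qM // !lmul_pi ?lactM //; first [exact: Wl | exact: ra_JMl].
Qed.

Let lmul_star a : adjoint_pair (lmul a) (lmul (star a)).
Proof.
move=> d e; have [x Wx <-] := surj d; have [y Wy <-] := surj e; have [a' Ja' <-] := lsurj a.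
rewrite -ra_qS // !lmul_pi //; last exact: ra_JS.
have -> : inner (pi (lact a' x)) (pi y) = inn (pi (lact a' x)) (pi y) by [].
have -> : inner (pi x) (pi (lact (star a') y)) = inn (pi x) (pi (lact (star a') y)) by [].
by rewrite !inn_pi ?lact_star //; exact: Wl.
Qed.

Let lmul_nondeg :
  closed_span [set z : corrquot | exists (a : ra_D ra) (e : corrquot), z = lmul a e] = setT.
Proof.
apply/seteqP; split=> // d _; have [w Ww <-] := surj d.
set P := closed_span _; have cP : closed_subspace P by exact: closed_span_subspace.
have [P0 PD PZ Pcl] := cP.
suff : W w /\ P (pi w) by case.
move: w Ww; apply: act_span_ind.
  have [W0 WD' WZ' Wcl] := cr_W; split.
  - by split=> //; have -> : pi 0 = 0 by apply/esym; rewrite -(scale0r (pi 0)) -piZ // scale0r.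
  - by move=> x y [Wx Px] [Wy Py]; split; [exact: WD | rewrite piD //; exact: PD].
  - by move=> c x [Wx Px]; split; [exact: WZ | rewrite piZ //; exact: PZ].
  - move=> x h; have Wx : W x by apply: Wcl => e /h[y [Wy _]]; exists y.
    split=> //; apply: Pcl => e /h[y [Wy Py] xy]; exists (pi y) => //.
    have WB : W (x - y) by exact: subspaceB cr_W Wx Wy.
    have -> : pi x - pi y = pi (x - y).
      by have e' := piD WB Wy; rewrite subrK in e'; rewrite e' addrK.
    by apply: le_lt_trans xy; exact: nm_pi.
move=> c x Jc; have Wcx : W (lact c x) by exact: act_span_gen.
split=> //; apply: (subspace_approx cP) => e e0.
(* Cutting [Z] down to [J Z] is what gives non-degeneracy: [c] in [J] is close to [b c] with [b] in
   [J]. *)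
have [b Jb' h] := approx_left (ra_cideal ra) Jc (div_succ_gt0 (nm_ge0 x) e0).
exists (lmul (qa b) (pi (lact c x))).
  by apply: closed_span_gen; exists (qa b), (pi (lact c x)).
rewrite lmul_pi //.
have Wb : W (lact b (lact c x)) by exact: Wl.
have WB : W (lact c x - lact b (lact c x)) by exact: subspaceB cr_W Wcx Wb.
have -> : pi (lact c x) - pi (lact b (lact c x)) = pi (lact c x - lact b (lact c x)).
  by have e' := piD WB Wb; rewrite subrK in e'; rewrite e' addrK.
apply: le_trans (nm_pi WB) _; rewrite -lactM -lactBl; apply: le_trans (nm_lact _ _) _.
rewrite (le_trans (ler_wpM2r (nm_ge0 x) h)) // mulrC.
exact: mul_div_succ (nm_ge0 x) e0.
Qed.

HB.instance Definition _ := isCorrespondence.Build R (ra_D ra) (ra_D rb) corrquot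
  lmulD lmulZ lmulM lmul_star lmul_nondeg.

Lemma corrquot_redcorr : @redcorr R A B Z ra rb corrquot pi.
Proof.
split.
- exact: cr_J.
- exact: piD.
- exact: piZ.
- exact: inn_pi.
- by move=> x b Wx Jb'; rewrite -rmul_pi.
- by move=> a x Ja' Wx; rewrite -lmul_pi.
- exact: surj.
Qed.

End CorrQuotient.

Lemma id_redcorr (R : realType) (A B : cstarAlgType R) (Z : corrType A B) :
  @redcorr R A B Z (id_redalg A) (id_redalg B) Z id.
Proof. by split=> //; move=> d; exists d => //; exact: act_spanT. Qed.

(** * Interior tensor products *)

(** The body of [interior_tensor] with the map [t] as a parameter, so that adjoints and
    amplifications can refer to it. *)
Definition is_tensor (R : realType) (A B C : cstarAlgType R)
    (X : corrType A B) (Y : corrType B C) (T : corrType A C) (t : X -> Y -> T) : Prop :=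
  (forall (k : R[i]) x x' y, t (k *: x + x') y = k *: t x y + t x' y) /\
  (forall (k : R[i]) x y y', t x (k *: y + y') = k *: t x y + t x y') /\
  (forall x (b : B) y, t (ract x b) y = t x (lact b y)) /\
  (forall (a : A) x y, lact a (t x y) = t (lact a x) y) /\
  (forall x y (c : C), ract (t x y) c = t x (ract y c)) /\
  (forall x x' y y', inner (t x y) (t x' y') = inner y (lact (inner x x') y')) /\
  closed_span [set z : T | exists x y, z = t x y] = setT.

Section Tensor.
Variables (R : realType) (A B C : cstarAlgType R).
Variables (X : corrType A B) (Y : corrType B C) (T : corrType A C) (t : X -> Y -> T).
Hypothesis ht : is_tensor t.

Lemma tns_ract x b y : t (ract x b) y = t x (lact b y).
Proof. by have [_ [_ [h _]]] := ht. Qed.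

Lemma tns_lact a x y : lact a (t x y) = t (lact a x) y.
Proof. by have [_ [_ [_ [h _]]]] := ht. Qed.

Lemma tns_ractr x y c : ract (t x y) c = t x (ract y c).
Proof. by have [_ [_ [_ [_ [h _]]]]] := ht. Qed.

Lemma tns_inner x x' y y' : inner (t x y) (t x' y') = inner y (lact (inner x x') y').
Proof. by have [_ [_ [_ [_ [_ [h _]]]]]] := ht. Qed.

Lemma tns_dense z : closed_span [set z : T | exists x y, z = t x y] z.
Proof. by have [_ [_ [_ [_ [_ [_ ->]]]]]] := ht. Qed.

Lemma tnsDl x x' y : t (x + x') y = t x y + t x' y.
Proof. by have [h _] := ht; have := h 1 x x' y; rewrite !scale1r. Qed.

Lemma tnsDr x y y' : t x (y + y') = t x y + t x y'.
Proof. by have [_ [h _]] := ht; have := h 1 x y y'; rewrite !scale1r. Qed.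

Lemma tns0l y : t 0 y = 0.
Proof. by apply: (addrI (t 0 y)); rewrite -tnsDl !addr0. Qed.

Lemma tns0r x : t x 0 = 0.
Proof. by apply: (addrI (t x 0)); rewrite -tnsDr !addr0. Qed.

Lemma tnsZl k x y : t (k *: x) y = k *: t x y.
Proof. by have [h _] := ht; have := h k x 0 y; rewrite !addr0 tns0l addr0. Qed.

Lemma tnsZr k x y : t x (k *: y) = k *: t x y.
Proof. by have [_ [h _]] := ht; have := h k x y 0; rewrite !addr0 tns0r addr0. Qed.

Lemma tnsBl x x' y : t (x - x') y = t x y - t x' y.
Proof. by rewrite tnsDl -scaleN1r tnsZl scaleN1r. Qed.

Lemma tnsBr x y y' : t x (y - y') = t x y - t x y'.
Proof. by rewrite tnsDr -scaleN1r tnsZr scaleN1r. Qed.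

Lemma nm_tns x y : nm (t x y) <= nm x * nm y.
Proof.
rewrite -ler_sqr ?nnegrE ?mulr_ge0 ?nm_ge0 // nm_inner tns_inner.
apply: le_trans (nm_innerM _ _) _; rewrite exprMn (nm_inner x) (expr2 (nm y)) mulrCA.
by rewrite ler_wpM2l ?nm_ge0 // nm_lact.
Qed.

Lemma tns_ind (P : T -> Prop) : closed_subspace P ->
  (forall x y, P (t x y)) -> forall z, P z.
Proof.
move=> cP h z; have := @tns_dense z; apply: closed_span_min => // _ [x [y ->]].
exact: h.
Qed.

Lemma subspace_tnsl (P : T -> Prop) y : closed_subspace P -> closed_subspace (fun x => P (t x y)).
Proof.
by move=> cP; apply: (subspace_preim (f := fun x => t x y) (M := nm y) cP) => [x x'|c x|x];
  [exact: tnsDl | exists c; exact: tnsZl | rewrite mulrC nm_tns].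
Qed.

End Tensor.

Section RedCorrTheory.
Variables (R : realType) (A B : cstarAlgType R) (Z : corrType A B).
Variables (ra : redalg A) (rb : redalg B) (Z' : corrType (ra_D ra) (ra_D rb)) (p : Z -> Z').
Hypothesis hp : redcorr p.
Local Notation W := (@act_span R A B Z (ra_J ra)).

Lemma rc_innerr x y : W y -> ra_J rb (inner x y).
Proof.
move: y; apply: act_span_ind; first exact: subspace_innerr (cideal_span (ra_cideal _)).
by move=> c y Jc; apply: (rc_J hp).
Qed.

Lemma rc_0 : p 0 = 0.
Proof.
have W0 : W 0 by have [] := act_span_subspace Z (ra_J ra).
by rewrite -(scale0r (0 : Z)) (rc_Z hp) ?scale0r.
Qed.

Lemma rc_B x y : W x -> W y -> p (x - y) = p x - p y.
Proof.
have [_ _ WZ _] := act_span_subspace Z (ra_J ra) => Wx Wy.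
have WNy : W (-1 *: y) by exact: WZ.
by rewrite -scaleN1r (rc_D hp) // (rc_Z hp) // scaleN1r.
Qed.

Lemma nm_rc x : W x -> nm (p x) <= nm x.
Proof.
move=> Wx; rewrite -ler_sqr ?nnegrE ?nm_ge0 // !nm_inner (rc_inner hp) //.
by apply: ra_nm; exact: rc_innerr.
Qed.

Lemma rc_preim (P : Z' -> Prop) : closed_subspace P ->
  closed_subspace (fun x => W x /\ P (p x)).
Proof.
move=> [P0 PD PZ Pcl]; have cW := act_span_subspace Z (ra_J ra).
have [W0 WD WZ Wcl] := cW; split.
- by split=> //; rewrite rc_0.
- by move=> x y [Wx Px] [Wy Py]; split; [exact: WD | rewrite (rc_D hp) //; exact: PD].
- by move=> c x [Wx Px]; split; [exact: WZ | rewrite (rc_Z hp) //; exact: PZ].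
- move=> x h; have Wx : W x by apply: Wcl => e /h[y [Wy _]]; exists y.
  split=> //; apply: Pcl => e /h[y [Wy Py] xy]; exists (p y) => //.
  by rewrite -rc_B //; apply: le_lt_trans xy; apply/nm_rc/(subspaceB cW).
Qed.

Lemma red_injective :
  (forall c, ra_J ra c -> (forall z z' : Z, ra_q rb (inner z (lact c z')) = 0) -> ra_q ra c = 0) ->
  forall d, (forall x : Z', lact d x = 0) -> d = 0.
Proof.
move=> hinj d hd; have [c Jc qc] := ra_surj d.
(* for [z] arbitrary, [c' z] lies in the domain of [p] *)
pose c' := star c; have Jc' : ra_J ra c' by exact: ra_JS.
have h : ra_q ra (cmul c' (cmul c c')) = 0.
  apply: hinj => [|z z']; first exact: ra_JMl.
  have Wz : W (lact c z) by exact: act_span_gen.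
  have Wz' : W (lact c' z') by exact: act_span_gen.
  rewrite lactM /c' -lact_star lactM -(rc_inner hp) //; last first.
    by apply: act_span_gen.
  by rewrite [X in inner _ X](rc_lact hp) // qc hd inner0r.
(* Two uses of the C*-identity lead from [d^* d d^* = 0] to [d d^* = 0] and then to [d = 0]. *)
have e : cmul (star d) (cmul d (star d)) = 0.
  by rewrite -qc -ra_qS // -!ra_qM //; exact: ra_JMl.
have e2 : cmul d (star d) = 0.
  apply/nm_eq0/eqP; rewrite -sqrf_eq0 -nm_cstar starM starK.
  by rewrite -cmulA e cmul0r nm0.
by apply/nm_eq0/eqP; rewrite -sqrf_eq0 -nm_star -nm_cstar starK e2 nm0.
Qed.

End RedCorrTheory.

(** * Reduction of interior tensor products *)

Section RedTensor.
Variables (R : realType) (A B C : cstarAlgType R).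
Variables (ra : redalg A) (rb : redalg B) (rc : redalg C).
Variables (X : corrType A B) (Y : corrType B C) (T : corrType A C).
Variables (X' : corrType (ra_D ra) (ra_D rb)) (Y' : corrType (ra_D rb) (ra_D rc)).
Variables (T' : corrType (ra_D ra) (ra_D rc)).
Variables (pX : X -> X') (pY : Y -> Y') (pT : T -> T').
Hypotheses (hX : redcorr pX) (hY : redcorr pY) (hT : redcorr pT).

Lemma red_tensor : interior_tensor X Y T -> interior_tensor X' Y' T'.
Proof.
move=> [t ht0]; have ht : is_tensor t by exact: ht0.
pose WX := @act_span R A B X (ra_J ra); pose WY := @act_span R B C Y (ra_J rb).
pose WT := @act_span R A C T (ra_J ra).
have sX' d : exists x, WX x /\ pX x = d by have [x Wx <-] := rc_surj hX d; exists x.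
have sY' d : exists y, WY y /\ pY y = d by have [y Wy <-] := rc_surj hY d; exists y.
have [[sX sXP] [sY sYP]] := (choice sX', choice sY').
have cWX : closed_subspace WX by exact: act_span_subspace.
have cWY : closed_subspace WY by exact: act_span_subspace.
have cWT : closed_subspace WT by exact: act_span_subspace.
have WXl a x : WX x -> WX (lact a x) by exact: (act_span_lact (ra_cideal ra)).
have WYl b y : WY y -> WY (lact b y) by exact: (act_span_lact (ra_cideal rb)).
have WT_t x y : WX x -> WT (t x y).
  move: x; apply: act_span_ind; first exact: (subspace_tnsl ht).
  by move=> a x Ja; rewrite -(tns_lact ht); exact: act_span_gen.
have F x a y b : WX x -> WX a -> WY y -> WY b ->
    inner (pT (t x y)) (pT (t a b)) = inner (pY y) (lact (inner (pX x) (pX a)) (pY b)).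
  move=> Wx Wa Wy Wb; have Jxa : ra_J rb (inner x a) by exact: (rc_innerr hX).
  rewrite (rc_inner hT); [|exact: WT_t | exact: WT_t].
  rewrite (tns_inner ht) (rc_inner hX) // -(rc_lact hY) // (rc_inner hY) //.
  exact: WYl.
(* [t'] is built on chosen preimages. By [F] all inner products depend only on the images, so
   another choice differs by a vector of norm 0; this is [tE]. *)
pose t' d e := pT (t (sX d) (sY e)).
have tE x y : WX x -> WY y -> t' (pX x) (pY y) = pT (t x y).
  move=> Wx Wy; have [Wx1 e1] := sXP (pX x); have [Wy1 e2] := sYP (pY y).
  apply/eqP; rewrite -subr_eq0; apply/eqP/inner_eq0.
  by rewrite /t' innerBr !innerBl !F // e1 e2 !subrr.
have WD (V : normedModType R[i]) (P : V -> Prop) x y : closed_subspace P -> P x -> P y -> P (x + y).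
  by move=> [_ h _ _]; apply: h.
have WZ (V : normedModType R[i]) (P : V -> Prop) c x : closed_subspace P -> P x -> P (c *: x).
  by move=> [_ _ h _]; apply: h.
exists t'; split; [|split; [|split; [|split; [|split; [|split]]]]].
- move=> k d d' e; have [x [Wx <-]] := sX' d; have [x' [Wx' <-]] := sX' d'.
  have [y [Wy <-]] := sY' e; have Wkx : WX (k *: x) by exact: (WZ _ WX).
  rewrite -(rc_Z hX) // -(rc_D hX) // !tE //; last exact: (WD _ WX).
  have W1 : WT (t x y) by exact: WT_t.
  have W2 : WT (k *: t x y) by exact: (WZ _ WT).
  have W3 : WT (t x' y) by exact: WT_t.
  by rewrite (tnsDl ht) (tnsZl ht) (rc_D hT) // (rc_Z hT).
- move=> k d e e'; have [x [Wx <-]] := sX' d; have [y' [Wy' <-]] := sY' e'.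
  have [y [Wy <-]] := sY' e; have Wky : WY (k *: y) by exact: (WZ _ WY).
  rewrite -(rc_Z hY) // -(rc_D hY) // !tE //; last exact: (WD _ WY).
  have W1 : WT (t x y) by exact: WT_t.
  have W2 : WT (k *: t x y) by exact: (WZ _ WT).
  have W3 : WT (t x y') by exact: WT_t.
  by rewrite (tnsDr ht) (tnsZr ht) (rc_D hT) // (rc_Z hT).
- move=> d b e; have [x [Wx <-]] := sX' d; have [y [Wy <-]] := sY' e.
  have [b' Jb <-] := ra_surj b; rewrite -(rc_ract hX) // -(rc_lact hY) // !tE //.
  + by rewrite (tns_ract ht).
  + exact: WYl.
  + exact: act_span_ract.
- move=> a d e; have [x [Wx <-]] := sX' d; have [y [Wy <-]] := sY' e.
  have [a' Ja <-] := ra_surj a; rewrite -(rc_lact hX) // !tE //; last exact: WXl.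
  by rewrite -(rc_lact hT) ?(tns_lact ht) //; exact: WT_t.
- move=> d e c; have [x [Wx <-]] := sX' d; have [y [Wy <-]] := sY' e.
  have [c' Jc <-] := ra_surj c; rewrite -(rc_ract hY) // !tE //; last exact: act_span_ract.
  by rewrite -(rc_ract hT) ?(tns_ractr ht) //; exact: WT_t.
- move=> d d' e e'; have [x [Wx <-]] := sX' d; have [y [Wy <-]] := sY' e.
  by have [x' [Wx' <-]] := sX' d'; have [y' [Wy' <-]] := sY' e'; rewrite !tE // F.
apply/seteqP; split=> // z _; set P := closed_span _.
have cP : closed_subspace P by exact: closed_span_subspace.
have cQ := rc_preim hT cP.
have [w Ww <-] := rc_surj hT z; suff [] : WT w /\ P (pT w) by [].
move: w Ww; apply: act_span_ind => // a w Ja.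
move: w; apply: (tns_ind ht); first exact: (@subspace_lactr R A C T _ a cQ).
move=> x y; rewrite (tns_lact ht); have Wx : WX (lact a x) by exact: act_span_gen.
move: (lact a x) Wx => {}x Wx; split; first exact: WT_t.
apply: (subspace_approx cP) => e e0.
(* The vector [y] may lie outside the domain of [pY]. As [<x, x>] is in the ideal, [x] is close to
   [x b] with [b] in the ideal, and [b] moves over to [y], bringing it into the domain. *)
have Jxx : ra_J rb (inner x x) by exact: (rc_innerr hX).
have [u [u1 Ju us un] h] := approx_ract (ra_cideal rb) Jxx (div_succ_gt0 (nm_ge0 y) e0).
pose b := - upart u; have Jb : ra_J rb b by exact: ra_JN.
have Wb : WY (lact b y) by exact: act_span_gen.
exists (pT (t x (lact b y))).
  rewrite -tE //; apply: (@closed_span_gen R T'); exists (pX x), (pY (lact b y)) => //.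
rewrite -(rc_B hT); [|exact: WT_t | exact: WT_t].
have WB : WT (t x y - t x (lact b y)) := subspaceB cWT (WT_t _ _ Wx) (WT_t _ _ Wx).
apply: le_trans (nm_rc hT WB) _.
rewrite -(tns_ract ht) -(tnsBl ht) -rau_sub //; apply: le_trans (nm_tns ht _ _) _.
rewrite (le_trans (ler_wpM2r (nm_ge0 y) h)) // mulrC.
exact: mul_div_succ (nm_ge0 y) e0.
Qed.

End RedTensor.

(** * Injective left actions are isometric *)

Section Isometric.
Variables (R : realType) (A B : cstarAlgType R) (X : corrType A B).
Implicit Types (x y z v : X) (k h g : unitz A).

Definition faithful_action : Prop := forall a : A, (forall x : X, lact a x = 0) -> a = 0.

Lemma nm_adjoint (G G' : X -> X) (M : R) : adjoint_pair G G' -> 0 <= M ->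
  (forall x, nm (G x) <= M * nm x) -> forall x, nm (G' x) <= M * nm x.
Proof.
move=> GG' M0 hG x; apply: nm_le_inner; first by rewrite mulr_ge0 ?nm_ge0.
rewrite -GG'; apply: le_trans (nm_innerM _ _) _.
by rewrite mulrAC ler_wpM2r ?nm_ge0 ?hG.
Qed.

(** If [D] is the difference for [n] and [z] a root of [k], the difference for [n + 1] is
    [D + z D z + n k^2]. *)
Lemma pos_bernoulli k n : pos k -> pos ((1 + k) ^+ n - 1 - n%:R%:C *: k).
Proof.
move=> pk; have [z [pz zz zc]] := pos_sqrt pk.
have zk : GRing.comm z k by apply/commr_sym/zc/commr_refl.
elim: n => [|n IH]; first by rewrite expr0 subrr scale0r subr0; exact: pos0.
set D := _ - _ - _ in IH.
have zD : GRing.comm z D.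
  apply: commrB; last by rewrite /GRing.comm -scalerAl -scalerAr zk.
  by apply: commrB; [apply: commrX; apply: commrD => //; exact: commr1 | exact: commr1].
have -> : (1 + k) ^+ n.+1 - 1 - n.+1%:R%:C *: k = D + z * D * z + n%:R%:C *: (k * k).
  have -> : z * D * z = k * D by rewrite -mulrA -zD mulrA zz.
  rewrite exprS -natr1 rmorphD scalerDl scale1r /D mulrDl mul1r !mulrBr mulr1 -scalerAr.
  set e := (1 + k) ^+ n; set ke := k * e; set nk := _ *: k; set nkk := _ *: (k * k).
  rewrite !opprD !addrA.
  by rewrite [RHS](ACl (1*4*2*3*5*(6*7))) /= addNr addr0.
apply: posD; last by apply: posZ => //; apply: pos_sq; exact: pos_sa.
by apply: posD => //; rewrite -{1}(pos_sa pz); apply: pos_conj.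
Qed.

Lemma lau0_sq g x : ust g = g -> lau (g * g) x = 0 -> lau g x = 0.
Proof.
by move=> gs h; apply: inner_eq0; rewrite inner_lau gs -lauM h inner0r.
Qed.

(** Positivity decides the sign: a scalar part [- m] would give [t + m <= t]. *)
Lemma uscal_pos_sqrt k (m : R) : 0 < m -> pos k -> uscal (k * k) = (m * m)%:C ->
  uscal k = m%:C.
Proof.
move=> m0 [_ [t t0 ht]]; rewrite uscalM rmorphM /= => /eqP; rewrite -!expr2 eqf_sqr.
move=> /orP[/eqP //|/eqP h]; have := le_trans (nm_uscal _) ht.
rewrite uscalD uscalN h opprK uscalZ uscal1 mulr1 -rmorphD nmC ger0_norm.
  by move=> h1; exfalso; lra.
by rewrite addr_ge0 // ltW.
Qed.

(** Let [h = a^* a], [m = M^2], [y = h - m] and [k] the absolute value of [y]. Then [f = k + y],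
    twice the positive part of [y], has scalar part 0, so it comes from [A], and it suffices that
    [f] acts as 0. On a vector [v = f s] the element [h] acts as [k + m], so its powers act as
    [m^n (1 + k/m)^n], yet their norms grow at most like [m^n]. This forces [k v = 0], hence
    [f^2 s = 2 k v = 0]. Once [f = 0], [m - h = k] is positive and [|h| <= m]. *)
Lemma lact_isometric (a : A) (M : R) : faithful_action -> 0 <= M ->
  (forall x, nm (lact a x) <= M * nm x) -> nm a <= M.
Proof.
move=> fX; rewrite le_eqVlt => /orP[/eqP <- h|M0 hM].
  rewrite (fX a) ?nm0 // => x; apply/nm_eq0/le_anti; rewrite nm_ge0 andbT.
  by rewrite (le_trans (h x)) // mul0r.
pose m := M * M; have m0 : 0 < m by rewrite mulr_gt0.
pose h := uinj (cmul (star a) a); have hs : ust h = h.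
  by rewrite -uinj_star starM starK.
pose y := h - ur A m; have ys : ust y = y by rewrite ustB hs ust_ur.
have [k [pk kk kc]] := pos_sqrt (pos_sq ys).
have yk : GRing.comm y k by apply: kc; rewrite /GRing.comm mulrA.
pose f := k + y; have fs : ust f = f by rewrite ustD ys pos_sa.
have f0 : uscal f = 0.
  have yE : uscal y = - m%:C by rewrite uscalD uscal_inj add0r uscalN uscalZ uscal1 mulr1.
  have kk' : uscal (k * k) = (m * m)%:C.
    by rewrite kk uscalM yE mulrNN -rmorphM.
  by rewrite uscalD yE (uscal_pos_sqrt m0 pk kk') subrr.
have yf : y * f = k * f.
    by rewrite /f (mulrDr y k) (mulrDr k k) kk yk addrC.
have ff : f * f = k * f + k * f.
  by rewrite {1}/f mulrDl yf.
have gf : (k - y) * f = 0.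
  by rewrite (mulrBl f k y) yf subrr.
have nmh v : nm (lau h v) <= m * nm v.
  rewrite lau_uinj lactM /m -mulrA (le_trans _ (ler_wpM2l (ltW M0) (hM v))) //.
  exact: (nm_adjoint (lact_star (s := X) a) (ltW M0) hM).
have key (s : X) : lau f s = 0.
  set v := lau f s.
  have hv : lau h v = lau (k + ur A m) v.
    apply/eqP; rewrite -subr_eq0 -oppr_eq0 opprB -lauB.
    have -> : k + ur A m - h = k - y by rewrite /y opprB addrA.
    by rewrite /v -lauM gf -(scale0r (0 : unitz A)) lauZ scale0r.
  have hk : GRing.comm (k + ur A m) h.
    apply/commr_sym/commrD; last exact: ur_comm.
    by rewrite -[h](subrK (ur A m)) -/y; apply/commr_sym/commrD; [exact: commr_sym | exact: ur_comm].
  pose k' : unitz A := (m^-1)%:C *: k; have pk' : pos k' by apply: posZ; rewrite ?invr_ge0 ?(ltW m0).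
  have kE : k + ur A m = m%:C *: (1 + k').
    by rewrite scalerDr scalerA -rmorphM /= mulfV ?gt_eqF // scale1r addrC.
  have hn n : lau (h ^+ n) v = lau ((k + ur A m) ^+ n) v.
    elim: n => [|n IH] //; rewrite exprS lauM IH -lauM.
    have -> : h * (k + ur A m) ^+ n = (k + ur A m) ^+ n * h.
      by apply: commrX; apply: commr_sym.
    by rewrite lauM hv -lauM -exprSr.
  have nmhn n : nm (lau (h ^+ n) v) <= m ^+ n * nm v.
    elim: n => [|n IH]; first by rewrite lau1 mul1r.
    rewrite exprS lauM; apply: le_trans (nmh _) _.
    by rewrite exprS -mulrA ler_wpM2l ?(ltW m0).
  have cn n : nm (lau ((1 + k') ^+ n) v) <= nm v.
    have := nmhn n; rewrite hn kE exprZn lauZ -rmorphXn /= nmZr ?exprn_ge0 ?(ltW m0) //.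
    by rewrite ler_pM2l // exprn_gt0.
  (* By Bernoulli [(N + 1) <v, k' v>] is at most [<v, (1 + k')^(N+1) v>], whose norm is at most
     [|v|^2] for every [N]. *)
  have vk' : inner v (lau k' v) = 0.
    apply: nm_small => e e0; pose N := Num.trunc (nm v ^+ 2 / e).
    have hN : nm v ^+ 2 / e < N.+1%:R by rewrite truncnS_gt.
    rewrite ltr_pdivrMr // in hN.
    have n0 : 0 < N.+1%:R :> R by rewrite ltr0n.
    rewrite -(ler_pM2l n0) (le_trans _ (ltW hN)) // -nmZr ?(ltW n0) // -nm_uinj.
    apply: (le_trans (y := nm (uinj (inner v (lau ((1 + k') ^+ N.+1) v))))); last first.
      by rewrite nm_uinj (le_trans (nm_innerM _ _)) // expr2 ler_wpM2l ?nm_ge0 ?cn.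
    have p1 : pos (uinj (N.+1%:R%:C *: inner v (lau k' v))).
      by rewrite uinjZ; apply: posZ; [exact: ltW | exact: pos_lau].
    apply: pos_le_norm => //.
    have := posD (pos_lau v (pos_bernoulli N.+1 pk')) (pos_inner v).
    by rewrite !lauB lau1 lauZ !innerBr innerZr -uinjD addrAC subrK uinjB.
  have vk : inner v (lau k v) = 0.
    have -> : k = m%:C *: k' by rewrite scalerA -rmorphM /= mulfV ?scale1r // gt_eqF.
    by rewrite lauZ innerZr vk' scaler0.
  have kv : lau k v = 0.
    have [z [pz zz _]] := pos_sqrt pk; rewrite -zz in vk *.
    have zv : lau z v = 0 by apply: inner_eq0; rewrite inner_lau (pos_sa pz) -lauM.
    by rewrite lauM zv -(scale0r (0 : X)) lauZr !scale0r.
  by apply: lau0_sq => //; rewrite ff lauD lauM -/v kv addr0.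
have fa0 : f = 0.
  rewrite (uscal0P f0) (fX (upart f)) ?uinj0 // => x.
  by rewrite -lau_uinj -(uscal0P f0).
have kE : ur A m - h = k.
  by apply/eqP; rewrite -opprB -/y eq_sym -addr_eq0 -/f fa0.
have : nm h <= m.
  apply: pos_norm; [exact: ltW | | by rewrite kE].
  by rewrite /h uinjM uinj_star; exact: pos_star.
rewrite nm_uinj nm_cstar /m -expr2 ler_sqr ?nnegrE ?nm_ge0 //; exact: ltW.
Qed.

End Isometric.

(** * Compact operators and tensor products *)

Section Thetas.
Variables (R : realType) (B : cstarAlgType R) (X : hilbertModType B).
Implicit Types (x y z : X) (s : seq (X * X)) (T : X -> X).

(** Finite rank operators as lists of pairs, with the scalars absorbed in the first vectors; sums,
    adjoints and compositions become list operations. *)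
Definition thetas s z : X := \sum_(p <- s) ract p.1 (inner p.2 z).

Definition swap_pairs s := [seq (p.2, p.1) | p <- s].

Lemma thetas_cat s s' z : thetas (s ++ s') z = thetas s z + thetas s' z.
Proof. by rewrite /thetas big_cat. Qed.

Lemma thetas_cons p s z : thetas (p :: s) z = ract p.1 (inner p.2 z) + thetas s z.
Proof. by rewrite /thetas big_cons. Qed.

Lemma thetas_nil z : thetas [::] z = 0.
Proof. by rewrite /thetas big_nil. Qed.

Lemma thetas_adjoint s : adjoint_pair (thetas s) (thetas (swap_pairs s)).
Proof.
elim: s => [|[a b] s IH] x y; first by rewrite !thetas_nil inner0l inner0r.
rewrite /= !thetas_cons /= innerDl innerDr IH inner_ractl inner_ract.
by rewrite inner_star.
Qed.

Lemma thetas_map T s z : (forall x y, T (x + y) = T x + T y) ->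
  (forall x b, T (ract x b) = ract (T x) b) ->
  T (thetas s z) = thetas [seq (T p.1, p.2) | p <- s] z.
Proof.
move=> TD Tr; have T0 : T 0 = 0 by apply: (addrI (T 0)); rewrite -TD !addr0.
elim: s => [|p s IH]; first by rewrite !thetas_nil.
by rewrite /= !thetas_cons TD Tr IH.
Qed.

Lemma thetas_comp T T' s z : adjoint_pair T T' ->
  thetas s (T z) = thetas [seq (p.1, T' p.2) | p <- s] z.
Proof.
move=> TT'; elim: s => [|p s IH]; first by rewrite !thetas_nil.
by rewrite /= !thetas_cons IH (adjoint_pair_sym TT').
Qed.

Lemma nm_theta x y z : nm (ract x (inner y z)) <= nm x * nm y * nm z.
Proof.
by rewrite (le_trans (nm_ract _ _)) // -mulrA ler_wpM2l ?nm_ge0 // nm_innerM.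
Qed.

Definition cpt T : Prop := forall e : R, 0 < e ->
  exists s, forall z, nm (T z - thetas s z) <= e * nm z.

Lemma finite_rank_thetas (F : X -> X) : finite_rank F ->
  exists s, forall z, F z = thetas s z.
Proof.
move=> [n [c [f [hf ->]]]]; have [g hg] := choice hf.
have {hg} [h hg] := choice hg.
exists [seq (c i *: g i, h i) | i <- enum 'I_n] => z.
rewrite /thetas big_map big_enum /= fct_sumE; apply: eq_bigr => i _.
by rewrite ractZl (hg i).
Qed.

Lemma thetas_finite_rank s : finite_rank (thetas s).
Proof.
elim: s => [|p s IH].
  have -> : thetas [::] = 0 by apply/funext => z; rewrite thetas_nil.
  exact: lin_span0.
have -> : thetas (p :: s) = rank1 p.1 p.2 + thetas s.
  by apply/funext => z; rewrite thetas_cons.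
by apply: lin_spanD => //; apply: lin_span_gen; exists p.1, p.2.
Qed.

Lemma gen_compactP T : gen_compact T <-> adjointable T /\ cpt T.
Proof.
split=> -[aT h]; split=> // e e0.
  have [|F /finite_rank_thetas[s hs] hF] := h e%:C; first by rewrite ltcR.
  by exists s => z; have := hF z; rewrite hs !nmE -rmorphM lecR.
have [|s hs] := h (complex.Re e); first by rewrite -ltcR RRe_real ?gtr0_real.
exists (thetas s); first exact: thetas_finite_rank.
by move=> z; rewrite !nmE -[e]RRe_real ?gtr0_real // -rmorphM lecR.
Qed.

(** The operators [1 - F] with [F] of finite rank are closed under composition, hence under
    powers. *)
Lemma one_sub_thetas_comp s1 s2 : exists s, forall z,
  z - thetas s z = (z - thetas s2 z) - thetas s1 (z - thetas s2 z).
Proof.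
have G2 : adjoint_pair (fun z => z - thetas s2 z) (fun z => z - thetas (swap_pairs s2) z).
  by move=> x y; rewrite innerBl innerBr thetas_adjoint.
exists (s2 ++ [seq (p.1, p.2 - thetas (swap_pairs s2) p.2) | p <- s1]) => z.
by rewrite thetas_cat -(thetas_comp _ _ G2) opprD addrA.
Qed.

Lemma rauD x (u v : unitz B) : rau x (u + v) = rau x u + rau x v.
Proof.
rewrite /rau uscalD scalerDl; have -> : upart (u + v) = upart u + upart v by [].
by rewrite ractDr addrACA.
Qed.

Lemma rauZ x c (u : unitz B) : rau x (c *: u) = c *: rau x u.
Proof.
rewrite /rau uscalZ; have -> : upart (c *: u) = c *: upart u by [].
by rewrite ractZr scalerDr scalerA.
Qed.

Lemma rauB x (u v : unitz B) : rau x (u - v) = rau x u - rau x v.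
Proof. by rewrite rauD -(scaleN1r v) rauZ scaleN1r. Qed.

(** For one vector [x] let [F = t x <x, .>] with the constant [t] of [approx_unit]. Then [1 - F] is
    a contraction and [(1 - F)^n x = x (1 - t <x, x>)^n] is small. For a list such operators are
    composed; being contractions, they do not spoil the bounds already reached. *)
Lemma quasi_unit (L : seq X) (e : R) : 0 < e -> exists s,
  (forall z, nm (z - thetas s z) <= nm z) /\
  (forall x, x \in L -> nm (x - thetas s x) <= e).
Proof.
move=> e0.
have one_step x : exists s, (forall z, nm (z - thetas s z) <= nm z) /\
    nm (x - thetas s x) <= e.
  set a := inner x x; have e2 : 0 < e ^+ 2 by rewrite exprn_gt0.
  have [u [_ _ us un hu] [n un']] := approx_unit (cidealT B) I (pos_inner x) e2.
  set t := (nm a + 1)^-1 in un'; have t0 : 0 < t by rewrite invr_gt0 ltr_wpDl ?nm_ge0.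
  pose s1 := [:: (t%:C *: x, x)].
  have s1E z : thetas s1 z = t%:C *: ract x (inner x z).
    by rewrite thetas_cons thetas_nil addr0 ractZl.
  have contr z : nm (z - thetas s1 z) <= nm z.
    rewrite -ler_sqr ?nnegrE ?nm_ge0 // !nm_inner s1E.
    set b := inner x z; set w := z - _.
    have wE : uinj (inner z z) - uinj (inner w w) =
        t%:C *: (ust (uinj b) * (1 + (1 - t%:C *: uinj a)) * uinj b).
      rewrite /w innerBr !innerBl !innerZr !innerZl inner_ract !inner_ractl inner_ract.
      rewrite -/b -/a -(inner_star x z) -/b conjC_real !uinjB !uinjZ !uinjM uinj_star.
      set P := ust (uinj b) * uinj b.
      rewrite mulrDr mulrDl mulr1 mulrBr mulrBl mulr1 -/P -scalerAr -scalerAl mulrA.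
      rewrite scalerDr scalerBr; move: (t%:C *: P - _) => D.
      by rewrite !opprB addrC !addrA subrK addrC.
    have pw : pos (uinj (inner z z) - uinj (inner w w)).
      rewrite wE; apply: posZ; first exact: ltW.
      apply: pos_conj; apply: posD; first by rewrite -ur1; exact: pos_ur.
      rewrite -(ur1 B); apply: pos_ur_sub.
        by rewrite ustZ conjC_real (pos_sa (pos_inner x)).
      rewrite nmZr ?(ltW t0) // nm_uinj /t ler_pdivrMl; last by rewrite ltr_wpDl ?nm_ge0.
      by rewrite mulr1 lerDl.
    by have := pos_le_norm (pos_inner w) pw; rewrite !nm_uinj.
  have step v : rau x v - thetas s1 (rau x v) = rau x ((1 - t%:C *: uinj a) * v).
    rewrite s1E -rau_uinj inner_raur -/a mulrBl mul1r -scalerAl.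
    by rewrite rauB rauZ.
  have [s [hs1 hs2]] : exists s, (forall z, nm (z - thetas s z) <= nm z) /\
      x - thetas s x = rau x u.
    rewrite un'; elim: (n) => [|m [s [h1 h2]]].
      exists [::]; split=> [z|]; rewrite thetas_nil subr0 //.
      by rewrite expr0 /rau uscal1 scale1r ract0r addr0.
    have [s' hs'] := one_sub_thetas_comp s1 s; exists s'; split=> [z|].
      by rewrite hs' (le_trans (contr _)).
    by rewrite hs' h2 step exprS.
  exists s; split=> //; rewrite hs2 -ler_sqr ?nnegrE ?nm_ge0 ?(ltW e0) //.
  by rewrite nm_rau_sq us.
elim: L => [|x L [s' [h1 h2]]].
  by exists [::]; split=> // z; rewrite thetas_nil subr0.
have [s [h3 h4]] := one_step (x - thetas s' x).
have [s'' hs] := one_sub_thetas_comp s s'; exists s''; split=> [z|y].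
  by rewrite hs (le_trans (h3 _)).
rewrite inE => /orP[/eqP ->|Ly]; first by rewrite hs.
by rewrite hs (le_trans (h3 _)) // h2.
Qed.

End Thetas.

Section CptIdeal.
Variables (R : realType) (A B : cstarAlgType R) (X : corrType A B).

Lemma adjointable_lact (a : A) : adjointable (fun x : X => lact a x).
Proof. by exists (lact (star a)); exact: lact_star. Qed.

Lemma corr_properP : corr_proper X <-> forall a, cpt (fun x : X => lact a x).
Proof.
split=> h a; first by have /gen_compactP[] := h a.
by apply/gen_compactP; split; [exact: adjointable_lact | exact: h].
Qed.

Lemma cpt_subspace : closed_subspace (fun a : A => cpt (fun x : X => lact a x)).
Proof.
split.
- move=> e e0; exists [::] => z.
  by rewrite thetas_nil lact0l subr0 nm0 mulr_ge0 ?nm_ge0 // ltW.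
- move=> a b ha hb e e0; have e2 : 0 < e / 2 by rewrite divr_gt0.
  have [s hs] := ha _ e2; have [s' hs'] := hb _ e2; exists (s ++ s') => z.
  rewrite thetas_cat lactD opprD addrACA (le_trans (nmD _ _)) //.
  by rewrite (splitr e) mulrDl lerD.
- move=> c a ha e e0; have [s hs] := ha _ (div_succ_gt0 (nm_ge0 c) e0).
  exists [seq (c *: p.1, p.2) | p <- s] => z.
  rewrite -(@thetas_map _ _ _ (fun x => c *: x)); first last.
  + by move=> x b; rewrite ractZl.
  + by move=> x y; rewrite scalerDr.
  rewrite lactZ -scalerBr nmZ (le_trans (ler_wpM2l (nm_ge0 c) (hs z))) //.
  by rewrite mulrA ler_wpM2r ?nm_ge0 // mul_div_succ ?nm_ge0.
- move=> a h e e0; have e2 : 0 < e / 2 by rewrite divr_gt0.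
  have [b hb ab] := h _ e2; have [s hs] := hb _ e2; exists s => z.
  apply: le_trans (nm_tri _ (lact b z) _) _; rewrite (splitr e) mulrDl.
  apply: lerD (hs z); rewrite -lactBl; apply: le_trans (nm_lact _ _) _.
  by rewrite ler_wpM2r ?nm_ge0 // ltW.
Qed.

End CptIdeal.

Lemma bernoulli (R : realType) (r : R) n : 1 <= r -> 1 + n%:R * (r - 1) <= r ^+ n.
Proof.
move=> r1; elim: n => [|n IH]; first by rewrite mul0r addr0 expr0.
rewrite exprS -natr1; have := ler_wpM2l (le_trans ler01 r1) IH.
have : 0 <= n%:R * (r - 1) ^+ 2 by rewrite mulr_ge0 ?ler0n ?sqr_ge0.
by rewrite expr2; lra.
Qed.

(* If [a_k^2 <= s a_(k+1)] then [a_k >= s (a_0 / s)^(2^k)]; the assumed growth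
   bounds [a_0 / s]. *)
Lemma power_trick (R : realType) (a : nat -> R) (s C m : R) :
  0 <= s -> 0 <= m -> (forall k, 0 <= a k) -> (forall k, a k ^+ 2 <= s * a k.+1) ->
  (forall k, a k <= C * m ^+ (2 ^ k)) -> a 0%N <= s * m.
Proof.
move=> s0 m0 a0 aS aC; rewrite leNgt; apply/negP => h.
have a00 : 0 < a 0%N by apply: le_lt_trans h; exact: mulr_ge0.
have sp : 0 < s.
  rewrite lt_neqAle s0 andbT eq_sym; apply/eqP => se; have := aS 0%N.
  by rewrite se mul0r leNgt exprn_gt0.
have mp : 0 < m.
  rewrite lt_neqAle m0 andbT eq_sym; apply/eqP => me; have := aC 0%N.
  by rewrite me expn0 expr1 mulr0 leNgt a00.
pose r := a 0%N / (s * m); have r1 : 1 < r.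
  by rewrite /r ltr_pdivlMr ?mulr_gt0 // mul1r.
have low k : s * (r * m) ^+ (2 ^ k) <= a k.
  elim: k => [|k IH].
    by rewrite expn0 expr1 mulrCA /r divfK // mulf_neq0 // lt0r_neq0.
  rewrite -(ler_pM2l sp) (le_trans _ (aS k)) // mulrA -expr2 expnS mulnC exprM -exprMn.
  rewrite ler_pXn2r // ?nnegrE // mulr_ge0 // exprn_ge0 // mulr_ge0 //.
  by rewrite (le_trans ler01) // ltW.
have up k : s * r ^+ (2 ^ k) <= C.
  have := le_trans (low k) (aC k); rewrite exprMn mulrA ler_pM2r // exprn_gt0 //.
have d0 : 0 < s * (r - 1) by rewrite mulr_gt0 // subr_gt0.
pose k := (Num.trunc (C / (s * (r - 1)))).+1.
have hk : C < k%:R * (s * (r - 1)) by rewrite -ltr_pdivrMr // truncnS_gt.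
have h1 : k%:R * (r - 1) <= r ^+ (2 ^ k).
  have := bernoulli (2 ^ k) (ltW r1); have : k%:R <= (2 ^ k)%:R :> R.
    by rewrite ler_nat ltnW // ltn_expl.
  move=> h2 h3; apply: le_trans h3; apply: (le_trans (y := (2 ^ k)%:R * (r - 1))).
    by rewrite ler_wpM2r // subr_ge0 ltW.
  by rewrite lerDr.
have := up k; rewrite leNgt => /negP; apply; apply: lt_le_trans hk _.
by rewrite mulrCA ler_pM2l.
Qed.

(** * Operators on interior tensor products *)

Section TensorAnalysis.
Variables (R : realType) (A B C : cstarAlgType R).
Variables (X : corrType A B) (Y : corrType B C) (T : corrType A C) (t : X -> Y -> T).
Hypothesis ht : is_tensor t.
Implicit Types (x r : X) (y v : Y) (w xi : T).

(* The adjoint of [y |-> t r y] is explicit on elementary tensors. *)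
Lemma tns_riesz r xi : exists y, forall v, inner v y = inner (t r v) xi.
Proof.
move: xi; apply: (tns_ind ht); last first.
  by move=> x y; exists (lact (inner r x) y) => v; rewrite (tns_inner ht).
split.
- by exists 0 => v; rewrite !inner0r.
- by move=> w w' [y hy] [y' hy']; exists (y + y') => v; rewrite !innerDr hy hy'.
- by move=> c w [y hy]; exists (c *: y) => v; rewrite !innerZr hy.
- move=> w hw; pose ep (n : nat) : R := n.+1%:R^-1.
  have ep0 n : 0 < ep n by rewrite invr_gt0 ltr0n.
  have [u hu] := choice (fun n => let (w', a, b) := hw (ep n) (ep0 n) in
    ex_intro (fun w' => (exists y, forall v, inner v y = inner (t r v) w') /\ nm (w - w') < ep n) w' (conj a b)).
  have [y hy] := choice (fun n => proj1 (hu n)).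
  have bnd m n : nm (y m - y n) <= nm r * nm (u m - u n).
    apply: nm_le_inner; first by rewrite mulr_ge0 ?nm_ge0.
    rewrite innerBr !hy -innerBr.
    apply: le_trans (nm_innerM _ _) _; rewrite mulrAC ler_wpM2r ?nm_ge0 //.
    exact: nm_tns.
  have cu : forall e : R, 0 < e -> exists N, forall n, (N <= n)%N -> nm (u n - w) <= e.
    move=> e /inv_succ_small[N hN]; exists N => n /hN h; rewrite nm_distC.
    by have [_ h'] := hu n; apply: ltW; exact: lt_trans h' h.
  have [|l hl] := @seq_complete R Y y.
    move=> e e0; have [N hN] := cu _ (div_succ_gt0 (nm_ge0 r) (divr_gt0 e0 (ltr0n R 2))).
    exists N => m n hm hn; apply: le_trans (bnd m n) _.
    have h : nm (u m - u n) <= e / (nm r + 1).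
      have := nm_tri (u m) w (u n); rewrite (nm_distC w); have := hN m hm; have := hN n hn.
      rewrite mulrAC; lra.
    by apply: le_trans (ler_wpM2l (nm_ge0 r) h) _; exact: mul_div_succ (nm_ge0 r) e0.
  exists l => v; apply/eqP; rewrite -subr_eq0; apply/eqP/nm_small => e e0.
  have e2 : 0 < e / 2 by rewrite divr_gt0.
  have [N hN] := cu _ (div_succ_gt0 (nm_ge0 (t r v)) e2).
  have [N' hN'] := hl _ (div_succ_gt0 (nm_ge0 v) e2).
  pose n := maxn N N'.
  have -> : inner v l - inner (t r v) w = inner (t r v) (u n - w) - inner v (y n - l).
    by rewrite !innerBr hy opprB [RHS]addrC addrA subrK.
  rewrite (le_trans (nmB _ _)) // (splitr e) lerD //.
    apply: le_trans (nm_innerM _ _) _.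
    apply: le_trans (ler_wpM2l (nm_ge0 _) (hN n (leq_maxl _ _))) _.
    by apply: mul_div_succ; rewrite ?nm_ge0.
  apply: le_trans (nm_innerM _ _) _.
  apply: le_trans (ler_wpM2l (nm_ge0 _) (hN' n (leq_maxr _ _))) _.
  by apply: mul_div_succ; rewrite ?nm_ge0.
Qed.

Definition tadj r xi : Y := sval (cid (tns_riesz r xi)).

Lemma tadjP r xi v : inner v (tadj r xi) = inner (t r v) xi.
Proof. exact: (svalP (cid (tns_riesz r xi))). Qed.

Lemma tadj_tns r x y : tadj r (t x y) = lact (inner r x) y.
Proof. by apply: inner_ext => v; rewrite tadjP (tns_inner ht). Qed.

Lemma tadjD r w w' : tadj r (w + w') = tadj r w + tadj r w'.
Proof. by apply: inner_ext => v; rewrite innerDr !tadjP innerDr. Qed.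

Lemma tadj_ract r w c : tadj r (ract w c) = ract (tadj r w) c.
Proof. by apply: inner_ext => v; rewrite inner_ract !tadjP inner_ract. Qed.

Lemma nm_tadj r w : nm (tadj r w) <= nm r * nm w.
Proof.
apply: nm_le_inner; first by rewrite mulr_ge0 ?nm_ge0.
by rewrite tadjP; apply: le_trans (nm_innerM _ _) _; rewrite mulrAC ler_wpM2r ?nm_ge0 ?(nm_tns ht).
Qed.

Definition tsum (s : seq (X * Y)) (F : X -> X) : T := \sum_(p <- s) t (F p.1) p.2.

Lemma tsum_approx w (e : R) : 0 < e -> exists s, nm (w - tsum s id) <= e.
Proof.
move: w e; apply: (tns_ind ht); last first.
  move=> x y e e0; exists [:: (x, y)].
  by rewrite /tsum big_cons big_nil addr0 subrr nm0 ltW.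
split.
- by move=> e e0; exists [::]; rewrite /tsum big_nil subr0 nm0 ltW.
- move=> w w' hw hw' e e0; have e2 : 0 < e / 2 by rewrite divr_gt0.
  have [s hs] := hw _ e2; have [s' hs'] := hw' _ e2; exists (s ++ s').
  rewrite /tsum big_cat opprD addrACA; apply: le_trans (nmD _ _) _.
  by rewrite (splitr e) lerD.
- move=> c w hw e e0; have [s hs] := hw _ (div_succ_gt0 (nm_ge0 c) e0).
  exists [seq (c *: p.1, p.2) | p <- s].
  have -> : tsum [seq (c *: p.1, p.2) | p <- s] id = c *: tsum s id.
    by rewrite /tsum big_map scaler_sumr; apply: eq_bigr => p _; rewrite /= (tnsZl ht).
  rewrite -scalerBr nmZ; apply: le_trans (ler_wpM2l (nm_ge0 c) hs) _.
  by apply: mul_div_succ; rewrite ?nm_ge0.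
- move=> w hw e e0; have e2 : 0 < e / 2 by rewrite divr_gt0.
  have [w' hw' ww'] := hw _ e2; have [s hs] := hw' _ e2; exists s.
  by apply: le_trans (nm_tri _ w' _) _; rewrite (splitr e) lerD // ltW.
Qed.

Lemma tsum_inner s (F F' G : X -> X) : adjoint_pair F F' ->
  inner (tsum s F) (tsum s G) = inner (tsum s id) (tsum s (F' \o G)).
Proof.
move=> FF'; rewrite /tsum !inner_suml; apply: eq_bigr => p _.
by rewrite !inner_sumr; apply: eq_bigr => q _; rewrite !(tns_inner ht) /= FF'.
Qed.

(* [|G (x) 1| <= |G|]: with [H = G' G], the Cauchy-Schwarz inequality gives
   [|(H^j (x) 1) w|^2 <= |w| |(H^2j (x) 1) w|]. *)
Lemma nm_tsum s (G G' : X -> X) (M : R) : adjoint_pair G G' -> 0 <= M ->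
  (forall x, nm (G x) <= M * nm x) -> nm (tsum s G) <= M * nm (tsum s id).
Proof.
move=> GG' M0 hG; have hG' := nm_adjoint GG' M0 hG.
pose H x := G' (G x); have HH : adjoint_pair H H.
  by move=> x y; rewrite /H (adjoint_pair_sym GG') GG'.
have iH j : adjoint_pair (iter j H) (iter j H).
  by elim: j => [|j IH] x y //; rewrite iterS iterSr HH IH.
have nH j x : nm (iter j H x) <= (M ^+ 2) ^+ j * nm x.
  elim: j => [|j IH]; first by rewrite mul1r.
  rewrite iterS; apply: le_trans (hG' _) _.
  apply: le_trans (ler_wpM2l M0 (hG _)) _; rewrite mulrA -expr2 [(M ^+ 2) ^+ j.+1]exprS -mulrA.
  by rewrite ler_wpM2l ?sqr_ge0.
have key : nm (tsum s H) <= nm (tsum s id) * M ^+ 2.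
  have -> : tsum s H = tsum s (iter (2 ^ 0) H) by [].
  (* The crude bound of the tensors one by one suffices: its constant does not depend on the
     exponent and disappears in [power_trick]. *)
  apply: (@power_trick R (fun k => nm (tsum s (iter (2 ^ k) H))) _
     (\sum_(p <- s) nm p.1 * nm p.2)); rewrite ?nm_ge0 ?sqr_ge0 // => k.
  - by rewrite nm_ge0.
  - rewrite nm_inner (tsum_inner _ _ (iH _)); apply: le_trans (nm_innerM _ _) _.
    rewrite ler_wpM2l ?nm_ge0 // (_ : iter _ H \o _ = iter (2 ^ k.+1) H) //.
    by apply/funext => x; rewrite /= -iterD expnS mul2n addnn.
  - apply: le_trans (nm_sum _ _) _; rewrite mulr_suml; apply: ler_sum => p _.
    apply: le_trans (nm_tns ht _ _) _; rewrite mulrAC ler_wpM2r ?nm_ge0 // mulrC.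
    exact: nH.
rewrite -ler_sqr ?nnegrE ?mulr_ge0 ?nm_ge0 // nm_inner (tsum_inner _ _ GG').
apply: le_trans (nm_innerM _ _) _.
apply: le_trans (ler_wpM2l (nm_ge0 _) key) _.
by rewrite exprMn mulrA -expr2 mulrC.
Qed.

(** The a priori bound [K] serves only to pass from finite sums of elementary tensors to all of [T],
    and does not enter the result. *)
Lemma nm_amplify (G G' : X -> X) (Gt : T -> T) (M K : R) : adjoint_pair G G' -> 0 <= M ->
  (forall x, nm (G x) <= M * nm x) -> (forall w w', Gt (w + w') = Gt w + Gt w') ->
  (forall w, nm (Gt w) <= K * nm w) -> (forall x y, Gt (t x y) = t (G x) y) ->
  forall w, nm (Gt w) <= M * nm w.
Proof.
move=> GG' M0 hG GtD GtK Gt_t w.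
have Gt0 : Gt 0 = 0 by apply: (addrI (Gt 0)); rewrite -GtD !addr0.
have Gt_sum s : Gt (tsum s id) = tsum s G.
  rewrite /tsum; elim: s => [|p s IH]; first by rewrite !big_nil.
  by rewrite !big_cons GtD IH Gt_t.
apply/ler_addgt0Pr => e e0; have K1 : 0 <= `|K| + M by rewrite addr_ge0.
have [s hs] := tsum_approx w (div_succ_gt0 K1 e0); set w' := tsum s id in hs.
have -> : Gt w = Gt (w - w') + Gt w' by rewrite -GtD subrK.
apply: le_trans (nmD _ _) _; rewrite Gt_sum.
apply: le_trans (lerD (GtK _) (nm_tsum _ GG' M0 hG)) _.
have h1 : nm w' <= nm w + nm (w - w') by rewrite nm_distC addrC; exact: nm_subr.
have h2 : K * nm (w - w') <= `|K| * nm (w - w') by rewrite ler_wpM2r ?nm_ge0 // ler_norm.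
apply: le_trans (lerD h2 (ler_wpM2l M0 h1)) _; rewrite mulrDr addrCA lerD2l -mulrDl.
by apply: le_trans (ler_wpM2l K1 hs) _; exact: mul_div_succ K1 e0.
Qed.

(* [thetas s (x) 1] *)
Definition Thetas (s : seq (X * X)) w : T := \sum_(p <- s) t p.1 (tadj p.2 w).

Lemma Thetas_tns s x y : Thetas s (t x y) = t (thetas s x) y.
Proof.
rewrite /Thetas /thetas; elim: s => [|p s IH]; first by rewrite !big_nil (tns0l ht).
by rewrite !big_cons IH tadj_tns -(tns_ract ht) (tnsDl ht).
Qed.

Lemma ThetasD s w w' : Thetas s (w + w') = Thetas s w + Thetas s w'.
Proof.
by rewrite /Thetas -big_split; apply: eq_bigr => p _; rewrite tadjD (tnsDr ht).
Qed.

Lemma Thetas_ract s w c : Thetas s (ract w c) = ract (Thetas s w) c.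
Proof.
by rewrite /Thetas ract_suml; apply: eq_bigr => p _; rewrite tadj_ract (tns_ractr ht).
Qed.

Lemma Thetas_bound s : exists2 K : R, 0 <= K & forall w, nm (Thetas s w) <= K * nm w.
Proof.
exists (\sum_(p <- s) nm p.1 * nm p.2).
  by apply: sumr_ge0 => p _; rewrite mulr_ge0 ?nm_ge0.
move=> w; apply: le_trans (nm_sum _ _) _; rewrite mulr_suml; apply: ler_sum => p _.
by apply: le_trans (nm_tns ht _ _) _; rewrite -mulrA ler_wpM2l ?nm_ge0 // nm_tadj.
Qed.

End TensorAnalysis.

(** * Compactness on a tensor product and on its factors *)

Section CompactTensor.
Variables (R : realType) (A B C : cstarAlgType R).
Variables (X : corrType A B) (Y : corrType B C) (T : corrType A C) (t : X -> Y -> T).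
Hypothesis ht : is_tensor t.
Implicit Types (x r : X) (y v : Y) (w xi : T).
Local Notation tadj := (tadj ht).
Local Notation Thetas := (Thetas ht).

(** Compressing by [T_r^*] and [T_r'] maps the rank one operator of a pair to that of its images
    under [tadj r] and [tadj r'], and multiplies errors by at most [|r| |r'|]. *)
Lemma cpt_left a r r' : cpt (fun w : T => lact a w) ->
  cpt (fun y : Y => lact (inner r (lact a r')) y).
Proof.
move=> ca e e0; pose k := nm r * nm r'; have k0 : 0 <= k by rewrite mulr_ge0 ?nm_ge0.
have [s hs] := ca _ (div_succ_gt0 k0 e0); exists [seq (tadj r p.1, tadj r' p.2) | p <- s] => u.
set d := _ - _; set D := lact a (t r' u) - thetas s (t r' u).
have dD v : inner v d = inner (t r v) D.
  rewrite !innerBr (tns_lact ht) (tns_inner ht); congr (_ - _).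
  rewrite /thetas big_map !inner_sumr; apply: eq_bigr => p _ /=.
  by rewrite !inner_ract tadjP -(inner_star u) tadjP inner_star.
apply: nm_le_inner; first by rewrite mulr_ge0 ?nm_ge0 // ltW.
rewrite dD; apply: le_trans (nm_innerM _ _) _.
apply: le_trans (ler_pM (nm_ge0 _) (nm_ge0 _) (nm_tns ht r d) (hs _)) _.
rewrite mulrAC ler_wpM2r ?nm_ge0 //.
have h : nm (t r' u) <= nm r' * nm u by exact: nm_tns.
have h2 := div_succ_gt0 k0 e0.
apply: le_trans (ler_wpM2l (nm_ge0 r) (ler_wpM2l (ltW h2) h)) _.
have -> : nm r * (e / (k + 1) * (nm r' * nm u)) = k * (e / (k + 1)) * nm u.
  by move: (e / (k + 1)) => f; rewrite /k; ring.
by rewrite ler_wpM2r ?nm_ge0 //; exact: mul_div_succ k0 e0.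
Qed.

(** Replace [x] by [x l] with [l] in [J]. The operator of the pair [(x l, z)], tensored with 1, is
    [T_x l T_z^*], and [l] is close to a finite rank operator on [Y]. *)
Lemma Thetas_cpt (J : B -> Prop) (s : seq (X * X)) : cideal J ->
  (forall b, J b -> cpt (fun y : Y => lact b y)) ->
  (forall p, p \in s -> J (inner p.1 p.1)) ->
  forall e : R, 0 < e -> exists s', forall w, nm (Thetas s w - thetas s' w) <= e * nm w.
Proof.
move=> cJ hJ; elim: s => [|[x z] s IH] hs e e0.
  exists [::] => w; rewrite /Thetas big_nil thetas_nil subrr nm0.
  by rewrite mulr_ge0 ?nm_ge0 // ltW.
have e2 : 0 < e / 2 by rewrite divr_gt0.
have e4 : 0 < e / 2 / 2 by rewrite divr_gt0.
have [|s' hs'] := IH _ _ e2; first by move=> p ps; apply: hs; rewrite inE ps orbT.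
have Jx : J (inner x x) by apply: (hs (x, z)); rewrite inE eqxx.
have [u [u1 Ju us un] hu] := approx_ract cJ Jx (div_succ_gt0 (nm_ge0 z) e4).
pose l := - upart u; have Jl : J l.
  by rewrite /l -scaleN1r; have [[_ _ JZ _] _ _ _] := cJ; apply: JZ.
have k0 : 0 <= nm x * nm z by rewrite mulr_ge0 ?nm_ge0.
have [s2 hs2] := hJ _ Jl _ (div_succ_gt0 k0 e4).
exists ([seq (t x q.1, t z q.2) | q <- s2] ++ s') => w; rewrite thetas_cat.
have -> : Thetas ((x, z) :: s) w = t x (tadj z w) + Thetas s w.
  by rewrite /Thetas big_cons.
set v := tadj z w; have hv : nm v <= nm z * nm w by exact: nm_tadj.
have -> : thetas [seq (t x q.1, t z q.2) | q <- s2] w = t x (thetas s2 v).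
  rewrite /thetas big_map; elim: s2 {hs2} => [|q s2 IHs]; first by rewrite !big_nil (tns0r ht).
  by rewrite !big_cons IHs (tnsDr ht) (tns_ractr ht) /v tadjP.
rewrite opprD addrACA; apply: le_trans (nmD _ _) _; rewrite (splitr e) mulrDl.
apply: lerD (hs' w); have -> : t x v - t x (thetas s2 v) = t (rau x u) v + t x (lact l v - thetas s2 v).
  by rewrite (tnsBr ht) rau_sub // -/l (tnsBl ht) (tns_ract ht) addrA subrK.
apply: le_trans (nmD _ _) _; rewrite (splitr (e / 2)) mulrDl; apply: lerD.
  apply: le_trans (nm_tns ht _ _) _.
  apply: le_trans (ler_pM (nm_ge0 _) (nm_ge0 _) hu hv) _; rewrite mulrA ler_wpM2r ?nm_ge0 //.
  by rewrite mulrC; exact: mul_div_succ (nm_ge0 z) e4.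
apply: le_trans (nm_tns ht _ _) _.
apply: le_trans (ler_wpM2l (nm_ge0 x) (hs2 v)) _.
have h2 := div_succ_gt0 k0 e4.
apply: le_trans (ler_wpM2l (nm_ge0 x) (ler_wpM2l (ltW h2) hv)) _.
set f := e / 2 / 2 / _; have -> : nm x * (f * (nm z * nm w)) = nm x * nm z * f * nm w.
  by move: f => f; ring.
by rewrite ler_wpM2r ?nm_ge0 //; exact: mul_div_succ k0 e4.
Qed.

(** Approximate [a] by [a0 a] with [a0] in [J1], and [a] on [X] by [thetas s]. The factor [a0] puts
    the first vectors of [a0 thetas s] into [J1 X], so their inner products lie in [J2] and
    [Thetas_cpt] applies. *)
Lemma cpt_tensor (J1 : A -> Prop) (J2 : B -> Prop) : cideal J1 -> cideal J2 ->
  (forall a x x', J1 a -> J2 (inner x (lact a x'))) ->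
  (forall a, J1 a -> cpt (fun x : X => lact a x)) ->
  (forall b, J2 b -> cpt (fun y : Y => lact b y)) ->
  forall a, J1 a -> cpt (fun w : T => lact a w).
Proof.
move=> c1 c2 h12 h1 h2 a Ja e e0.
have e2 : 0 < e / 2 by rewrite divr_gt0.
have e4 : 0 < e / 2 / 2 by rewrite divr_gt0.
have [a0 Ja0 ha0] := approx_left c1 Ja e2.
have [s hs] := h1 _ Ja _ (div_succ_gt0 (nm_ge0 a0) e4).
pose s' := [seq (lact a0 p.1, p.2) | p <- s].
have s'E x : thetas s' x = lact a0 (thetas s x).
  rewrite -(@thetas_map _ _ _ (fun x => lact a0 x)) //.
    by move=> y y'; rewrite lactDr.
  by move=> y b; rewrite lact_ract.
have Js' p : p \in s' -> J2 (inner p.1 p.1).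
  by move=> /mapP[q _ ->] /=; rewrite lact_star -lactM; apply: h12; have [_ _ h _] := c1; exact: h.
have [s2 hs2] := Thetas_cpt c2 h2 Js' e4.
exists s2 => w.
have hw : nm (lact (cmul a0 a) w - Thetas s' w) <= e / 2 / 2 * nm w.
  have [K K0 hK] := Thetas_bound ht s'.
  pose G x := lact (cmul a0 a) x - thetas s' x.
  pose G' x := lact (star (cmul a0 a)) x - thetas (swap_pairs s') x.
  apply: (@nm_amplify R A B C X Y T t ht G G' (fun w => lact (cmul a0 a) w - Thetas s' w)
    _ (nm (cmul a0 a) + K)).
  - by move=> x y; rewrite /G /G' innerBl innerBr lact_star thetas_adjoint.
  - exact: ltW.
  - move=> x; rewrite /G s'E lactM -lactBr; apply: le_trans (nm_lact _ _) _.
    apply: le_trans (ler_wpM2l (nm_ge0 a0) (hs x)) _; rewrite mulrA ler_wpM2r ?nm_ge0 //.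
    exact: mul_div_succ (nm_ge0 a0) e4.
  - by move=> x y; rewrite lactDr ThetasD opprD addrACA.
  - by move=> x; apply: le_trans (nmB _ _) _; rewrite mulrDl lerD // nm_lact.
  - by move=> x y; rewrite (tns_lact ht) Thetas_tns /G (tnsBl ht).
apply: le_trans (nm_tri _ (lact (cmul a0 a) w) _) _; rewrite (splitr e) mulrDl.
apply: lerD.
  by rewrite -lactBl; apply: le_trans (nm_lact _ _) _; rewrite ler_wpM2r ?nm_ge0.
apply: le_trans (nm_tri _ (Thetas s' w) _) _; rewrite (splitr (e / 2)) mulrDl.
exact: lerD hw (hs2 w).
Qed.

Lemma nm_sub_Thetas s : (forall x, nm (x - thetas s x) <= nm x) ->
  forall w, nm (w - Thetas s w) <= nm w.
Proof.
move=> hs; have [K K0 hK] := Thetas_bound ht s => w; rewrite -[leRHS]mul1r.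
apply: (nm_amplify ht (G := fun x => x - thetas s x) (G' := fun x => x - thetas (swap_pairs s) x)
  (Gt := fun w => w - Thetas s w) (K := 1 + K)) => //.
- by move=> x y; rewrite innerBl innerBr thetas_adjoint.
- by move=> x; rewrite mul1r.
- by move=> x y; rewrite ThetasD opprD addrACA.
- by move=> x; apply: le_trans (nmB _ _) _; rewrite mulrDl mul1r lerD.
- by move=> x y; rewrite Thetas_tns (tnsBl ht).
Qed.

(** [L'] collects the first factors of finite sums approximating [L]; the errors are harmless
    because [1 - Thetas s] is a contraction. Both [L'] and [d] are fixed before [s], which
    [quasi_unit] then supplies. *)
Lemma quasi_unit_tensor (L : seq T) (e : R) : 0 < e -> exists L' : seq X, exists2 d : R, 0 < d &
  forall s, (forall x, nm (x - thetas s x) <= nm x) ->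
    (forall x, x \in L' -> nm (x - thetas s x) <= d) ->
    forall w, w \in L -> nm (w - Thetas s w) <= e.
Proof.
move=> e0; have e2 : 0 < e / 2 by rewrite divr_gt0.
elim: L => [|w L [L' [d d0 h]]]; first by exists [::]; exists 1.
have [s0 hs0] := tsum_approx ht w e2.
pose k := \sum_(q <- s0) nm q.2; have k0 : 0 <= k by apply: sumr_ge0 => q _; exact: nm_ge0.
exists ([seq q.1 | q <- s0] ++ L'); exists (Num.min d (e / 2 / (k + 1))).
  by rewrite lt_min d0 div_succ_gt0.
move=> s hs hL w'; rewrite inE => /orP[/eqP ->|wL]; last first.
  apply: h => // x xL; apply: le_trans (hL x _) _; first by rewrite mem_cat xL orbT.
  by rewrite ge_min lexx.
set w0 := tsum t s0 id in hs0.
have -> : w - Thetas s w = (w - w0 - Thetas s (w - w0)) + (w0 - Thetas s w0).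
  by rewrite addrACA subrK -opprD -ThetasD subrK.
apply: le_trans (nmD _ _) _; rewrite (splitr e); apply: lerD.
  by apply: le_trans (nm_sub_Thetas hs _) _.
have -> : w0 - Thetas s w0 = \sum_(q <- s0) t (q.1 - thetas s q.1) q.2.
  rewrite /w0 /tsum; elim: (s0) => [|q s1 IH].
    rewrite !big_nil (_ : Thetas s 0 = 0) ?subr0 //.
    by apply: (addrI (Thetas s 0)); rewrite -ThetasD !addr0.
  rewrite !big_cons ThetasD opprD addrACA IH.
  by rewrite Thetas_tns (tnsBl ht).
apply: le_trans (nm_sum _ _) _.
apply: (le_trans (y := (e / 2 / (k + 1)) * k)); last by rewrite mulrC; exact: mul_div_succ k0 e2.
rewrite /k mulr_sumr big_seq [leRHS]big_seq; apply: ler_sum => q qs.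
apply: le_trans (nm_tns ht _ _) _; rewrite ler_wpM2r ?nm_ge0 //.
apply: le_trans (hL _ _) _; first by rewrite mem_cat map_f.
by rewrite ge_min lexx orbT.
Qed.

(** Approximate [a] on [T] by a finite rank operator and choose [F] of finite rank on [X] such that
    [(1 - F) (x) 1] is small on its first vectors. Then [(1 - F) a (x) 1] is small on [T].
    Faithfulness of [Y] brings this back to [(1 - F) a] on [X], and [F a] has finite rank. *)
Lemma cpt_factor a : faithful_action Y -> cpt (fun w : T => lact a w) ->
  cpt (fun x : X => lact a x).
Proof.
move=> fY ca e e0; have e2 : 0 < e / 2 by rewrite divr_gt0.
have [s hs] := ca _ e2.
pose k := \sum_(p <- s) nm p.2; have k0 : 0 <= k by apply: sumr_ge0 => p _; exact: nm_ge0.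
have [L [d d0 hL]] := quasi_unit_tensor [seq p.1 | p <- s] (div_succ_gt0 k0 e2).
have [s0 [h1 h2]] := quasi_unit L d0.
have hG := hL _ h1 h2.
exists [seq (p.1, lact (star a) p.2) | p <- s0] => z.
rewrite -(thetas_comp _ _ (lact_star (s := X) a)); set u := _ - _.
have hu y : nm (t u y) <= e * nm z * nm y.
  pose w := t z y; have -> : t u y = lact a w - Thetas s0 (lact a w).
    by rewrite /w (tns_lact ht) Thetas_tns (tnsBl ht).
  have hw : nm w <= nm z * nm y by exact: nm_tns.
  set D := lact a w - thetas s w.
  have -> : lact a w - Thetas s0 (lact a w) =
     (D - Thetas s0 D) + (thetas s w - Thetas s0 (thetas s w)).
    by rewrite addrACA subrK -opprD -ThetasD subrK.
  apply: (le_trans (y := e * nm w)); last by rewrite -mulrA ler_wpM2l // ltW.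
  apply: le_trans (nmD _ _) _; rewrite (splitr e) mulrDl; apply: lerD.
    by apply: le_trans (nm_sub_Thetas h1 _) _; exact: hs.
  rewrite (@thetas_map _ _ _ (fun w => w - Thetas s0 w)); first last.
  - by move=> x b; rewrite Thetas_ract ractBl.
  - by move=> x y'; rewrite ThetasD opprD addrACA.
  rewrite /thetas big_map; apply: le_trans (nm_sum _ _) _.
  apply: (le_trans (y := e / 2 / (k + 1) * k * nm w)).
    rewrite /k mulr_sumr mulr_suml big_seq [leRHS]big_seq; apply: ler_sum => p ps /=.
    apply: le_trans (nm_theta _ _ _) _; rewrite ler_wpM2r ?nm_ge0 // ler_wpM2r ?nm_ge0 //.
    by apply: hG; rewrite map_f.
  by rewrite ler_wpM2r ?nm_ge0 // mulrC; exact: mul_div_succ k0 e2.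
(* If [<u, u> = b^* b], then [u (x) y] and [b y] have equal norms, so the bound [hu] bounds the
   action of [b], and [lact_isometric] bounds [b] itself. *)
have [b bE] := inner_ge0 u.
have hb : nm b <= e * nm z.
  apply: (lact_isometric fY); first by rewrite mulr_ge0 ?nm_ge0 // ltW.
  move=> y; apply: le_trans (hu y); rewrite -ler_sqr ?nnegrE ?nm_ge0 //.
  by rewrite !nm_inner (tns_inner ht) bE lactM -lact_star.
rewrite -ler_sqr ?nnegrE ?mulr_ge0 ?nm_ge0 ?(ltW e0) // nm_inner bE nm_cstar.
by rewrite ler_sqr ?nnegrE ?mulr_ge0 ?nm_ge0 ?(ltW e0).
Qed.

End CompactTensor.

(** * Ideals along correspondences *)

Section PullPush.
Variables (R : realType) (A B : cstarAlgType R) (Z : corrType A B).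

Definition pull (I : B -> Prop) : A -> Prop :=
  fun c => forall z z' : Z, I (inner z (lact c z')).

Definition push (J : A -> Prop) : B -> Prop :=
  closed_span [set b : B | exists c (z z' : Z), J c /\ b = inner z (lact c z')].

Lemma pull_ideal I : cideal I -> cideal (pull I).
Proof.
move=> [cI Ir Il Is]; split.
- apply: subspace_forall => z; apply: subspace_forall => z'.
  exact: (subspace_lactl (P := fun y => I (inner z y)) z' (subspace_innerr z cI)).
- by move=> a b ha z z'; rewrite lactM.
- by move=> a b hb z z'; rewrite lactM -{1}(starK a) -lact_star; exact: hb.
- by move=> a ha z z'; rewrite -lact_star -inner_star; apply/Is/ha.
Qed.

Lemma pull_mono (I I' : B -> Prop) : (forall b, I b -> I' b) -> forall a, pull I a -> pull I' a.
Proof. by move=> h a ha z z'; apply/h/ha. Qed.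

Lemma push_gen (J : A -> Prop) c (z z' : Z) : J c -> push J (inner z (lact c z')).
Proof. by move=> Jc; apply: closed_span_gen; exists c, z, z'. Qed.

Lemma push_ind (J : A -> Prop) (P : B -> Prop) : closed_subspace P ->
  (forall c (z z' : Z), J c -> P (inner z (lact c z'))) -> forall b, push J b -> P b.
Proof. by move=> cP h; apply: closed_span_min => // _ [c [z [z' [Jc ->]]]]; apply: h. Qed.

Lemma push_subspace J : closed_subspace (push J).
Proof. exact: closed_span_subspace. Qed.

Lemma push_mono (J J' : A -> Prop) : (forall a, J a -> J' a) -> forall b, push J b -> push J' b.
Proof. by move=> h; apply: push_ind; [exact: push_subspace | move=> c z z' /h; exact: push_gen]. Qed.

Lemma cmul_subspacel (P : B -> Prop) (b : B) : closed_subspace P ->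
  closed_subspace (fun x => P (cmul x b)).
Proof.
by move=> cP; apply: (subspace_preim (f := fun x => cmul x b) (M := nm b) cP) => [x y|c x|x];
  [exact: cmulDl | exists c; exact: cmulZl | rewrite mulrC nm_cmul].
Qed.

Lemma cmul_subspacer (P : B -> Prop) (b : B) : closed_subspace P ->
  closed_subspace (fun x => P (cmul b x)).
Proof.
by move=> cP; apply: (subspace_preim (f := fun x => cmul b x) (M := nm b) cP) => [x y|c x|x];
  [exact: cmulDr | exists c; exact: cmulZr | exact: nm_cmul].
Qed.

Lemma star_subspace (P : B -> Prop) : closed_subspace P -> closed_subspace (fun x => P (star x)).
Proof.
by move=> cP; apply: (subspace_preim (f := fun x => star x) (M := 1) cP) => [x y|c x|x];
  [exact: starD | exists (Num.conj c); exact: starZ | rewrite mul1r nm_star].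
Qed.

Lemma push_ideal J : cideal J -> cideal (push J).
Proof.
move=> [_ _ _ Js]; have cP := push_subspace J; split=> //.
- move=> a b; move: a; apply: push_ind; first exact: cmul_subspacel.
  by move=> c z z' Jc; rewrite -inner_ract -lact_ract; exact: push_gen.
- move=> a b; move: b; apply: push_ind; first exact: cmul_subspacer.
  by move=> c z z' Jc; rewrite -{1}(starK a) -inner_ractl; exact: push_gen.
- apply: push_ind; first exact: star_subspace.
  by move=> c z z' Jc; rewrite inner_star lact_star; apply: push_gen; exact: Js.
Qed.

(** The pullback of 0 is the kernel of the left action, so that injectivity travels through
    [pull_tensor]. *)
Lemma pull0_faithful : faithful_action Z -> pull (fun b => b = 0) = (fun a => a = 0).
Proof.
move=> fZ; apply/funext => a; apply/propext; split=> [h|-> z z']; last first.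
  by rewrite lact0l inner0r.
by apply: fZ => z; apply: inner_ext => z'; rewrite h inner0r.
Qed.

Lemma faithful_pull0 : (forall a, pull (fun b => b = 0) a -> a = 0) -> faithful_action Z.
Proof. by move=> h a ha; apply: h => z z'; rewrite ha inner0r. Qed.

Lemma corr_injectiveP : corr_injective Z <-> faithful_action Z.
Proof.
split=> h.
  by move=> a ha; apply: h; apply/funext => x; rewrite ha lact0l.
move=> a b /(congr1 (fun f => f _)) ab; apply/eqP; rewrite -subr_eq0; apply/eqP/h => x.
by rewrite lactBl (ab x) subrr.
Qed.

(** By non-degeneracy every vector is a limit of sums of vectors [lact a y], so inserting the left
    action loses nothing. *)
Lemma fullP : full Z <-> push (fun=> True) = (fun=> True).
Proof.
split=> [h|h].
  apply/funext => b; apply/propext; split=> // _.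
  have : closed_span [set b : B | exists x y : Z, b = inner x y] b by rewrite h.
  move: b; apply: closed_span_min; first exact: push_subspace.
  move=> _ [x [y ->]]; have := @act_spanT R A B Z y; move: y; apply: act_span_ind.
    by apply: subspace_innerr; exact: push_subspace.
  by move=> a y _; exact: push_gen.
apply/seteqP; split=> // b _; have : push (fun=> True) b by rewrite h.
move: b; apply: push_ind; first exact: closed_span_subspace.
by move=> c z z' _; apply: closed_span_gen; exists z, (lact c z').
Qed.

End PullPush.

Section PullPushTensor.
Variables (R : realType) (A B C : cstarAlgType R).
Variables (X : corrType A B) (Y : corrType B C) (T : corrType A C).
Hypothesis hT : interior_tensor X Y T.

Lemma pull_tensor (I : C -> Prop) : closed_subspace I -> pull T I = pull X (pull Y I).
Proof.
have [t ht0] := hT; have ht : is_tensor t by exact: ht0.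
move=> cI; apply/funext => c; apply/propext; split=> h.
  by move=> x x' y y'; rewrite -(tns_inner ht) -(tns_lact ht).
move=> w; apply: (tns_ind ht).
  exact: (subspace_lactr (P := fun z => I (inner w z)) c (subspace_innerr w cI)).
move=> x' y'; move: w; apply: (tns_ind ht); first exact: subspace_innerl.
by move=> x y; rewrite (tns_lact ht) (tns_inner ht); apply: h.
Qed.

Lemma push_tensor (J : A -> Prop) : push T J = push Y (push X J).
Proof.
have [t ht0] := hT; have ht : is_tensor t by exact: ht0.
apply/funext => c; apply/propext; split; move: c; apply: push_ind;
  try exact: push_subspace.
  have cP : closed_subspace (push Y (push X J)) by exact: push_subspace.
  move=> c w w' Jc; move: w'; apply: (tns_ind ht).
    exact: (subspace_lactr (P := fun z => push Y (push X J) (inner w z)) c (subspace_innerr w cP)).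
  move=> x' y'; move: w; apply: (tns_ind ht); first exact: subspace_innerl.
  move=> x y; rewrite (tns_lact ht) (tns_inner ht); apply: push_gen.
  exact: push_gen.
move=> b y y'; have cP : closed_subspace (push T J) by exact: push_subspace.
move: b; apply: push_ind.
  exact: (subspace_lactl (P := fun z => push T J (inner y z)) y' (subspace_innerr y cP)).
move=> c x x' Jc; rewrite -(tns_inner ht) -(tns_lact ht); exact: push_gen.
Qed.

End PullPushTensor.

Section IsoTensor.
Variables (R : realType) (A B C : cstarAlgType R).
Variables (X : corrType A B) (Y : corrType B C) (Z : corrType A C).

Lemma unitary_refl : unitarily_isomorphic Z Z.
Proof. by exists idfun; split=> // y; exists y. Qed.

(** Transport [t] by the inverse of the unitary. From here on every link is an [interior_tensor]
    statement without isomorphisms. *)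
Lemma iso_tensorP : iso_tensor Z X Y <-> interior_tensor X Y Z.
Proof.
split=> [[T [t ht0] [U [Us Ul Ur Ui]]]|h]; last by exists Z => //; exact: unitary_refl.
have ht : is_tensor t by exact: ht0.
have Uinj x y : U x = U y -> x = y.
  move=> e; apply/eqP; rewrite -subr_eq0; apply/eqP/inner_eq0.
  by rewrite -Ui linearB /= e subrr inner0r.
have [V VK] := choice Us.
exists (fun x y => V (t x y)); split; [|split; [|split; [|split; [|split; [|split]]]]].
- by move=> k x x' y; apply: Uinj; rewrite linearP !VK (tnsDl ht) (tnsZl ht).
- by move=> k x y y'; apply: Uinj; rewrite linearP !VK (tnsDr ht) (tnsZr ht).
- by move=> x b y; rewrite (tns_ract ht).
- by move=> a x y; apply: Uinj; rewrite Ul !VK (tns_lact ht).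
- by move=> x y c; apply: Uinj; rewrite Ur !VK (tns_ractr ht).
- by move=> x x' y y'; rewrite -Ui !VK (tns_inner ht).
have nmU z : nm (U z) = nm z.
  by apply/eqP; rewrite -(@eqrXn2 _ 2) ?nm_ge0 // !nm_inner Ui.
apply/seteqP; split=> // z _; set P := closed_span _.
have cP : closed_subspace P by exact: closed_span_subspace.
have cQ : closed_subspace (fun w => P (V w)).
  have VU w : V (U w) = w by apply: Uinj; rewrite VK.
  apply: (@subspace_preim R T Z V 1) => //.
  - by move=> w w'; apply: Uinj; rewrite linearD /= !VK.
  - by move=> c w; exists c; apply: Uinj; rewrite linearZ /= !VK.
  - by move=> w; rewrite mul1r -nmU VK.
have -> : z = V (U z) by apply: Uinj; rewrite VK.
move: (U z); apply: (tns_ind ht) => // x y.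
by apply: closed_span_gen; exists x, y.
Qed.

End IsoTensor.

Lemma tensor_iso_tensorP (R : realType) (A B B' C : cstarAlgType R)
    (X : corrType A B) (Y : corrType B C) (X' : corrType A B') (Y' : corrType B' C) :
  tensor_iso_tensor X Y X' Y' <->
  exists T, interior_tensor X Y T /\ interior_tensor X' Y' T.
Proof.
split=> [[T h /iso_tensorP h']|[T [h h']]]; first by exists T.
by exists T => //; apply/iso_tensorP.
Qed.

(** * Chains *)

Section ChainIdeals.
Variables (R : realType) (alg : nat -> cstarAlgType R).
Variable corR : forall i, corrType (alg i) (alg i.+1).
Variable corS : forall i, corrType (alg i.+1) (alg i).
Variables (n : nat) (X : corrType (alg 0%N) (alg 0%N)) (Y : corrType (alg n.+1) (alg n.+1)).
Hypothesis tX : interior_tensor (corR 0%N) (corS 0%N) X.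
Hypothesis tY : interior_tensor (corS n) (corR n) Y.
Hypothesis tT : forall i, (i < n)%N -> exists T,
  interior_tensor (corS i) (corR i) T /\ interior_tensor (corR i.+1) (corS i.+1) T.

Definition zero_set i : alg i -> Prop := fun a => a = 0.
Definition all_set i : alg i -> Prop := fun _ => True.

(** The ideals [I_i]. The family [down_ker] from the other end serves to show that [up_ker] vanishes
    at [n.+1]. *)
Fixpoint up_ker i : alg i -> Prop :=
  match i return alg i -> Prop with
  | 0%N => zero_set (i := 0)
  | j.+1 => pull (corS j) (up_ker (i := j))
  end.

Fixpoint up_span i : alg i -> Prop :=
  match i return alg i -> Prop with
  | 0%N => all_set (i := 0)
  | j.+1 => push (corR j) (up_span (i := j))
  end.

(* The descending recursions from [n.+1] take the number of steps as fuel. *)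
Fixpoint fuel_ker k i : alg i -> Prop :=
  if k is l.+1 then pull (corR i) (fuel_ker l (i := i.+1)) else zero_set (i := i).

Fixpoint fuel_span k i : alg i -> Prop :=
  if k is l.+1 then push (corS i) (fuel_span l (i := i.+1)) else all_set (i := i).

Definition down_ker i : alg i -> Prop := fuel_ker (n.+1 - i) (i := i).
Definition down_span i : alg i -> Prop := fuel_span (n.+1 - i) (i := i).

Lemma down_ker_last : down_ker (i := n.+1) = zero_set (i := n.+1).
Proof. by rewrite /down_ker subnn. Qed.

Lemma down_span_last : down_span (i := n.+1) = all_set (i := n.+1).
Proof. by rewrite /down_span subnn. Qed.

Lemma down_kerE i : (i <= n)%N -> down_ker (i := i) = pull (corR i) (down_ker (i := i.+1)).
Proof. by move=> le_in; rewrite /down_ker subSS subSn. Qed.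

Lemma down_spanE i : (i <= n)%N -> down_span (i := i) = push (corS i) (down_span (i := i.+1)).
Proof. by move=> le_in; rewrite /down_span subSS subSn. Qed.

Lemma zero_ideal i : cideal (zero_set (i := i)).
Proof.
split; first exact: subspace0.
- by move=> a b ->; rewrite /zero_set cmul0l.
- by move=> a b ->; rewrite /zero_set cmul0r.
- by move=> a ->; rewrite /zero_set star0.
Qed.

Lemma all_ideal i : cideal (all_set (i := i)).
Proof. exact: cidealT. Qed.

Lemma up_ker_ideal i : cideal (up_ker (i := i)).
Proof. by elim: i => [|i IH]; [exact: zero_ideal | exact: pull_ideal]. Qed.

Lemma up_span_ideal i : cideal (up_span (i := i)).
Proof. by elim: i => [|i IH]; [exact: all_ideal | exact: push_ideal]. Qed.

Lemma down_ker_ideal i : cideal (down_ker (i := i)).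
Proof.
rewrite /down_ker; move: (n.+1 - i)%N => k.
by elim: k i => [|k IH] i; [exact: zero_ideal | exact: pull_ideal].
Qed.

Lemma down_span_ideal i : cideal (down_span (i := i)).
Proof.
rewrite /down_span; move: (n.+1 - i)%N => k.
by elim: k i => [|k IH] i; [exact: all_ideal | exact: push_ideal].
Qed.

Lemma down_ind (P : nat -> Prop) : P n -> (forall i, (i < n)%N -> P i.+1 -> P i) ->
  forall i, (i <= n)%N -> P i.
Proof.
move=> Pn PS i le_in; rewrite -(subKn le_in); move: (n - i)%N (leq_subr i n) => k.
elim: k => [|k IH] kn; first by rewrite subn0.
apply: PS; first by rewrite ltn_subrL /= (leq_ltn_trans _ kn).
by rewrite -subSn // subSS; apply: IH; exact: ltnW.
Qed.

(** Going up by [R] and back by [S] is pushing along [R (x) S], which the link replaces by [S (x) R]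
    of the preceding index; there the induction hypothesis applies. *)
Lemma up_span_S i : (i <= n)%N -> forall a, push (corS i) (up_span (i := i.+1)) a -> up_span a.
Proof.
elim: i => [//|i IH] lt_in a; have [T [hSR hRS]] := tT lt_in.
rewrite [up_span (i := i.+2)]/(push (corR i.+1) (up_span (i := i.+1))).
rewrite -(push_tensor hRS) (push_tensor hSR).
by apply: push_mono => b; apply: IH; exact: ltnW.
Qed.

Lemma down_span_R i : (i <= n)%N -> forall a, push (corR i) (down_span (i := i)) a -> down_span a.
Proof.
move: i; apply: down_ind => [a _|i lt_in IH a]; first by rewrite down_span_last.
have [T [hSR hRS]] := tT lt_in; rewrite (down_spanE (ltnW lt_in)).
rewrite -(push_tensor hSR) (push_tensor hRS) => h.
by rewrite (down_spanE lt_in); move: h; apply: push_mono => b; exact: IH.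
Qed.

Definition both_span i : alg i -> Prop :=
  closed_span [set a | up_span a \/ down_span a].

Lemma both_span_up i a : up_span a -> both_span (i := i) a.
Proof. by move=> h; apply: closed_span_gen; left. Qed.

Lemma both_span_down i a : down_span a -> both_span (i := i) a.
Proof. by move=> h; apply: closed_span_gen; right. Qed.

Lemma both_span_ind i (P : alg i -> Prop) : closed_subspace P ->
  (forall a, up_span a -> P a) -> (forall a, down_span a -> P a) ->
  forall a, both_span a -> P a.
Proof. by move=> cP h1 h2; apply: closed_span_min => // a [/h1|/h2]. Qed.

Lemma both_span_ideal i : cideal (both_span (i := i)).
Proof.
have cP : closed_subspace (both_span (i := i)) by exact: closed_span_subspace.
have [_ ur ul us] := up_span_ideal i; have [_ dr dl ds] := down_span_ideal i.
split=> //.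
- move=> a b; move: a; apply: both_span_ind; first exact: cmul_subspacel.
    by move=> a ha; apply: both_span_up; exact: ur.
  by move=> a ha; apply: both_span_down; exact: dr.
- move=> a b; move: b; apply: both_span_ind; first exact: cmul_subspacer.
    by move=> b hb; apply: both_span_up; exact: ul.
  by move=> b hb; apply: both_span_down; exact: dl.
- apply: both_span_ind; first exact: star_subspace.
    by move=> a ha; apply: both_span_up; exact: us.
  by move=> a ha; apply: both_span_down; exact: ds.
Qed.

Lemma both_span_R i : (i <= n)%N -> forall c (z z' : corR i),
  both_span c -> both_span (inner z (lact c z')).
Proof.
move=> le_in c z z'; have [cJ _ _ _] := both_span_ideal i.+1; move: c.
apply: both_span_ind.
- exact: (subspace_lactl (P := fun y => both_span (inner z y)) z' (subspace_innerr z cJ)).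
- by move=> c hc; apply: both_span_up; exact: push_gen.
- by move=> c hc; apply: both_span_down; apply: (down_span_R le_in); exact: push_gen.
Qed.

Lemma both_span_S i : (i <= n)%N -> forall c (z z' : corS i),
  both_span c -> both_span (inner z (lact c z')).
Proof.
move=> le_in c z z'; have [cJ _ _ _] := both_span_ideal i; move: c.
apply: both_span_ind.
- exact: (subspace_lactl (P := fun y => both_span (inner z y)) z' (subspace_innerr z cJ)).
- by move=> c hc; apply: both_span_up; apply: (up_span_S le_in); exact: push_gen.
- by move=> c hc; apply: both_span_down; rewrite (down_spanE le_in); exact: push_gen.
Qed.

Section Kernels.
Hypothesis fX : faithful_action X.
Hypothesis fY : faithful_action Y.

(** Compatibility with [S] is the definition; compatibility with [R] starts from the injectivity of
    [X] and moves up through the links. *)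
Lemma up_ker_R i : (i <= n)%N -> up_ker (i := i) = pull (corR i) (up_ker (i := i.+1)).
Proof.
elim: i => [_|i IH lt_in] /=.
  by rewrite -(pull_tensor tX) ?pull0_faithful //; exact: subspace0.
have [T [hSR hRS]] := tT lt_in; have [c1 _ _ _] := up_ker_ideal i.+1.
rewrite -(pull_tensor hRS) // (pull_tensor hSR) //.
by rewrite -[pull (corS i) (up_ker (i := i))]/(up_ker (i := i.+1)) -IH // ltnW.
Qed.

Lemma down_ker_S i : (i <= n)%N -> down_ker (i := i.+1) = pull (corS i) (down_ker (i := i)).
Proof.
move: i; apply: down_ind => [|i lt_in IH].
  rewrite (down_kerE (leqnn n)) down_ker_last -(pull_tensor tY) ?pull0_faithful //.
  exact: subspace0.
have [T [hSR hRS]] := tT lt_in; have [c1 _ _ _] := down_ker_ideal i.+1.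
rewrite (down_kerE (ltnW lt_in)) -(pull_tensor hSR) // (pull_tensor hRS) //.
by rewrite -IH -down_kerE.
Qed.

(** [down_ker] is 0 at [n.+1] by definition, so this comparison makes [I] vanish at the far end. The
    injectivity of [Y] enters through [down_ker_S]. *)
Lemma up_ker_down i : (i <= n.+1)%N -> forall a, up_ker (i := i) a -> down_ker a.
Proof.
elim: i => [_ a ->|i IH lt_in a]; first by have [[]] := down_ker_ideal 0.
by rewrite down_ker_S //=; apply: pull_mono; apply: IH; exact: ltnW.
Qed.

Lemma up_ker_last a : up_ker (i := n.+1) a -> a = 0.
Proof. by move=> /(up_ker_down (leqnn _)); rewrite down_ker_last. Qed.

End Kernels.

(** * Chains with injective actions in which [both_span] is everything *)

Section Regularity.
Hypothesis fR : forall i, (i <= n)%N -> faithful_action (corR i).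
Hypothesis fS : forall i, (i <= n)%N -> faithful_action (corS i).
Hypothesis gen : forall i, (i <= n.+1)%N -> forall a, both_span (i := i) a.

Section Compact.
Hypothesis cX : forall a, cpt (fun x : X => lact a x).
Hypothesis cY : forall a, cpt (fun y : Y => lact a y).

(* The compactness of the action of [J1] on [Z (x) Z'] passes to [Z' (x) Z] and,
   through a second factorization of the latter, to the next correspondence. *)
Lemma cpt_step (A B C : cstarAlgType R) (Z : corrType A B) (Z' : corrType B A)
    (Z2 : corrType B C) (Z2' : corrType C B) (T1 : corrType A A) (T2 : corrType B B)
    (J1 : A -> Prop) (J2 : B -> Prop) :
  interior_tensor Z Z' T1 -> interior_tensor Z' Z T2 -> interior_tensor Z2 Z2' T2 ->
  faithful_action Z2' -> cideal J1 -> J2 = push Z J1 ->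
  (forall a, push Z' J2 a -> J1 a) ->
  (forall a, J1 a -> cpt (fun z : Z => lact a z)) ->
  (forall a, J1 a -> cpt (fun z : T1 => lact a z)) ->
  (forall b, J2 b -> cpt (fun z : T2 => lact b z)) /\
  (forall b, J2 b -> cpt (fun z : Z2 => lact b z)).
Proof.
move=> [t1 h1] [t2 h2] [t3 h3] f2 c1 J2E h21 cZ cT1.
have c2 : cideal J2 by rewrite J2E; exact: push_ideal.
have cZ' b : J2 b -> cpt (fun z : Z' => lact b z).
  rewrite J2E; move: b; apply: push_ind; first exact: cpt_subspace.
  by move=> c z z' Jc; apply: (cpt_left h1); exact: cT1.
have cT2 b : J2 b -> cpt (fun z : T2 => lact b z).
  apply: (cpt_tensor h2 c2 c1) => // a x x' Ja; apply: h21; exact: push_gen.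
by split=> // b Jb; apply: (cpt_factor h3) => //; exact: cT2.
Qed.

Lemma up_cpt i : (i <= n)%N -> (forall a, up_span a -> cpt (fun z : corR i => lact a z)) /\
  exists2 T, interior_tensor (corR i) (corS i) T & forall a, up_span a -> cpt (fun z : T => lact a z).
Proof.
elim: i => [_|i IH lt_in].
  have [t ht] := tX; split=> [a _|]; last by exists X.
  by apply: (cpt_factor ht) => //; exact: fS.
have [cR [T1 h1 cT1]] := IH (ltnW lt_in); have [T2 [h2 h3]] := tT lt_in.
have [cT2 cR2] := cpt_step h1 h2 h3 (fS lt_in) (up_span_ideal i)
  (erefl (up_span (i := i.+1))) (up_span_S (ltnW lt_in)) cR cT1.
by split=> //; exists T2.
Qed.

Lemma down_cpt i : (i <= n)%N ->
  (forall a, down_span (i := i.+1) a -> cpt (fun z : corS i => lact a z)) /\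
  exists2 T, interior_tensor (corS i) (corR i) T &
    forall a, down_span (i := i.+1) a -> cpt (fun z : T => lact a z).
Proof.
move: i; apply: down_ind => [|i lt_in [cS [T1 h1 cT1]]].
  have [t ht] := tY; split=> [a _|]; last by exists Y.
  by apply: (cpt_factor ht) => //; exact: fR.
have [T2 [h2 h3]] := tT lt_in.
have [cT2 cS2] := cpt_step h1 h3 h2 (fR (ltnW lt_in)) (down_span_ideal i.+2)
  (down_spanE lt_in) (down_span_R lt_in) cS cT1.
by split=> //; exists T2.
Qed.

(** The part from the left is [up_cpt]. The part from the right is pushed along [S] from an ideal
    acting compactly on [S (x) R], so [cpt_left] hands compactness on to [R]. *)
Lemma chain_cpt_R i : (i <= n)%N -> forall a, cpt (fun z : corR i => lact a z).
Proof.
move=> le_in a; have ga := @gen i (leqW le_in) a; move: a ga.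
apply: both_span_ind; first exact: cpt_subspace.
  by have [] := up_cpt le_in.
have [_ [T [t ht] cT]] := down_cpt le_in.
rewrite (down_spanE le_in); apply: push_ind; first exact: cpt_subspace.
by move=> c z z' hc; apply: (cpt_left ht); exact: cT.
Qed.

Lemma chain_cpt_S i : (i <= n)%N -> forall a, cpt (fun z : corS i => lact a z).
Proof.
move=> le_in a; have ga := @gen i.+1 le_in a; move: a ga.
apply: both_span_ind; first exact: cpt_subspace; last by have [] := down_cpt le_in.
have [_ [T [t ht] cT]] := up_cpt le_in.
apply: push_ind; first exact: cpt_subspace.
by move=> c z z' hc; apply: (cpt_left ht); exact: cT.
Qed.

End Compact.

Section Fullness.
Hypothesis uX : push X (all_set (i := 0%N)) = all_set (i := 0%N).
Hypothesis uY : push Y (all_set (i := n.+1)) = all_set (i := n.+1).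

Lemma up_span_Seq i : (i <= n)%N -> push (corS i) (up_span (i := i.+1)) = up_span (i := i).
Proof.
elim: i => [_|i IH lt_in] /=; first by rewrite -(push_tensor tX).
have [T [hSR hRS]] := tT lt_in.
by rewrite -(push_tensor hRS) (push_tensor hSR) -[in RHS]IH // ltnW.
Qed.

Lemma down_span_Req i : (i <= n)%N -> push (corR i) (down_span (i := i)) = down_span (i := i.+1).
Proof.
move: i; apply: down_ind => [|i lt_in IH].
  by rewrite (down_spanE (leqnn n)) down_span_last -(push_tensor tY).
have [T [hSR hRS]] := tT lt_in; rewrite (down_spanE (ltnW lt_in)).
by rewrite -(push_tensor hSR) (push_tensor hRS) IH (down_spanE lt_in).
Qed.

(** At 0 [up_span] is everything, and pushing along [R] carries [down_span] exactly to [down_span]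
    by fullness of [Y]. Hence [down_span] lies in [up_span] at every index, and [gen] says that the
    two fill the algebra. *)
Lemma up_span_all i : (i <= n.+1)%N -> up_span (i := i) = all_set (i := i).
Proof.
have down_up j : (j <= n.+1)%N -> forall a, down_span (i := j) a -> up_span a.
  elim: j => [//|j IH] le_jn a; rewrite -down_span_Req //=.
  by apply: push_mono; apply: IH; exact: ltnW.
move=> le_in; apply/funext => a; apply/propext; split=> // _.
have := @gen i le_in a; move: a; have [cU _ _ _] := up_span_ideal i.
by apply: both_span_ind => //; exact: down_up.
Qed.

Lemma chain_full_R i : (i <= n)%N -> push (corR i) (all_set (i := i)) = all_set (i := i.+1).
Proof.
move=> le_in; have := up_span_all (i := i.+1) le_in.
by rewrite /= (up_span_all (leqW le_in)).
Qed.

Lemma chain_full_S i : (i <= n)%N -> push (corS i) (all_set (i := i.+1)) = all_set (i := i).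
Proof.
move=> le_in; rewrite -(up_span_all (i := i.+1)) // up_span_Seq //.
exact: up_span_all (leqW le_in).
Qed.

End Fullness.

End Regularity.

End ChainIdeals.

Lemma approx_both (R : realType) (A : cstarAlgType R) (J : A -> Prop) a (e : R) :
  cideal J -> J a -> 0 < e ->
  exists b c, [/\ J b, J c & nm (a - cmul b (cmul a c)) <= e].
Proof.
move=> cJ Ja e0; have [_ Jr Jl Js] := cJ; have e2 : 0 < e / 2 by rewrite divr_gt0.
have [b Jb hb] := approx_left cJ Ja e2.
have Jba : J (star (cmul b a)) by apply/Js/Jl.
have [c Jc hc] := approx_left cJ Jba e2.
exists b, (star c); split=> //; first exact: Js.
apply: le_trans (nm_tri _ (cmul b a) _) _; rewrite (splitr e) lerD //.
by rewrite -nm_star starB cmulA (starM (cmul b a)) starK.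
Qed.

Section RedPush.
Variables (R : realType) (A B : cstarAlgType R) (Z : corrType A B).
Variables (ra : redalg A) (rb : redalg B) (Z' : corrType (ra_D ra) (ra_D rb)) (p : Z -> Z').
Hypothesis hp : redcorr p.

(** Arbitrary [z], [z'] may lie outside the domain of [p]. Approximating [a] by [b a c] with [b],
    [c] in the ideal lets these factors act on [z] and [z']. *)
Lemma red_push (L : A -> Prop) (L' : ra_D ra -> Prop) :
  (forall a, L a -> ra_J ra a) -> (forall a, L a -> L' (ra_q ra a)) ->
  forall b, push Z L b -> ra_J rb b /\ push Z' L' (ra_q rb b).
Proof.
move=> LJ LL'; have cP := push_subspace Z' L'; have cQ := ra_preim cP.
apply: push_ind => // a z z' La; have Ja := LJ _ La.
have cQ' : closed_subspace (fun c => ra_J rb (inner z (lact c z')) /\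
    push Z' L' (ra_q rb (inner z (lact c z')))).
  exact: (subspace_lactl (P := fun y => ra_J rb (inner z y) /\ push Z' L' (ra_q rb (inner z y)))
    z' (subspace_innerr z cQ)).
apply: (subspace_approx cQ') => e e0.
have [b [c [Jb Jc h]]] := approx_both (ra_cideal ra) Ja e0.
exists (cmul b (cmul a c)) => //; have Jbac : ra_J ra (cmul b (cmul a c)) by exact: ra_JMl.
split; first exact: (rc_J hp).
have -> : inner z (lact (cmul b (cmul a c)) z') = inner (lact (star b) z) (lact a (lact c z')).
  by rewrite lact_star starK !lactM.
have Wz : act_span (ra_J ra) (lact (star b) z) by apply: act_span_gen; exact: ra_JS.
have Wz' : act_span (ra_J ra) (lact c z') by exact: act_span_gen.
rewrite -(rc_inner hp) //; last by apply: (act_span_lact (ra_cideal ra)).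
rewrite (rc_lact hp Ja) //; apply/(@push_gen _ _ _ Z' L'); exact: LL'.
Qed.

End RedPush.

(** After substituting the trivial reduction, proof irrelevance makes [e] reflexive and the
    transport disappears. *)
Lemma transport_redcorr (R : realType) (C : cstarAlgType R) (ra : redalg C)
    (Y : corrType C C) (e : C = ra_D ra) : ra = id_redalg C ->
  exists p : Y -> transport_corr e Y, redcorr p.
Proof.
move=> h; subst ra; rewrite (Prop_irrelevance e (erefl C)) /=.
by exists id; exact: id_redcorr.
Qed.

Lemma transport_cpt (R : realType) (A B : cstarAlgType R) (e : A = B) (X : corrType A A) :
  corr_proper X -> forall b, cpt (fun x : transport_corr e X => lact b x).
Proof. by case: B / e => /corr_properP. Qed.

Lemma transport_full (R : realType) (A B : cstarAlgType R) (e : A = B) (X : corrType A A) :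
  full X -> push (transport_corr e X) (fun _ => True) = (fun _ => True).
Proof. by case: B / e => /fullP. Qed.

(** * The reduced chain *)

Section ChainReduction.
Variables (R : realType) (alg : nat -> cstarAlgType R).
Variable corR : forall i, corrType (alg i) (alg i.+1).
Variable corS : forall i, corrType (alg i.+1) (alg i).
Variables (n : nat) (X : corrType (alg 0%N) (alg 0%N)) (Y : corrType (alg n.+1) (alg n.+1)).
Hypothesis tX : interior_tensor (corR 0%N) (corS 0%N) X.
Hypothesis tY : interior_tensor (corS n) (corR n) Y.
Hypothesis tT : forall i, (i < n)%N -> exists T,
  interior_tensor (corS i) (corR i) T /\ interior_tensor (corR i.+1) (corS i.+1) T.
Hypothesis fX : faithful_action X.
Hypothesis fY : faithful_action Y.
Local Notation J i := (@both_span R alg corR corS n i).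
Local Notation I i := (@up_ker R alg corS i).

Let redpair i : idealpair (alg i) :=
  IdealPair (both_span_ideal corR corS n i) (up_ker_ideal corS i).

(* The end algebras must remain the given ones. *)
Let rd i : redalg (alg i) :=
  if (0 < i <= n)%N then quot_redalg (redpair i) else id_redalg (alg i).

Let rd_out i : (n < i)%N -> rd i = id_redalg (alg i).
Proof. by move=> lt_ni; rewrite /rd [(i <= n)%N]leqNgt lt_ni andbF. Qed.

Let ends i (P : nat -> Prop) : (i <= n.+1)%N -> (0 < i <= n)%N = false -> P 0%N -> P n.+1 -> P i.
Proof.
case: i => [//|i] /= le_in h P0 Pn; have -> // : i.+1 = n.+1.
by apply/eqP; rewrite eqn_leq le_in /= ltnNge -ltnS -ltnNge ltnS ltnNge; rewrite h.
Qed.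

Let J_ends i : (i <= n.+1)%N -> (0 < i <= n)%N = false -> forall a, J i a.
Proof.
move=> le_in h; apply: (ends (P := fun j => forall a, J j a) le_in h) => a.
  exact: both_span_up.
by apply: both_span_down; rewrite down_span_last.
Qed.

Let I_ends i : (i <= n.+1)%N -> (0 < i <= n)%N = false -> forall a, I i a -> a = 0.
Proof.
move=> le_in h; apply: (ends (P := fun j => forall a, I j a -> a = 0) le_in h) => a //.
exact: (up_ker_last tY tT fY).
Qed.

Let rd_J i a : (i <= n.+1)%N -> ra_J (rd i) a <-> J i a.
Proof. by move=> le_in; rewrite /rd; case: ifP => // h; split=> // _; apply: J_ends. Qed.

Let rd_ker i a : (i <= n.+1)%N -> J i a -> ra_q (rd i) a = 0 <-> I i a.
Proof.
move=> le_in Ja; rewrite /rd; case: ifP => h.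
  by split; [exact: quot_redalg_eq0 | exact: (quot_redalg_ker (p := redpair i))].
split=> [/= ->|/(I_ends le_in h) -> //]; by have [[]] := up_ker_ideal corS i.
Qed.

Let red_cond i j (Z : corrType (alg i) (alg j)) : (i <= n.+1)%N -> (j <= n.+1)%N ->
  (forall c (z z' : Z), J i c -> J j (inner z (lact c z'))) ->
  (forall c, I i c -> pull Z (I j) c) ->
  exists (Z' : corrType (ra_D (rd i)) (ra_D (rd j))) (p : Z -> Z'), redcorr p.
Proof.
move=> le_i le_j hJ hI.
have h1 c (z z' : Z) : ra_J (rd i) c -> ra_J (rd j) (inner z (lact c z')).
  by move=> /(rd_J _ le_i) Jc; apply/rd_J => //; apply: hJ.
have h2 c (z z' : Z) : ra_J (rd i) c -> ra_q (rd i) c = 0 -> ra_q (rd j) (inner z (lact c z')) = 0.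
  move=> /(rd_J _ le_i) Jc /rd_ker qc; apply/rd_ker => //; first exact: hJ.
  by apply: hI; exact: qc.
exact: (ex_intro _ _ (ex_intro _ _ (corrquot_redcorr (CorrRed h1 h2)))).
Qed.

Let ex_R i : exists (Z' : corrType (ra_D (rd i)) (ra_D (rd i.+1))) (p : corR i -> Z'), redcorr p.
Proof.
case: (leqP i n) => h.
  apply: red_cond => //; first exact: leqW.
    exact: (both_span_R tT h).
  by move=> c; rewrite -(up_ker_R tX tT fX h).
(* Past the end of the chain the algebras are unchanged, and the old correspondence is kept. *)
rewrite !rd_out //; last exact: ltnW.
by exists (corR i), id; exact: id_redcorr.
Qed.

Let ex_S i : exists (Z' : corrType (ra_D (rd i.+1)) (ra_D (rd i))) (p : corS i -> Z'), redcorr p.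
Proof.
case: (leqP i n) => h.
  apply: red_cond => //; first exact: leqW.
  exact: (both_span_S tT h).
rewrite !rd_out //; last exact: ltnW.
by exists (corS i), id; exact: id_redcorr.
Qed.

Let alg' i := ra_D (rd i).
Let R' i : corrType (alg' i) (alg' i.+1) := sval (cid (ex_R i)).
Let S' i : corrType (alg' i.+1) (alg' i) := sval (cid (ex_S i)).
Let pR i : {p : corR i -> R' i | redcorr p} := cid (svalP (cid (ex_R i))).
Let pS i : {p : corS i -> S' i | redcorr p} := cid (svalP (cid (ex_S i))).

(** At 0 the test in [rd] computes. At [n.+1] it is only provably false, so [last_eq] does not
    reduce and [Y] needs a genuine transport. *)
Let first_eq : alg 0%N = alg' 0%N := erefl.
Let last_eq : alg n.+1 = alg' n.+1 := esym (congr1 (@ra_D R (alg n.+1)) (rd_out (ltnSn n))).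
Let X' := transport_corr first_eq X.
Let Y' := transport_corr last_eq Y.

Let tX' : interior_tensor (R' 0%N) (S' 0%N) X'.
Proof.
have [p hp] := @transport_redcorr R _ (rd 0%N) X first_eq erefl.
exact: (red_tensor (svalP (pR 0%N)) (svalP (pS 0%N)) hp tX).
Qed.

Let tY' : interior_tensor (S' n) (R' n) Y'.
Proof.
have [p hp] := @transport_redcorr R _ (rd n.+1) Y last_eq (rd_out (ltnSn n)).
exact: (red_tensor (svalP (pS n)) (svalP (pR n)) hp tY).
Qed.

Let tT' i : (i < n)%N -> exists T,
  interior_tensor (S' i) (R' i) T /\ interior_tensor (R' i.+1) (S' i.+1) T.
Proof.
move=> lt_in; have [T [hSR hRS]] := tT lt_in; have le_in := ltnW lt_in.
(* A single reduction of [T] serves both factorizations, so the link survives as an equality of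
   middle terms. *)
have [T' [p hp]] : exists (T' : corrType (alg' i.+1) (alg' i.+1)) (p : T -> T'), redcorr p.
  apply: red_cond; rewrite ?leqW //.
    move=> c z z' Jc; have [cJ _ _ _] := both_span_ideal corR corS n i.+1.
    have : pull T (J i.+1) c.
      rewrite (pull_tensor hSR) // => s s' r r'.
      by apply: (both_span_R tT le_in); apply: (both_span_S tT le_in).
    exact.
  move=> c; have [cI _ _ _] := up_ker_ideal corS i.+1; rewrite (pull_tensor hSR) //.
  by rewrite -(up_ker_R tX tT fX le_in).
exists T'; split.
  exact: (red_tensor (svalP (pS i)) (svalP (pR i)) hp hSR).
exact: (red_tensor (svalP (pR i.+1)) (svalP (pS i.+1)) hp hRS).
Qed.

Let fR' i : (i <= n)%N -> faithful_action (R' i).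
Proof.
move=> le_in d; apply: (red_injective (svalP (pR i))) => c /(rd_J _ (leqW le_in)) Jc h.
apply/(rd_ker (leqW le_in) Jc); rewrite (up_ker_R tX tT fX le_in) => z z'.
by apply/rd_ker => //; apply: (both_span_R tT le_in).
Qed.

Let fS' i : (i <= n)%N -> faithful_action (S' i).
Proof.
move=> le_in d; apply: (red_injective (svalP (pS i))) => c /(@rd_J i.+1 _ le_in) Jc h.
apply/(@rd_ker i.+1 _ le_in Jc) => z z'.
by apply/rd_ker => //; rewrite ?leqW //; apply: (both_span_S tT le_in).
Qed.

Let up_q i : (i <= n.+1)%N -> forall a, @up_span R alg corR i a ->
  @up_span R alg' R' i (ra_q (rd i) a).
Proof.
elim: i => [//|i IH] le_in a ha.
have [] := red_push (svalP (pR i)) (L := @up_span R alg corR i) (L' := @up_span R alg' R' i) _ (IH (ltnW le_in)) ha.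
  by move=> b hb; apply/rd_J; [exact: ltnW | exact: both_span_up].
by [].
Qed.

Let down_q_step i : (i <= n)%N ->
  (forall a, @down_span R alg corS n i.+1 a -> @down_span R alg' S' n i.+1 (ra_q (rd i.+1) a)) ->
  forall a, @down_span R alg corS n i a -> @down_span R alg' S' n i (ra_q (rd i) a).
Proof.
move=> le_in IH a; rewrite (down_spanE corS le_in) (down_spanE S' le_in) => ha.
have [] := red_push (svalP (pS i)) (L := @down_span R alg corS n i.+1)
  (L' := @down_span R alg' S' n i.+1) _ IH ha.
  by move=> b hb; apply/rd_J => //; exact: both_span_down.
by [].
Qed.

Let down_q i : (i <= n.+1)%N -> forall a, @down_span R alg corS n i a ->
  @down_span R alg' S' n i (ra_q (rd i) a).
Proof.
have last a : @down_span R alg corS n n.+1 a -> @down_span R alg' S' n n.+1 (ra_q (rd n.+1) a).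
  by rewrite !down_span_last.
rewrite leq_eqVlt ltnS => /orP[/eqP ->|]; first exact: last.
move: i; apply: down_ind => [|i lt_in IH]; first exact: down_q_step last.
by apply: down_q_step IH; exact: ltnW.
Qed.

(** [ra_q] is onto from [J_i] and carries its two generating ideals into their analogues for the
    reduced chain. *)
Let gen' i : (i <= n.+1)%N -> forall d, @both_span R alg' R' S' n i d.
Proof.
move=> le_in d; have [a /(rd_J _ le_in) Ja <-] := ra_surj d.
suff [] : ra_J (rd i) a /\ @both_span R alg' R' S' n i (ra_q (rd i) a) by [].
have [cP _ _ _] := both_span_ideal R' S' n i.
move: a Ja; apply: both_span_ind; first exact: ra_preim.
  move=> a ha; split; first by apply/rd_J => //; exact: both_span_up.
  by apply: both_span_up; exact: up_q.
move=> a ha; split; first by apply/rd_J => //; exact: both_span_down.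
by apply: both_span_down; exact: down_q.
Qed.

(** The same chain serves both parts of the theorem, so fullness appears as an implication. *)
Lemma chain_reduction : corr_proper X -> corr_proper Y ->
  exists c : chain (alg 0%N) (alg n.+1) n.+1, [/\ chain_links X Y c,
    forall i, (i < n)%N -> tensor_has (Defs.corS c i) (Defs.corR c i) (@regular _ _ _) /\
      tensor_has (Defs.corR c i.+1) (Defs.corS c i.+1) (@regular _ _ _) &
    full X -> full Y ->
    forall i, (i < n)%N -> tensor_has (Defs.corS c i) (Defs.corR c i) (@full _ _ _) /\
      tensor_has (Defs.corR c i.+1) (Defs.corS c i.+1) (@full _ _ _)].
Proof.
move=> pX pY; exists (@Chain R _ _ n.+1 alg' first_eq last_eq R' S').
have cR := chain_cpt_R tX' tY' tT' fR' fS' gen' (transport_cpt first_eq pX) (transport_cpt last_eq pY).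
have cS := chain_cpt_S tX' tY' tT' fR' fS' gen' (transport_cpt first_eq pX) (transport_cpt last_eq pY).
split=> /=.
- split; [exact/iso_tensorP | exact/iso_tensorP |].
  by move=> i lt_in; apply/tensor_iso_tensorP; exact: tT'.
- have reg A B (Z : corrType A B) (Z' : corrType B A) : faithful_action Z -> faithful_action Z' ->
      (forall a, cpt (fun z : Z => lact a z)) -> (forall a, cpt (fun z : Z' => lact a z)) ->
      tensor_has Z Z' (@regular _ _ _).
    move=> fZ fZ' cZ cZ' T hT; split.
      apply/corr_injectiveP/faithful_pull0 => a.
      by rewrite (pull_tensor hT); [rewrite !pull0_faithful | exact: subspace0].
    apply/corr_properP => a; have [t ht] := hT.
    by apply: (cpt_tensor ht (cidealT A) (cidealT B)).
  move=> i lt_in; have le_in := ltnW lt_in.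
  by split; apply: reg; auto.
- move=> uX uY.
  have uR := chain_full_R tY' tT' gen' (transport_full last_eq uY).
  have uS := chain_full_S tX' tY' tT' gen' (transport_full first_eq uX) (transport_full last_eq uY).
  have ful A B (Z : corrType A B) (Z' : corrType B A) :
      push Z (fun _ => True) = (fun _ => True) -> push Z' (fun _ => True) = (fun _ => True) ->
      tensor_has Z Z' (@full _ _ _).
    by move=> uZ uZ' T hT; apply/fullP; rewrite (push_tensor hT) uZ.
  move=> i lt_in; have le_in := ltnW lt_in.
  by split; apply: ful; [exact: uS | exact: uR | exact: uR | exact: uS].
Qed.

End ChainReduction.

(* The length of the chains is m = n.+1 >= 1; the index i < n stands for the
   index i.+1 in 1, ..., m - 1. *)
Theorem theorem2 (R : realType) (A B : cstarAlgType R)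
    (X : corrType A A) (Y : corrType B B) (n : nat)
    (hXY : exists c : chain A B n.+1, chain_links X Y c) :
  (regular X -> regular Y ->
     exists2 c : chain A B n.+1, chain_links X Y c &
       forall i : nat, (i < n)%N ->
         tensor_has (corS c i) (corR c i) (@regular _ _ _) /\
         tensor_has (corR c i.+1) (corS c i.+1) (@regular _ _ _)) /\
  (regular X /\ full X -> regular Y /\ full Y ->
     exists2 c : chain A B n.+1, chain_links X Y c &
       forall i : nat, (i < n)%N ->
         tensor_has (corS c i) (corR c i) (fun T => regular T /\ full T) /\
         tensor_has (corR c i.+1) (corS c i.+1) (fun T => regular T /\ full T)).
Proof.
suff main : regular X -> regular Y -> exists c : chain A B n.+1, [/\ chain_links X Y c,
    forall i, (i < n)%N -> tensor_has (corS c i) (corR c i) (@regular _ _ _) /\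
      tensor_has (corR c i.+1) (corS c i.+1) (@regular _ _ _) &
    full X -> full Y ->
    forall i, (i < n)%N -> tensor_has (corS c i) (corR c i) (@full _ _ _) /\
      tensor_has (corR c i.+1) (corS c i.+1) (@full _ _ _)].
  split=> [rX rY|[rX uX] [rY uY]]; have [c [lc rc uc]] := main rX rY; exists c => // i lt_in.
  have [r1 r2] := rc i lt_in; have [u1 u2] := uc uX uY i lt_in.
  by split=> T hT; split; auto.
move=> [/corr_injectiveP fX pX] [/corr_injectiveP fY pY].
case: hXY => -[alg eA eB corR corS] [/= lX lY lT].
(* Identifying [A] and [B] with the end algebras of the given chain removes the transports from its
   links. *)
subst A B; move: lX lY => /= /iso_tensorP tX /iso_tensorP tY.
apply: (chain_reduction tX tY) => //.
by move=> i /lT/tensor_iso_tensorP.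
Qed.
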